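(* There is a deterministic polynomial-time $4$-approximation algorithm for $2$-column-sparse packing integer programs (with multiplicity constraints). There is also a randomized polynomial-time $(6-\sqrt5)$-approximation algorithm for simple $2$-column-sparse packing integer programs with $d=\mathbf{1}$.
   Context: A packing integer program is $\{\max c\cdot x: Ax\le b,\ 0\le x\le d,\ x\text{ integral}\}$ with $A,b,c,d$ nonnegative rational (entries of $d$ may be $+\infty$, finite ones integral). It is $2$-column-sparse if each column of $A$ has at most 2 nonzero entries. Writing $A_j$ for the $j$th column and $\mathrm{supp}(A_j)=\{i: A_{ij}>0\}$, a 2-column-sparse PIP is non-simple if there exist distinct $j,j'$ with $\mathrm{supp}(A_j)=\mathrm{supp}(A_{j'})$ and $|\mathrm{supp}(A_j)|=2$; otherwise it is simple. An $\alpha$-approximation algorithm returns a feasible solution of value at least $1/\alpha$ times optimal (for the randomized algorithm, in expectation). *)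

(* Defs.v *)
From HB Require Import structures.
From mathcomp Require Import all_boot all_order all_algebra.

Set Implicit Arguments.
Unset Strict Implicit.
Unset Printing Implicit Defensive.

Import Order.TTheory GRing.Theory Num.Theory.
Local Open Scope ring_scope.

(* [pip_d P j = None] stands for the multiplicity bound d_j = +oo. *)
Record pip (m n : nat) := Pip {
  pip_A : 'M[rat]_(m, n);
  pip_b : 'cV[rat]_m;
  pip_c : 'rV[rat]_n;
  pip_d : 'I_n -> option nat;
  pip_A_ge0 : forall i j, 0 <= pip_A i j;
  pip_b_ge0 : forall i, 0 <= pip_b i 0;
  pip_c_ge0 : forall j, 0 <= pip_c 0 j
}.

Section Pip.
Variables (m n : nat) (P : pip m n).

Definition feasible (x : 'cV[int]_n) : Prop :=
  [/\ forall i, (pip_A P *m map_mx intr x) i 0 <= pip_b P i 0,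
      forall j, 0 <= x j 0 &
      forall j u, pip_d P j = Some u -> x j 0 <= u%:Z].

Definition objective (x : 'cV[int]_n) : rat := (pip_c P *m map_mx intr x) 0 0.

Definition optimal (x : 'cV[int]_n) : Prop :=
  feasible x /\ forall y, feasible y -> objective y <= objective x.

Definition supp (j : 'I_n) : {set 'I_m} := [set i | 0 < pip_A P i j].

Definition two_column_sparse : Prop :=
  forall j, (#|[set i | pip_A P i j != 0%R]| <= 2)%N.

Definition non_simple : Prop :=
  exists j j', [/\ j != j', supp j = supp j' & #|supp j| = 2%N].

Definition simple_pip : Prop := ~ non_simple.

Definition unit_multiplicity : Prop := forall j, pip_d P j = Some 1%N.

Definition encode_rat (q : rat) : seq nat := [:: `|numq q|%N; `|denq q|%N].

Definition encode_bound (u : option nat) : seq nat :=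
  if u is Some k then [:: 1%N; k] else [:: 0%N; 0%N].

(* Dimensions, then A in row-major order, then b, c and d; rationals are in
   lowest terms. *)
Definition encode : seq nat :=
  [:: m, n &
      flatten [seq encode_rat (pip_A P i j) | i <- enum 'I_m, j <- enum 'I_n] ++
      flatten [seq encode_rat (pip_b P i 0) | i <- enum 'I_m] ++
      flatten [seq encode_rat (pip_c P 0 j) | j <- enum 'I_n] ++
      flatten [seq encode_bound (pip_d P j) | j <- enum 'I_n]].

End Pip.

(* Model of computation: the random access machine with the logarithmic
   cost criterion (Aho, Hopcroft, Ullman), with structured control flow and a
   fair-coin instruction [Toss]; each instruction costs the bit lengths of the
   values and memory addresses that it handles. *)

(* Number of binary digits of k; 0 has one digit. *)
Definition bitlen (k : nat) : nat := (trunc_log 2 k).+1.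

Definition bitsize (s : seq nat) : nat := (\sum_(k <- s) bitlen k)%N.

Inductive arith := Add | Sub | Mul | Div.

Definition eval_arith (o : arith) : nat -> nat -> nat :=
  match o with Add => addn | Sub => subn | Mul => muln | Div => divn end.

(* Registers are addressed by literals only, so a program uses finitely many;
   the unbounded memory is addressed through registers by [Read] and [Write]. *)
Inductive cmd :=
| Const (r k : nat)
| Arith (o : arith) (r r1 r2 : nat)
| Read (r ra : nat)
| Write (ra r : nat)
| Toss (r : nat)
| Skip
| Seq (c1 c2 : cmd)
| If (r : nat) (c1 c2 : cmd)
| While (r : nat) (c : cmd).

(* [coins] are the outcomes of the tosses still to come. *)
Record state := State {
  reg : nat -> nat;
  ram : nat -> nat;
  coins : seq bool
}.

Definition upd (f : nat -> nat) (a v : nat) : nat -> nat :=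
  fun a' => if a' == a then v else f a'.

Definition set_reg (s : state) (r v : nat) : state :=
  State (upd (reg s) r v) (ram s) (coins s).

Definition set_ram (s : state) (a v : nat) : state :=
  State (reg s) (upd (ram s) a v) (coins s).

(* [exec c s k s']: from [s], [c] halts in [s'] at logarithmic cost [k]. *)
Inductive exec : cmd -> state -> nat -> state -> Prop :=
| ExecConst r v s :
    exec (Const r v) s (bitlen v) (set_reg s r v)
| ExecArith o r r1 r2 s :
    exec (Arith o r r1 r2) s (bitlen (reg s r1) + bitlen (reg s r2))%N
      (set_reg s r (eval_arith o (reg s r1) (reg s r2)))
| ExecRead r ra s :
    exec (Read r ra) s (bitlen (reg s ra) + bitlen (ram s (reg s ra)))%N
      (set_reg s r (ram s (reg s ra)))
| ExecWrite ra r s :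
    exec (Write ra r) s (bitlen (reg s ra) + bitlen (reg s r))%N
      (set_ram s (reg s ra) (reg s r))
| ExecToss r f g b t :
    exec (Toss r) (State f g (b :: t)) 1 (State (upd f r (nat_of_bool b)) g t)
| ExecSkip s :
    exec Skip s 1 s
| ExecSeq c1 c2 s1 s2 s3 k1 k2 :
    exec c1 s1 k1 s2 -> exec c2 s2 k2 s3 -> exec (Seq c1 c2) s1 (k1 + k2)%N s3
| ExecIfTrue r c1 c2 s s' k :
    reg s r != 0%N -> exec c1 s k s' ->
    exec (If r c1 c2) s (bitlen (reg s r) + k)%N s'
| ExecIfFalse r c1 c2 s s' k :
    reg s r = 0%N -> exec c2 s k s' ->
    exec (If r c1 c2) s (bitlen (reg s r) + k)%N s'
| ExecWhileTrue r c s1 s2 s3 k1 k2 :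
    reg s1 r != 0%N -> exec c s1 k1 s2 -> exec (While r c) s2 k2 s3 ->
    exec (While r c) s1 (bitlen (reg s1 r) + k1 + k2)%N s3
| ExecWhileFalse r c s :
    reg s r = 0%N ->
    exec (While r c) s (bitlen (reg s r)) s.

Definition init (input : seq nat) (t : seq bool) : state :=
  State (fun=> 0%N) (nth 0%N input) t.

Definition output (n : nat) (s : state) : 'cV[int]_n := \col_j (ram s j)%:Z.

Definition computes (n : nat) (c : cmd) (input : seq nat) (t : seq bool)
    (T : nat) (x : 'cV[int]_n) : Prop :=
  exists k s, [/\ exec c (init input t) k s, (k <= T)%N & output n s = x].

Lemma exec_det c s k1 s1 k2 s2 :
  exec c s k1 s1 -> exec c s k2 s2 -> k1 = k2 /\ s1 = s2.
Proof.
move=> e1; elim: e1 k2 s2 => {c s k1 s1}.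
- by move=> r v s k2 s2 e; inversion e; subst.
- by move=> o r r1 r2 s k2 s2 e; inversion e; subst.
- by move=> r ra s k2 s2 e; inversion e; subst.
- by move=> ra r s k2 s2 e; inversion e; subst.
- by move=> r f g b t k2 s2 e; inversion e; subst.
- by move=> s k2 s2 e; inversion e; subst.
- move=> c1 c2 s1 s2 s3 k1 k2 _ IH1 _ IH2 k s e; inversion e; subst.
  match goal with H : exec c1 _ _ _ |- _ => case: (IH1 _ _ H) => *; subst end.
  by match goal with H : exec c2 _ _ _ |- _ => case: (IH2 _ _ H) => -> -> end.
- move=> r c1 c2 s s' k rn0 _ IH k2 s2 e; inversion e; subst.
    by match goal with H : exec c1 _ _ _ |- _ => case: (IH _ _ H) => -> -> end.
  by match goal with H : reg s r = 0%N |- _ => rewrite H in rn0 end.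
- move=> r c1 c2 s s' k r0 _ IH k2 s2 e; inversion e; subst.
    by match goal with H : is_true (reg s r != _) |- _ => rewrite r0 in H end.
  by match goal with H : exec c2 _ _ _ |- _ => case: (IH _ _ H) => -> -> end.
- move=> r c s1 s2 s3 k1 k2 rn0 _ IH1 _ IH2 k s e; inversion e; subst.
    match goal with H : exec c _ _ _ |- _ => case: (IH1 _ _ H) => *; subst end.
    by match goal with
       | H : exec (While r c) _ _ _ |- _ => case: (IH2 _ _ H) => -> ->
       end.
  by match goal with H : reg _ r = 0%N |- _ => rewrite H in rn0 end.
- move=> r c s r0 k2 s2 e; inversion e; subst => //.
  by match goal with H : is_true (reg s r != _) |- _ => rewrite r0 in H end.
Qed.

Definition pip_class := forall m n : nat, pip m n -> Prop.

(* The tape of coins is empty: a [Toss] would block the execution.  The ratio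
   is required of the instances that have an optimal solution; the others (a
   null column with d_j = +oo and c_j > 0) are unbounded, and on them the
   algorithm has only to return a feasible solution in time. *)
Definition det_poly_approx (R : rcfType) (alpha : R) (K : pip_class) : Prop :=
  exists (c : cmd) (p : {poly nat}),
    forall (m n : nat) (P : pip m n), K m n P ->
    exists x : 'cV[int]_n,
      [/\ computes c (encode P) [::] p.[bitsize (encode P)] x,
          feasible P x &
          forall y, optimal P y ->
            alpha^-1 * ratr (objective P y) <= ratr (objective P x)].

(* The time bound holds for all outcomes of the tosses, so T coins are enough
   for time T, and the expectation is the mean over the T-bit tapes. *)
Definition rand_poly_approx (R : rcfType) (alpha : R) (K : pip_class) : Prop :=
  exists (c : cmd) (p : {poly nat}),
    forall (m n : nat) (P : pip m n), K m n P ->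
    let T := p.[bitsize (encode P)] in
    exists x : T.-tuple bool -> 'cV[int]_n,
      [/\ forall t : T.-tuple bool, computes c (encode P) t T (x t),
          forall t, feasible P (x t) &
          forall y, optimal P y ->
            alpha^-1 * ratr (objective P y) <=
              (2 ^+ T)^-1 * \sum_(t : T.-tuple bool) ratr (objective P (x t))].

(* Main.v *)
Require Import Defs.
From mathcomp Require Import all_boot all_order all_algebra.
From mathcomp Require Import zify ring lra.

Set Implicit Arguments.
Unset Strict Implicit.
Unset Printing Implicit Defensive.

Import Order.TTheory GRing.Theory Num.Theory.

(** A single deterministic algorithm of ratio 15/4 serves both claims, because
    15/4 <= 6 - sqrt 5 < 4.

    After clearing denominators, a variable bounded by [U] is split in binary into
    at most [log U] items to be taken 0 or 1 times; the item [e] has size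
    [sz i e] in the at most two rows [i] that it meets.  The items are packed by the
    local ratio technique: picking [e] of weight [w e] decreases the weight of each
    other item [f] by [w e] times the sum over the rows [i] of [e] of
    [min (sz i f) d / d], where [d = b i - sz i e].  When the recursive solution
    leaves no room for [e], it already has charge at least 1, so the ratio is the
    largest charge of a fractional solution, and it is enough to find a fractional
    solution of nearly maximal weight with charge at most 3.  For a vertex of the
    relaxation, the number of fractional items is at most the number of rows they
    meet, hence by counting some item meets only rows with few fractional items, and
    has charge at most 3.

    Vertices are not computed.  For each candidate [e], the packing linear program
    with the additional constraint that the charge of [e] is at most 3 is solved
    approximately by a greedy method with quadratic potential, and the candidate of
    largest value is picked.  It loses a factor [1 - 1 / (5 n)], for a total of at
    least 4/5 over the at most [n] rounds, and 3 / (4/5) = 15/4. *)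

(** * A loop language and its compilation to the random access machine *)

(** The 3 arises in two ways: an item counts 1 for itself and at most 1 for each of its two rows, or
    it shares a single row in which at most two other items are smaller. The distance from 3 to
    [6 - sqrt 5], about 3.764, is the budget for approximate computation: a loss [d] gives
    [3 / (1 - d)], so [d = 1/5] is nearly all that can be afforded. Bernoulli's inequality spreads
    it over the rounds.

    An approximate solver does not deliver a vertex. But the charge of one fixed item is a linear
    function, and by the counting argument there is an item for which bounding it by 3 costs no
    value; trying every item therefore replaces the vertex.

    The cost model, which counts bits, shapes the rest. All data are integers, ratios are compared
    by cross multiplication, and the weights are multiplied by denominators in each round; their
    length stays polynomial because the rounds are few and each factor is short. Truncating every
    store at a cap makes a compiled program polynomial whatever it computes; correctness then
    includes a proof that the cap never alters a value that matters. *)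

(* Variable 0 holds the common bound of all loops and big operators, and variable
   1 the cap to which every stored value is truncated, so that all values keep
   polynomial bit length.  Array 0 is the input and the output; its indices are
   truncated to the length [L] of the input. *)
Inductive bigop_kind := BSum | BProd.

Inductive expr :=
| Var (x : nat)
| Cst (c : nat)
| Bin (o : arith) (a b : expr)
| Rd (k : nat) (a : expr)
| Ite (c a b : expr)
| Big (o : bigop_kind) (x : nat) (e : expr).

Inductive prog :=
| Wr (k : nat) (a e : expr)
| PSeq (p1 p2 : prog)
| For (x : nat) (p : prog).

Definition env := nat -> nat.
Definition memory := nat -> nat -> nat.

Definition updm (A : memory) (k i v : nat) : memory :=
  fun k' => if k' == k then upd (A k) i v else A k'.

Definition clampi (L k i : nat) : nat := if k == 0 then minn i L else i.

Fixpoint evalE (L : nat) (s : env) (A : memory) (e : expr) : nat :=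
  match e with
  | Var x => s x
  | Cst c => c
  | Bin o a b => eval_arith o (evalE L s A a) (evalE L s A b)
  | Rd k a => A k (clampi L k (evalE L s A a))
  | Ite c a b =>
      if evalE L s A c != 0 then evalE L s A a else evalE L s A b
  | Big BSum x e => \sum_(0 <= i < s 0) evalE L (upd s x i) A e
  | Big BProd x e => \prod_(0 <= i < s 0) evalE L (upd s x i) A e
  end.

(* The loops run downwards, as the compiled [While] tests its counter against 0. *)
Fixpoint loop (T : Type) (n : nat) (f : nat -> T -> T) (x : T) : T :=
  if n is n'.+1 then loop n' f (f n' x) else x.

Fixpoint evalP (L : nat) (p : prog) (s : env) (A : memory) : memory :=
  match p with
  | Wr k a e => updm A k (clampi L k (evalE L s A a)) (minn (evalE L s A e) (s 1))
  | PSeq p1 p2 => evalP L p2 s (evalP L p1 s A)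
  | For x p => loop (s 0) (fun i A' => evalP L p (upd s x i) A') A
  end.

Definition nkeys := 32.

Fixpoint wfE (e : expr) : bool :=
  match e with
  | Var _ | Cst _ => true
  | Bin _ a b => wfE a && wfE b
  | Rd k a => (k < nkeys) && wfE a
  | Ite c a b => [&& wfE c, wfE a & wfE b]
  | Big _ _ e => wfE e
  end.

Fixpoint wfP (p : prog) : bool :=
  match p with
  | Wr k a e => [&& k < nkeys, wfE a & wfE e]
  | PSeq p1 p2 => wfP p1 && wfP p2
  | For _ p => wfP p
  end.

(* Register 0 holds [L], the even registers hold the variables, and the odd ones
   are the stack of temporaries. *)
Definition rv (x : nat) : nat := x.*2.+2.
Definition rt (t : nat) : nat := t.*2.+1.

(** Array 0 stays where the machine receives its input and leaves its output, with cell [L] as a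
    spare; the other arrays are unbounded, hence interleaved beyond it with stride [nkeys]. *)
Definition addr (L k i : nat) : nat :=
  if k == 0 then i else L + 1 + (i * nkeys + k).

(** The machine has no minimum, but its subtraction is truncated at 0, so that [i - (i - L)] is
    [minn i L]. [compP] caps stored values in the same way. *)
Definition compA (t k : nat) : cmd :=
  if k == 0 then
    Seq (Arith Defs.Sub (rt t.+1) (rt t) 0) (Arith Defs.Sub (rt t) (rt t) (rt t.+1))
  else
    Seq (Const (rt t.+1) nkeys)
   (Seq (Arith Defs.Mul (rt t) (rt t) (rt t.+1))
   (Seq (Const (rt t.+1) k.+1)
   (Seq (Arith Defs.Add (rt t) (rt t) (rt t.+1))
        (Arith Defs.Add (rt t) (rt t) 0)))).

Definition mov (r r' : nat) : cmd := Seq (Const r 0) (Arith Defs.Add r r' r).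

Definition bk_id o := if o is BSum then 0 else 1.
Definition bk_op o := if o is BSum then Defs.Add else Defs.Mul.

(** Calling convention: the value is left in [rt t], and only temporaries from [rt t] on are
    changed. A big operator accumulates in [rt t], keeps the old value of its variable in [rt t.+1]
    to restore it at the end, and evaluates its body from level [t.+2]. *)
Fixpoint compE (t : nat) (e : expr) : cmd :=
  match e with
  | Var x => mov (rt t) (rv x)
  | Cst c => Const (rt t) c
  | Bin o a b =>
      Seq (compE t a) (Seq (compE t.+1 b) (Arith o (rt t) (rt t) (rt t.+1)))
  | Rd k a => Seq (compE t a) (Seq (compA t k) (Read (rt t) (rt t)))
  | Ite c a b => Seq (compE t c) (If (rt t) (compE t a) (compE t b))
  | Big o x e =>
      Seq (mov (rt t.+1) (rv x))
     (Seq (Const (rt t) (bk_id o))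
     (Seq (mov (rt t.+2) (rv 0))
     (Seq (mov (rv x) (rt t.+2))
     (Seq (While (rv x)
             (Seq (Const (rt t.+2) 1)
             (Seq (Arith Defs.Sub (rv x) (rv x) (rt t.+2))
             (Seq (compE t.+2 e)
                  (Arith (bk_op o) (rt t) (rt t) (rt t.+2))))))
          (mov (rv x) (rt t.+1))))))
  end.

Fixpoint compP (t : nat) (p : prog) : cmd :=
  match p with
  | Wr k a e =>
      Seq (compE t a) (Seq (compA t k)
     (Seq (compE t.+1 e)
     (Seq (Arith Defs.Sub (rt t.+2) (rt t.+1) (rv 1))
     (Seq (Arith Defs.Sub (rt t.+1) (rt t.+1) (rt t.+2))
          (Write (rt t) (rt t.+1))))))
  | PSeq p1 p2 => Seq (compP t p1) (compP t p2)
  | For x p =>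
      Seq (mov (rt t) (rv x))
     (Seq (mov (rt t.+1) (rv 0))
     (Seq (mov (rv x) (rt t.+1))
     (Seq (While (rv x)
             (Seq (Const (rt t.+1) 1)
             (Seq (Arith Defs.Sub (rv x) (rv x) (rt t.+1))
                  (compP t.+1 p))))
          (mov (rv x) (rt t)))))
  end.

(* With at most [q] iterations per loop and stored values below [2 ^ W], [bE]
   bounds the bit length of a value, and [tE] and [tP] bound the cost. *)
Section Bounds.
Variables (q W : nat).

Fixpoint bE (e : expr) : nat :=
  match e with
  | Var _ => W
  | Cst c => c.+1
  | Bin _ a b => (bE a + bE b).+1
  | Rd _ a => W + bE a
  | Ite c a b => bE c + bE a + bE b
  | Big _ _ e => q.+1 * (bE e).+1
  end.

Fixpoint tE (e : expr) : nat :=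
  match e with
  | Var _ => W + 3
  | Cst c => c.+1
  | Bin _ a b => tE a + tE b + bE a + bE b
  | Rd k a => tE a + 9 * (bE a + W + nkeys + k + 9)
  | Ite c a b => tE c + tE a + tE b + bE c
  | Big o x e =>
      8 * (W + 9) + q.+1 * (tE e + bE e + 3 * (W + 9) + q.+1 * (bE e).+1)
  end.

Fixpoint tP (p : prog) : nat :=
  match p with
  | Wr k a e =>
     tE a + tE e + 9 * (bE a + bE e + W + nkeys + k + 9)
  | PSeq p1 p2 => tP p1 + tP p2
  | For x p => 8 * (W + 9) + q.+1 * (tP p + 3 * (W + 9))
  end.
End Bounds.

(** The closure properties of this predicate spare an explicit polynomial for [tE] and [tP], which
    are recursive in the program. *)
Definition pbounded (f : nat -> nat) : Prop :=
  exists p : {poly nat}, forall x, f x <= p.[x]%R.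

Lemma pb_const c : pbounded (fun=> c).
Proof. by exists (c%:P)%R => x; rewrite hornerC. Qed.

Lemma pb_id : pbounded id.
Proof. by exists 'X%R => x; rewrite hornerX. Qed.

Lemma pb_add f g : pbounded f -> pbounded g -> pbounded (fun x => f x + g x).
Proof. by case=> p hp [r hr]; exists (p + r)%R => x; rewrite hornerD leq_add. Qed.

Lemma pb_mul f g : pbounded f -> pbounded g -> pbounded (fun x => f x * g x).
Proof. by case=> p hp [r hr]; exists (p * r)%R => x; rewrite hornerM leq_mul. Qed.

Lemma poly_nat_mono (p : {poly nat}) x y : x <= y -> (p.[x])%R <= (p.[y])%R.
Proof.
move=> xy; elim/poly_ind: p => [|p c IH]; first by rewrite !horner0.
by rewrite !hornerMXaddC; apply: leq_add => //; apply: leq_mul.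
Qed.

Lemma bitlen_le v b : v < 2 ^ b -> 0 < b -> bitlen v <= b.
Proof.
case: v => [|v] h b0; first by rewrite /bitlen trunc_log0.
by rewrite /bitlen -(@ltn_exp2l 2) // (leq_ltn_trans _ h) // trunc_logP.
Qed.

Lemma rv_inj x y : (rv x == rv y) = (x == y).
Proof. by rewrite /rv; lia. Qed.

Lemma rt_inj x y : (rt x == rt y) = (x == y).
Proof. by rewrite /rt; lia. Qed.

Lemma rv_rt x t : (rv x == rt t) = false.
Proof. by rewrite /rv /rt; lia. Qed.

Lemma rt_rv x t : (rt t == rv x) = false.
Proof. by rewrite /rv /rt; lia. Qed.

Lemma evalE_ext L A e s s' : s =1 s' -> evalE L s A e = evalE L s' A e.
Proof.
elim: e s s' => //= [o a IHa b IHb|k a IHa|c IHc a IHa b IHb|o x e IH] s s' h.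
- by rewrite (IHa _ _ h) (IHb _ _ h).
- by rewrite (IHa _ _ h).
- by rewrite (IHa _ _ h) (IHb _ _ h) (IHc _ _ h).
- have h' i : upd s x i =1 upd s' x i by move=> y; rewrite /upd h.
  by case: o; rewrite h; apply: eq_bigr => i _; apply: IH.
Qed.

Lemma evalP_ext L p s s' A : s =1 s' -> evalP L p s A = evalP L p s' A.
Proof.
elim: p s s' A => [k a e|p1 IH1 p2 IH2|x p IH] s s' A h /=.
- by rewrite (evalE_ext _ _ a h) (evalE_ext _ _ e h) h.
- by rewrite (IH1 _ _ _ h) (IH2 _ _ _ h).
- rewrite h; elim: (s' 0) A => //= n IHn A.
  by rewrite IHn; congr loop; apply: IH => y; rewrite /upd h.
Qed.

Definition frame (t : nat) (s s' : state) : Prop :=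
  forall r, (forall u, t <= u -> r != rt u) -> reg s' r = reg s r.

Lemma frame_trans t s1 s2 s3 : frame t s1 s2 -> frame t s2 s3 -> frame t s1 s3.
Proof. by move=> h1 h2 r hr; rewrite h2 // h1. Qed.

Lemma frame_le t t' s1 s2 : t <= t' -> frame t' s1 s2 -> frame t s1 s2.
Proof. by move=> tt h r hr; apply: h => u hu; apply: hr; lia. Qed.

Lemma frame_set t u s v : t <= u -> frame t s (set_reg s (rt u) v).
Proof. by move=> tu r hr; rewrite /= /upd (negbTE (hr _ tu)). Qed.

Lemma frame_rv t s s' x : frame t s s' -> reg s' (rv x) = reg s (rv x).
Proof. by apply=> u _; rewrite rv_rt. Qed.

Lemma frame_rt t s s' u : frame t s s' -> u < t -> reg s' (rt u) = reg s (rt u).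
Proof. by move=> h ut; apply: h => v hv; rewrite rt_inj; lia. Qed.

Lemma frame_r0 t s s' : frame t s s' -> reg s' 0 = reg s 0.
Proof. by apply=> u _; rewrite /rt; lia. Qed.

Lemma exec_mov r r' s : r != r' ->
  exists s', [/\ exec (mov r r') s (bitlen (reg s r') + 2) s',
    ram s' = ram s, reg s' r = reg s r' &
    forall r'', r'' != r -> reg s' r'' = reg s r''].
Proof.
move=> rr; pose s1 := set_reg s r 0.
exists (set_reg s1 r (eval_arith Defs.Add (reg s1 r') (reg s1 r))); split => //.
- have -> : bitlen (reg s r') + 2 = bitlen 0 + (bitlen (reg s1 r') + bitlen (reg s1 r)).
    by rewrite /s1 /= /upd eqxx eq_sym (negbTE rr) /bitlen trunc_log0; lia.
  by apply: ExecSeq; [apply: ExecConst | apply: ExecArith].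
- by rewrite /= /upd !eqxx eq_sym (negbTE rr) addn0.
- by move=> r'' h; rewrite /= /upd (negbTE h).
Qed.

(** * Correctness and cost of the compiler *)

Section Compiler.
Variables (q W L : nat).
Hypotheses (qW : q < 2 ^ W) (LW : L < 2 ^ W) (W0 : 0 < W).

Definition good (s : env) : Prop := s 0 <= q /\ forall x, s x < 2 ^ W.
Definition goodm (A : memory) : Prop := forall k i, A k i < 2 ^ W.
Definition rep (A : memory) (s : state) : Prop :=
  reg s 0 = L /\ forall k i, k < nkeys -> (k == 0 -> i <= L) ->
    ram s (addr L k i) = A k i.
Definition env_of (s : state) : env := fun x => reg s (rv x).

Lemma good_upd s x i : good s -> i < q -> good (upd s x i).
Proof.
case=> h0 h iq; split; first by rewrite /upd; case: eqP => // _; lia.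
by move=> y; rewrite /upd; case: eqP => // _; lia.
Qed.

Lemma bE_gt0 e : 0 < bE q W e.
Proof. by elim: e => //=; lia. Qed.

Lemma expn_add_bound a b u v : u < 2 ^ a -> v < 2 ^ b -> u + v < 2 ^ (a + b).
Proof. by rewrite expnD => h1 h2; nia. Qed.

Lemma sum_lt_bound m n b (F : nat -> nat) : n <= q ->
  (forall i, i < n -> F i < 2 ^ b) ->
  \sum_(m <= i < n) F i < 2 ^ (q.+1 * b.+1).
Proof.
move=> nq h; have : \sum_(m <= i < n) F i <= (n - m) * 2 ^ b.
  rewrite -sum_nat_const_nat big_nat [X in _ <= X]big_nat.
  by apply: leq_sum => i /andP[_ hi]; apply: ltnW; apply: h.
move/leq_ltn_trans; apply.
have h1 : n < 2 ^ n by apply: ltn_expl.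
have : (n - m) * 2 ^ b < 2 ^ (n + b) by rewrite expnD ltn_pmul2r ?expn_gt0; lia.
move/leq_trans; apply; rewrite leq_exp2l //; nia.
Qed.

Lemma prod_lt_bound m n b (F : nat -> nat) : n <= q ->
  (forall i, i < n -> F i < 2 ^ b) ->
  \prod_(m <= i < n) F i < 2 ^ (q.+1 * b.+1).
Proof.
move=> nq h; have : \prod_(m <= i < n) F i <= 2 ^ (n * b).
  elim: n nq h => [|n IH] nq h; first by rewrite big_geq.
  case: (leqP m n) => mn; last by rewrite big_geq // expn_gt0.
  rewrite big_nat_recr //= mulSn addnC expnD leq_mul ?IH //; first by lia.
    by move=> i hi; apply: h; lia.
  by apply: ltnW; apply: h.
move/leq_ltn_trans; apply; rewrite ltn_exp2l //; nia.
Qed.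

(** Only stored values are truncated, so intermediate values need this static bound, which depends
    on the syntax of the expression and on [q] and [W] alone. *)
Lemma evalE_bound A e s : goodm A -> good s -> evalE L s A e < 2 ^ bE q W e.
Proof.
move=> gA; elim: e s => /= [x|c|o a IHa b IHb|k a IHa|c IHc a IHa b IHb|o x e IH] s gs.
- by case: gs.
- by have := @ltn_expl 2 c isT; move/leq_trans; apply; rewrite leq_exp2l.
- have ha := IHa s gs; have hb := IHb s gs.
  rewrite expnS; set u := evalE _ _ _ a in ha *; set v := evalE _ _ _ b in hb *.
  have hs := expn_add_bound ha hb.
  case: o => /=; try lia.
  + by rewrite expnD; nia.
  + by have := leq_div u v; lia.
- by apply: leq_trans (gA _ _) _; rewrite leq_exp2l //; lia.
- case: ifP => _; [apply: leq_trans (IHa s gs) _|apply: leq_trans (IHb s gs) _];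
  by rewrite leq_exp2l //; lia.
- have gs' i : i < s 0 -> good (upd s x i).
    by move=> hi; apply: good_upd => //; case: gs; lia.
  by case: o; [apply: sum_lt_bound|apply: prod_lt_bound]; case: (gs) => // ? ? i hi;
    apply: IH; apply: gs'.
Qed.

Lemma compA_ok t k b s : k < nkeys -> reg s (rt t) < 2 ^ b -> 0 < b -> reg s 0 = L ->
  exists kc s', [/\ exec (compA t k) s kc s', kc <= 7 * (b + W + nkeys + k + 9),
    reg s' (rt t) = addr L k (clampi L k (reg s (rt t))), frame t s s' &
    ram s' = ram s].
Proof.
move=> hk; set i := reg s (rt t) => hi b0 h0.
have E0 u : (0 == rt u) = false by rewrite /rt; lia.
have E1 : (t.+1 == t) = false by lia.
have E2 : (t == t.+1) = false by lia.
have bi : bitlen i <= b by apply: bitlen_le.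
have bL : bitlen L <= W by apply: bitlen_le.
rewrite /compA /addr /clampi; case: eqP => [k0|/eqP k0].
- eexists; eexists; split.
  + by eapply ExecSeq; [apply: ExecArith|apply: ExecArith].
  + rewrite /= /upd ?eqxx ?rt_inj ?E0 ?E1 ?E2 -/i h0.
    have : bitlen (i - L) <= b by apply: bitlen_le => //; lia.
    by lia.
  + by rewrite /= /upd ?eqxx ?rt_inj ?E0 ?E1 ?E2 -/i h0; lia.
  + move=> r hr; rewrite /= /upd.
    by rewrite (negbTE (hr t _)) // (negbTE (hr t.+1 _)).
  + by [].
- eexists; eexists; split.
  + by do 4 (eapply ExecSeq; [constructor|]); constructor.
  + rewrite /= /upd ?eqxx ?rt_inj ?E0 ?E1 ?E2 -/i h0.
    have h1 : bitlen nkeys <= 6 by [].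
    have h2 : bitlen k.+1 <= 6.
      by apply: bitlen_le => //; move: hk; rewrite /nkeys; have -> : 2 ^ 6 = 64 by []; lia.
    have h3 : bitlen (i * nkeys) <= b + 6.
      apply: bitlen_le; last by lia.
      by rewrite expnD /nkeys; lia.
    have h4 : bitlen (i * nkeys + k.+1) <= b + 6.
      apply: bitlen_le; last by lia.
      by move: hk; rewrite expnD /nkeys; lia.
    by rewrite /nkeys in h1 h2 h3 h4 *; lia.
  + by rewrite /= /upd ?eqxx ?rt_inj ?E0 ?E1 ?E2 -/i h0; lia.
  + move=> r hr; rewrite /= /upd.
    by rewrite (negbTE (hr t _)) // (negbTE (hr t.+1 _)).
  + by [].
Qed.

Lemma addr_lt k i b : k < nkeys -> i < 2 ^ b ->
  addr L k (clampi L k i) < 2 ^ (b + W + 6).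
Proof.
move=> hk hi; rewrite /addr /clampi; case: eqP => _.
  apply: leq_ltn_trans (geq_minl _ _) _; apply: leq_trans hi _.
  by rewrite leq_exp2l //; lia.
move: hk; rewrite /nkeys => hk; rewrite !expnD.
have h1 : L + 1 <= 2 ^ W by lia.
have h2 : i.+1 <= 2 ^ b by [].
have -> : 2 ^ 6 = 64 by [].
nia.
Qed.

Lemma rep_frame t A s s' : frame t s s' -> ram s' = ram s -> rep A s -> rep A s'.
Proof. by move=> f r [h0 h]; split; rewrite ?(frame_r0 f) ?r. Qed.

Lemma env_frame t s s' : frame t s s' -> env_of s' =1 env_of s.
Proof. by move=> f x; rewrite /env_of (frame_rv _ f). Qed.

Lemma good_ext s s' : s =1 s' -> good s -> good s'.
Proof. by move=> e [h0 h]; split => [|x]; rewrite -e. Qed.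

Lemma compBig_ok A o x e :
  (wfE e -> forall t s, good (env_of s) -> rep A s ->
    exists k s', [/\ exec (compE t e) s k s', k <= tE q W e,
      reg s' (rt t) = evalE L (env_of s) A e, frame t s s' & ram s' = ram s]) ->
  wfE e -> goodm A -> forall t s, good (env_of s) -> rep A s ->
  exists k s', [/\ exec (compE t (Big o x e)) s k s', k <= tE q W (Big o x e),
    reg s' (rt t) = evalE L (env_of s) A (Big o x e), frame t s s' &
    ram s' = ram s].
Proof.
move=> IH we gA t s gs rs.
pose f i := evalE L (upd (env_of s) x i) A e.
pose opn := eval_arith (bk_op o).
pose N0 := reg s (rv 0).
(* The counter runs down, so with [n] iterations left the accumulator holds the operator over the
   indices from [n] to [N0 - 1]; by commutativity the next value may be appended on the right. *)
pose res n := if o is BSum then \sum_(n <= i < N0) f i else \prod_(n <= i < N0) f i.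
pose b := q.+1 * (bE q W e).+1.
have N0q : N0 <= q by case: gs.
have sb r : reg s (rv r) < 2 ^ W by case: gs => _; apply.
have fb i : i < N0 -> f i < 2 ^ bE q W e.
  by move=> hi; apply: evalE_bound => //; apply: good_upd => //; lia.
have b0 : 0 < b by rewrite /b; nia.
have resb n : res n < 2 ^ b.
  by rewrite /res; case: (o); [apply: sum_lt_bound | apply: prod_lt_bound].
have resS n : n < N0 -> res n = opn (res n.+1) (f n).
  by move=> h; rewrite /res /opn; case: (o); rewrite /= big_ltn // 1?addnC 1?mulnC.
pose body := Seq (Const (rt t.+2) 1)
  (Seq (Arith Defs.Sub (rv x) (rv x) (rt t.+2))
  (Seq (compE t.+2 e) (Arith (bk_op o) (rt t) (rt t) (rt t.+2)))).
have E01 : (rt t == rt t.+2) = false by rewrite rt_inj; lia.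
have E12 : (rt t.+1 == rt t.+2) = false by rewrite rt_inj; lia.
have E10 : (rt t.+1 == rt t) = false by rewrite rt_inj; lia.
have E21 : (rt t.+2 == rt t.+1) = false by rewrite rt_inj; lia.
have E20 : (rt t.+2 == rt t) = false by rewrite rt_inj; lia.
have E02 : (rt t == rt t.+1) = false by rewrite rt_inj; lia.
pose cst := tE q W e + bE q W e + 3 * (W + 9) + b.
have main n s1 : n <= N0 -> reg s1 (rv x) = n ->
    (forall r, (forall u, t <= u -> r != rt u) -> r != rv x -> reg s1 r = reg s r) ->
    reg s1 (rt t) = res n -> ram s1 = ram s ->
    exists k s2, [/\ exec (While (rv x) body) s1 k s2, k <= n * cst + 1,
      reg s2 (rt t) = res 0, ram s2 = ram s &
      reg s2 (rt t.+1) = reg s1 (rt t.+1) /\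
      (forall r, (forall u, t <= u -> r != rt u) -> r != rv x -> reg s2 r = reg s r)].
  elim: n s1 => [|n IHn] s1 nN h1 hf ha hm.
    exists (bitlen (reg s1 (rv x))), s1; split => //; first by apply: ExecWhileFalse.
    by rewrite h1.
  pose s2 := set_reg s1 (rt t.+2) 1.
  pose s3 := set_reg s2 (rv x) n.
  have envs3 : env_of s3 =1 upd (env_of s) x n.
    move=> y; rewrite /env_of /s3 /s2 /= /upd rv_inj rv_rt; case: eqP => // /eqP yx.
    by apply: hf => [u _|]; rewrite ?rv_rt ?rv_inj.
  have gs3 : good (env_of s3).
    apply: (@good_ext (upd (env_of s) x n)); first by move=> y; rewrite envs3.
    by apply: good_upd => //; lia.
  have rs3 : rep A s3.
    split; rewrite /s3 /= ?hm; last by case: rs.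
    rewrite /upd [0 == rv x](_ : _ = false) // [0 == _](_ : _ = false) //.
    by rewrite hf //; case: rs.
  have [k4 [s4 [e4 l4 v4 f4 m4]]] := IH we t.+2 s3 gs3 rs3.
  rewrite (evalE_ext _ _ _ envs3) -/(f n) in v4.
  have a4 : reg s4 (rt t) = res n.+1.
    by rewrite (frame_rt f4) // /s3 /s2 /= /upd rt_rv E01.
  pose s5 := set_reg s4 (rt t) (opn (reg s4 (rt t)) (reg s4 (rt t.+2))).
  have [|||||k6 [s6 [e6 l6 v6 m6 [t6 f6]]]] := IHn s5; first by lia.
  + by rewrite /s5 /= /upd rv_rt (frame_rv _ f4) /s3 /= /upd eqxx.
  + move=> r hr rx; rewrite /s5 /= /upd (negbTE (hr t _)) // f4; last by move=> u hu; apply: hr; lia.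
    by rewrite /s3 /s2 /= /upd (negbTE rx) (negbTE (hr t.+2 _)) ?hf //; lia.
  + by rewrite /s5 /= /upd eqxx a4 v4 -resS //; lia.
  + by rewrite /s5 /= m4 /s3 /=.
  eexists; exists s6; split.
  + eapply ExecWhileTrue; [by rewrite h1| |exact: e6].
    eapply ExecSeq; first by constructor.
    eapply ExecSeq.
      have := ExecArith Defs.Sub (rv x) (rv x) (rt t.+2) s2.
      rewrite /= /upd eqxx rv_rt h1 subn1 /=; exact.
    eapply ExecSeq; first by exact: e4.
    by constructor.
  + rewrite -/s2 h1 a4 v4.
    have hn : bitlen n.+1 <= W.
      by apply: bitlen_le => //; apply: leq_ltn_trans nN _; apply: leq_ltn_trans N0q _.
    have h7 := bitlen_le (resb n.+1) b0.
    have h8 : bitlen (f n) <= bE q W e by apply: bitlen_le; [apply: fb|apply: bE_gt0].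
    have -> : bitlen 1 = 1 by [].
    by rewrite mulSn /cst; lia.
  + exact: v6.
  + exact: m6.
  + split; last exact: f6.
    by rewrite t6 /s5 /= /upd E10 (frame_rt f4) // /s3 /s2 /= /upd rt_rv E12.
have [s1 [e1 m1 v1 h1]] := @exec_mov (rt t.+1) (rv x) s (negbT (rt_rv _ _)).
pose s2 := set_reg s1 (rt t) (bk_id o).
have [s3 [e3 m3 v3 h3]] := @exec_mov (rt t.+2) (rv 0) s2 (negbT (rt_rv _ _)).
have [s4 [e4 m4 v4 h4]] := @exec_mov (rv x) (rt t.+2) s3 (negbT (rv_rt _ _)).
have s2v y : reg s2 (rv y) = reg s (rv y).
  by rewrite /s2 /= /upd rv_rt h1 // rv_rt.
have [|||||k5 [s5 [e5 l5 v5 m5 [t5 f5]]]] := main N0 s4.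
+ by [].
+ by rewrite v4 v3 s2v.
+ move=> r hr rx; rewrite h4 // h3 ?hr //; last by lia.
  by rewrite /s2 /= /upd (negbTE (hr t _)) // h1 // hr; lia.
+ rewrite h4 ?rt_rv // h3 ?E01 // /s2 /= /upd eqxx /res.
  by case: (o); rewrite big_geq.
+ by rewrite m4 m3 /s2 /= m1.
have [s6 [e6 m6 v6 h6]] := @exec_mov (rv x) (rt t.+1) s5 (negbT (rv_rt _ _)).
have t5' : reg s5 (rt t.+1) = reg s (rv x).
  rewrite t5 h4 ?rt_rv // h3 ?E12 // /s2 /= /upd E10.
  exact: v1.
eexists; exists s6; split.
+ eapply ExecSeq; first by exact: e1.
  eapply ExecSeq; first by constructor.
  eapply ExecSeq; first by exact: e3.
  eapply ExecSeq; first by exact: e4.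
  eapply ExecSeq; first by exact: e5.
  exact: e6.
+ rewrite t5' v3 s2v.
  have hx : bitlen (reg s (rv x)) <= W by apply: bitlen_le.
  have h0 : bitlen (reg s (rv 0)) <= W by apply: bitlen_le.
  have hb : bitlen (bk_id o) = 1 by case: (o).
  have : N0 * cst <= q.+1 * cst by rewrite leq_mul2r; apply/orP; right; lia.
  rewrite hb /= -/b -/cst; lia.
+ by rewrite h6 ?rt_rv // v5 /= /res; case: (o).
+ move=> r hr; case: (eqVneq r (rv x)) => [->|rx]; first by rewrite v6 t5'.
  by rewrite h6 // f5.
+ by rewrite m6 m5.
Qed.

Lemma compE_ok A e t s : wfE e -> goodm A -> good (env_of s) -> rep A s ->
  exists k s', [/\ exec (compE t e) s k s', k <= tE q W e,
    reg s' (rt t) = evalE L (env_of s) A e, frame t s s' & ram s' = ram s].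
Proof.
move=> we gA; elim: e we t s => /= [x|c|o a IHa b IHb|k a IHa|c IHc a IHa b IHb|o x e IH] we t s gs rs.
- have [s' [e1 rm h1 h2]] := @exec_mov (rt t) (rv x) s (negbT (rt_rv _ _)).
  eexists; exists s'; split; [exact: e1| |by []| |by []].
    have : bitlen (reg s (rv x)) <= W by apply: bitlen_le => //; case: gs => _; apply.
    by lia.
  by move=> r hr; apply: h2; apply: hr.
- eexists; eexists; split; [constructor| |by rewrite /= /upd eqxx|exact: frame_set|by []].
  by apply: bitlen_le => //; have := @ltn_expl 2 c isT; rewrite expnS; lia.
- case/andP: we => wa wb.
  have [k1 [s1 [e1 l1 v1 f1 m1]]] := IHa wa t s gs rs.
  have gs1 : good (env_of s1) by apply: good_ext gs => y; rewrite (env_frame f1).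
  have [k2 [s2 [e2 l2 v2 f2 m2]]] := IHb wb t.+1 s1 gs1 (rep_frame f1 m1 rs).
  have v1' : reg s2 (rt t) = evalE L (env_of s) A a by rewrite (frame_rt f2).
  rewrite (evalE_ext _ _ _ (env_frame f1)) in v2.
  eexists; eexists; split.
  + by eapply ExecSeq; [exact: e1|eapply ExecSeq; [exact: e2|constructor]].
  + rewrite v1' v2.
    have := bitlen_le (evalE_bound a gA gs) (bE_gt0 _).
    have := bitlen_le (evalE_bound b gA gs) (bE_gt0 _).
    by lia.
  + by rewrite /= /upd eqxx v1' v2.
  + apply: frame_trans f1 _; apply: frame_trans (frame_le _ f2) _ => //.
    exact: frame_set.
  + by rewrite /= m2 m1.
- case/andP: we => wk wa.
  have [k1 [s1 [e1 l1 v1 f1 m1]]] := IHa wa t s gs rs.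
  have hb : reg s1 (rt t) < 2 ^ bE q W a by rewrite v1; apply: evalE_bound.
  have r0 : reg s1 0 = L by rewrite (frame_r0 f1); case: rs.
  have [k2 [s2 [e2 l2 v2 f2 m2]]] := compA_ok wk hb (bE_gt0 _) r0.
  have hv : ram s2 (reg s2 (rt t)) = A k (clampi L k (evalE L (env_of s) A a)).
    rewrite v2 v1 m2 m1; case: rs => _ -> //.
    by rewrite /clampi; case: eqP => // _ _; apply: geq_minr.
  eexists; eexists; split.
  + by eapply ExecSeq; [exact: e1|eapply ExecSeq; [exact: e2|constructor]].
  + rewrite hv v2 v1.
    have h1 := bitlen_le (addr_lt wk (evalE_bound a gA gs)) (ltn_addl _ (isT : 0 < 6)).
    have h2 : bitlen (A k (clampi L k (evalE L (env_of s) A a))) <= W.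
      by apply: bitlen_le.
    by rewrite /nkeys in l2 *; lia.
  + by rewrite /= /upd eqxx.
  + apply: frame_trans f1 _; apply: frame_trans f2 _; exact: frame_set.
  + by rewrite /= m2 m1.
- case/and3P: we => wc wa wb.
  have [k1 [s1 [e1 l1 v1 f1 m1]]] := IHc wc t s gs rs.
  have gs1 : good (env_of s1) by apply: good_ext gs => y; rewrite (env_frame f1).
  have hl := bitlen_le (evalE_bound c gA gs) (bE_gt0 _).
  case: ifP => cv.
  + have [k2 [s2 [e2 l2 v2 f2 m2]]] := IHa wa t s1 gs1 (rep_frame f1 m1 rs).
    rewrite (evalE_ext _ _ _ (env_frame f1)) in v2.
    eexists; exists s2; split.
    * by eapply ExecSeq; [exact: e1|eapply ExecIfTrue; [rewrite v1|exact: e2]].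
    * by rewrite v1; lia.
    * by [].
    * exact: frame_trans f2.
    * by rewrite m2.
  + have [k2 [s2 [e2 l2 v2 f2 m2]]] := IHb wb t s1 gs1 (rep_frame f1 m1 rs).
    rewrite (evalE_ext _ _ _ (env_frame f1)) in v2.
    eexists; exists s2; split.
    * by eapply ExecSeq; [exact: e1|eapply ExecIfFalse; [rewrite v1; exact/eqP/negbFE|exact: e2]].
    * by rewrite v1; lia.
    * by [].
    * exact: frame_trans f2.
    * by rewrite m2.
- exact: (@compBig_ok A o x e IH we gA t s gs rs).
Qed.

Lemma evalP_goodm p s A : good s -> goodm A -> goodm (evalP L p s A).
Proof.
elim: p s A => [k a e|p1 IH1 p2 IH2|x p IH] s A gs gA /=.
- move=> k' i'; rewrite /updm; case: eqP => // _; rewrite /upd; case: eqP => // _.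
  by apply: leq_ltn_trans (geq_minr _ _) _; case: gs.
- by apply: IH2 => //; apply: IH1.
- have : s 0 <= q by case: gs.
  elim: (s 0) A gA => //= n IHn A gA nq; apply: IHn; last by lia.
  by apply: IH => //; apply: good_upd.
Qed.

Lemma addr_inj k i k' i' : k < nkeys -> k' < nkeys -> (k == 0 -> i <= L) ->
  (k' == 0 -> i' <= L) -> (addr L k i == addr L k' i') = (k == k') && (i == i').
Proof. by rewrite /addr /nkeys; case: eqP => h1; case: eqP => h2 *; lia. Qed.

Lemma rep_upd A s k i v : rep A s -> k < nkeys -> (k == 0 -> i <= L) ->
  rep (updm A k i v) (set_ram s (addr L k i) v).
Proof.
case=> h0 h hk hi; split => //= k' i' hk' hi'.
rewrite /updm /upd addr_inj // (eq_sym k'); case: eqP => [->|_] /=; last exact: h.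
by case: ifP => // _; apply: h.
Qed.

Lemma clampi_le k i : k == 0 -> clampi L k i <= L.
Proof. by rewrite /clampi => ->; apply: geq_minr. Qed.

Lemma compP_ok p A t s : wfP p -> goodm A -> good (env_of s) -> rep A s ->
  exists k s', [/\ exec (compP t p) s k s', k <= tP q W p,
    rep (evalP L p (env_of s) A) s' & frame t s s'].
Proof.
elim: p A t s => [k a e|p1 IH1 p2 IH2|x p IH] A t s /= wp gA gs rs.
- case/and3P: wp => wk wa we.
  have [k1 [s1 [e1 l1 v1 f1 m1]]] := compE_ok t wa gA gs rs.
  have hb : reg s1 (rt t) < 2 ^ bE q W a by rewrite v1; apply: evalE_bound.
  have r0 : reg s1 0 = L by rewrite (frame_r0 f1); case: rs.
  have [k2 [s2 [e2 l2 v2 f2 m2]]] := compA_ok wk hb (bE_gt0 _) r0.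
  have f12 := frame_trans f1 f2.
  have rs2 : rep A s2 by apply: rep_frame f12 _ rs; rewrite m2.
  have gs2 : good (env_of s2) by apply: good_ext gs => y; rewrite (env_frame f12).
  have [k3 [s3 [e3 l3 v3 f3 m3]]] := compE_ok t.+1 we gA gs2 rs2.
  rewrite (evalE_ext _ _ _ (env_frame f12)) in v3.
  set i := evalE L (env_of s) A a in v1.
  set v := evalE L (env_of s) A e in v3.
  have hv : v < 2 ^ bE q W e by apply: evalE_bound.
  have hi : i < 2 ^ bE q W a by apply: evalE_bound.
  have v1' : reg s3 (rt t) = addr L k (clampi L k i) by rewrite (frame_rt f3) // v2 v1.
  have c3 : reg s3 (rv 1) = reg s (rv 1).
    by rewrite (frame_rv _ f3) (frame_rv _ f12).
  have E1 : (t.+1 == t.+2) = false by lia.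
  have E2 : (t == t.+1) = false by lia.
  have E3 : (t == t.+2) = false by lia.
  set c := reg s (rv 1) in c3.
  have rs3 : rep A s3 by apply: rep_frame f3 m3 rs2.
  pose s5 := set_reg (set_reg s3 (rt t.+2) (v - c)) (rt t.+1) (v - (v - c)).
  have f5 : frame t s3 s5.
    by move=> r hr; rewrite /s5 /= /upd (negbTE (hr t.+1 _)) // (negbTE (hr t.+2 _)) //; lia.
  pose s4 := set_reg s3 (rt t.+2) (v - c).
  have := ExecArith Defs.Sub (rt t.+2) (rt t.+1) (rv 1) s3; rewrite v3 c3 => e4.
  have r41 : reg s4 (rt t.+1) = v by rewrite /s4 /= /upd rt_inj E1.
  have r42 : reg s4 (rt t.+2) = v - c by rewrite /s4 /= /upd eqxx.
  have := ExecArith Defs.Sub (rt t.+1) (rt t.+1) (rt t.+2) s4; rewrite r41 r42 => e5.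
  have := ExecWrite (rt t) (rt t.+1) s5.
  have -> : reg s5 (rt t.+1) = minn v c by rewrite /s5 /= /upd eqxx; lia.
  have -> : reg s5 (rt t) = addr L k (clampi L k i).
    by rewrite /s5 /= /upd !rt_inj E2 E3 v1'.
  move=> e6.
  eexists; exists (set_ram s5 (addr L k (clampi L k i)) (minn v c)); split.
  + eapply ExecSeq; first by exact: e1.
    eapply ExecSeq; first by exact: e2.
    eapply ExecSeq; first by exact: e3.
    eapply ExecSeq; first by exact: e4.
    by eapply ExecSeq; [exact: e5|exact: e6].
  +     have h1 := bitlen_le (addr_lt wk hi) (ltn_addl _ (isT : 0 < 6)).
    have h2 := bitlen_le hv (bE_gt0 _).
    have h3 : bitlen c <= W by apply: bitlen_le => //; case: gs => _; apply.
    have h4 : bitlen (v - c) <= bE q W e.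
      by apply: bitlen_le (bE_gt0 _); lia.
    have h5 : bitlen (minn v c) <= bE q W e.
      by apply: bitlen_le (bE_gt0 _); lia.
    by rewrite /nkeys in l2 *; lia.
  + by apply: rep_upd => //; exact: clampi_le.
  + move=> r hr; change (reg s5 r = reg s r); rewrite f5 // f3 ?f12 // => u hu.
    by apply: hr; lia.
- case/andP: wp => w1 w2.
  have [k1 [s1 [e1 l1 r1 f1]]] := IH1 A t s w1 gA gs rs.
  have gs1 : good (env_of s1) by apply: good_ext gs => y; rewrite (env_frame f1).
  have [k2 [s2 [e2 l2 r2 f2]]] := IH2 _ t s1 w2 (evalP_goodm p1 gs gA) gs1 r1.
  rewrite (evalP_ext _ _ _ (env_frame f1)) in r2.
  exists (k1 + k2), s2; split; [exact: ExecSeq e1 e2|lia|by []|exact: frame_trans f2].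
- pose N0 := reg s (rv 0).
  have N0q : N0 <= q by case: gs.
  have sb r : reg s (rv r) < 2 ^ W by case: gs => _; apply.
  pose body := Seq (Const (rt t.+1) 1)
    (Seq (Arith Defs.Sub (rv x) (rv x) (rt t.+1)) (compP t.+1 p)).
  pose f i A' := evalP L p (upd (env_of s) x i) A'.
  pose cst := tP q W p + 3 * (W + 9).
  have E01 : (rt t == rt t.+1) = false by rewrite rt_inj; lia.
  have main n s1 B : n <= N0 -> reg s1 (rv x) = n -> goodm B -> rep B s1 ->
      (forall r, (forall u, t <= u -> r != rt u) -> r != rv x -> reg s1 r = reg s r) ->
      exists k s2, [/\ exec (While (rv x) body) s1 k s2, k <= n * cst + 1,
        rep (loop n f B) s2,
        reg s2 (rt t) = reg s1 (rt t) &
        (forall r, (forall u, t <= u -> r != rt u) -> r != rv x -> reg s2 r = reg s r)].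
    elim: n s1 B => [|n IHn] s1 B nN h1 gB rB hf.
      exists (bitlen (reg s1 (rv x))), s1; split => //; first by apply: ExecWhileFalse.
      by rewrite h1.
    pose s2 := set_reg s1 (rt t.+1) 1.
    pose s3 := set_reg s2 (rv x) n.
    have envs3 : env_of s3 =1 upd (env_of s) x n.
      move=> y; rewrite /env_of /s3 /s2 /= /upd rv_inj rv_rt; case: eqP => // /eqP yx.
      by apply: hf => [u _|]; rewrite ?rv_rt ?rv_inj.
    have gu : good (upd (env_of s) x n) by apply: good_upd => //; lia.
    have gs3 : good (env_of s3).
      by apply: good_ext gu => y; rewrite envs3.
    have rs3 : rep B s3 by case: rB => hb0 hb; split.
    have [k4 [s4 [e4 l4 r4 f4]]] := IH B t.+1 s3 wp gB gs3 rs3.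
    rewrite (evalP_ext _ _ _ envs3) -/(f n B) in r4.
    have [|||||k6 [s6 [e6 l6 r6 t6 f6]]] := IHn s4 (f n B); first by lia.
    + by rewrite (frame_rv _ f4) /s3 /= /upd eqxx.
    + exact: evalP_goodm.
    + exact: r4.
    + move=> r hr rx; rewrite f4; last by move=> u hu; apply: hr; lia.
      by rewrite /s3 /s2 /= /upd (negbTE rx) (negbTE (hr t.+1 _)) ?hf //; lia.
    eexists; exists s6; split.
    + eapply ExecWhileTrue; [by rewrite h1| |exact: e6].
      eapply ExecSeq; first by constructor.
      eapply ExecSeq.
        have := ExecArith Defs.Sub (rv x) (rv x) (rt t.+1) s2.
        rewrite /= /upd eqxx rv_rt h1 subn1 /=; exact.
      exact: e4.
    + rewrite -/s2 h1.
      have hn : bitlen n.+1 <= W.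
        by apply: bitlen_le => //; apply: leq_ltn_trans nN _; apply: leq_ltn_trans N0q _.
      have -> : bitlen 1 = 1 by [].
      by rewrite mulSn /cst; lia.
    + exact: r6.
    + by rewrite t6 (frame_rt f4) // /s3 /s2 /= /upd rt_rv E01.
    + exact: f6.
  have [s1 [e1 m1 v1 h1]] := @exec_mov (rt t) (rv x) s (negbT (rt_rv _ _)).
  have [s3 [e3 m3 v3 h3]] := @exec_mov (rt t.+1) (rv 0) s1 (negbT (rt_rv _ _)).
  have [s4 [e4 m4 v4 h4]] := @exec_mov (rv x) (rt t.+1) s3 (negbT (rv_rt _ _)).
  have s1v y : reg s1 (rv y) = reg s (rv y) by rewrite h1 // rv_rt.
  have f4 r : (forall u, t <= u -> r != rt u) -> r != rv x -> reg s4 r = reg s r.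
    by move=> hr rx; rewrite h4 // h3 ?hr // h1 // hr.
  have [|||||k5 [s5 [e5 l5 r5 t5 f5]]] := main N0 s4 A => //.
  + by rewrite v4 v3 s1v.
  + case: rs => rs0 rs; split; first by rewrite f4 // => u _; rewrite /rt; lia.
    by rewrite m4 m3 m1.
  have [s6 [e6 m6 v6 h6]] := @exec_mov (rv x) (rt t) s5 (negbT (rv_rt _ _)).
  have t5' : reg s5 (rt t) = reg s (rv x).
    by rewrite t5 h4 ?rt_rv // h3 ?E01.
  eexists; exists s6; split.
  + eapply ExecSeq; first by exact: e1.
    eapply ExecSeq; first by exact: e3.
    eapply ExecSeq; first by exact: e4.
    eapply ExecSeq; first by exact: e5.
    exact: e6.
  + rewrite t5' v3 s1v.
    have hx : bitlen (reg s (rv x)) <= W by apply: bitlen_le.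
    have h0 : bitlen (reg s (rv 0)) <= W by apply: bitlen_le.
    have : N0 * cst <= q.+1 * cst by rewrite leq_mul2r; apply/orP; right; lia.
    rewrite /= -/cst; lia.
  + case: r5 => r50 r5; split; first by rewrite h6 // -r50 //.
    by rewrite m6.
  + move=> r hr; case: (eqVneq r (rv x)) => [->|rx]; first by rewrite v6 t5'.
    by rewrite h6 // f5.
Qed.
End Compiler.

Lemma pb_ext f g : f =1 g -> pbounded f -> pbounded g.
Proof. by move=> fg [p hp]; exists p => x; rewrite -fg. Qed.

Lemma pb_S f : pbounded f -> pbounded (fun x => (f x).+1).
Proof. by move=> h; apply: (@pb_ext (fun x => f x + 1)); [move=> x; rewrite addn1|apply: pb_add => //; apply: pb_const]. Qed.

Ltac pb := repeat first
  [ assumption | apply: pb_const | apply: pb_id | apply: pb_S | apply: pb_mul | apply: pb_add ].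

Lemma pb_bE e : pbounded (fun q => bE q q.+1 e).
Proof. elim: e => [x|c|o a IHa b IHb|k a IHa|c IHc a IHa b IHb|o x e IH] /=; pb. Qed.

Lemma pb_tE e : pbounded (fun q => tE q q.+1 e).
Proof.
elim: e => [x|c|o a IHa b IHb|k a IHa|c IHc a IHa b IHb|o x e IH] /=;
  repeat first [apply: pb_bE | progress pb].
Qed.

Lemma pb_tP p : pbounded (fun q => tP q q.+1 p).
Proof.
elim: p => [k a e|p1 IH1 p2 IH2|x p IH] /=;
  repeat first [apply: pb_bE | apply: pb_tE | progress pb].
Qed.

(** * The machine: computing the loop bound and the cap from the input *)

Definition sqE (e : expr) : expr := Bin Defs.Mul e e.

(** Adding 1 to each cell keeps zero cells from annihilating the product, whose bit length then
    dominates that of any product of distinct cells. *)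
Definition input_prod : expr :=
  Big BProd 5 (Bin Defs.Add (Rd 0 (Var 5)) (Cst 1)).

(** The machine is not told the length of its input, which is recomputed from the dimensions in
    cells 0 and 1. It also serves as provisional loop bound, for [input_prod]. *)
Definition prologue_sizes : cmd :=
  Seq (Const (rv 3) 0) (Seq (Read (rv 3) (rv 3))
 (Seq (Const (rv 4) 1) (Seq (Read (rv 4) (rv 4))
 (Seq (Arith Defs.Mul 0 (rv 3) (rv 4))
 (Seq (Arith Defs.Add 0 0 (rv 3))
 (Seq (Arith Defs.Add 0 0 (rv 4))
 (Seq (Arith Defs.Add 0 0 (rv 4))
 (Seq (Const (rt 0) 1)
 (Seq (Arith Defs.Add 0 0 (rt 0))
 (Seq (Arith Defs.Add 0 0 0)
      (mov (rv 0) 0))))))))))).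

Definition count_bits : cmd :=
  While (rt 0)
    (Seq (Const (rt 1) 2) (Seq (Arith Defs.Div (rt 0) (rt 0) (rt 1))
    (Seq (Const (rt 1) 1) (Arith Defs.Add (rv 2) (rv 2) (rt 1))))).

Definition prologue_N : cmd :=
  Seq (Arith Defs.Add (rv 2) (rv 2) 0)
 (Seq (Const (rt 0) 100) (Arith Defs.Add (rv 2) (rv 2) (rt 0))).

Definition assign (x : nat) (e : expr) : cmd :=
  Seq (compE 0 e) (mov (rv x) (rt 0)).

Definition machine (p : prog) : cmd :=
  Seq prologue_sizes (Seq (compE 0 input_prod) (Seq count_bits
 (Seq prologue_N (Seq (assign 0 (sqE (sqE (sqE (sqE (Var 2))))))
 (Seq (assign 1 (Big BProd 5 (Cst 2))) (compP 0 p)))))).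

(** Unlike [bitlen], this gives no digit to 0: it is the number of iterations of the halving loop
    [count_bits]. *)
Definition nbits (v : nat) : nat := if v == 0 then 0 else bitlen v.

Lemma nbits_half v : 0 < v -> nbits v = (nbits (v %/ 2)).+1.
Proof.
rewrite /nbits /bitlen => v0; rewrite (negbTE (lt0n_neq0 v0)).
case: eqP => h; first by have -> : v = 1 by lia.
by rewrite trunc_log2S ?divn2 //; lia.
Qed.

Lemma nbits_lt v : v < 2 ^ nbits v.
Proof. by rewrite /nbits; case: eqP => [->//|_]; apply: trunc_log_ltn. Qed.

Lemma nbits_le v b : v < 2 ^ b -> nbits v <= b.
Proof.
rewrite /nbits; case: eqP => // h vb; apply: bitlen_le => //.
by case: b vb => //; rewrite expn0; lia.
Qed.

Lemma count_bits_ok W s v a : v < 2 ^ W -> a + nbits v < 2 ^ W -> 0 < W ->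
  reg s (rt 0) = v -> reg s (rv 2) = a ->
  exists k s', [/\ exec count_bits s k s', k <= nbits v * (4 * W + 9) + 1,
    reg s' (rv 2) = a + nbits v, ram s' = ram s &
    forall r, (forall u, r != rt u) -> r != rv 2 -> reg s' r = reg s r].
Proof.
move=> vW aW W0; elim/ltn_ind: v s a vW aW => v IH s a vW aW hv ha.
case: (posnP v) => [v0|v0].
  rewrite v0 in hv *; exists (bitlen (reg s (rt 0))), s; split => //.
  - exact: ExecWhileFalse.
  - by rewrite hv.
  - by rewrite ha addn0.
pose s1 := set_reg s (rt 1) 2.
pose s2 := set_reg s1 (rt 0) (v %/ 2).
pose s3 := set_reg s2 (rt 1) 1.
pose s4 := set_reg s3 (rv 2) (a + 1).
have e1 : exec (Const (rt 1) 2) s (bitlen 2) s1 by constructor.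
have e2 : exec (Arith Defs.Div (rt 0) (rt 0) (rt 1)) s1 (bitlen v + bitlen 2) s2.
  by rewrite /s2 -hv; exact: (ExecArith Defs.Div (rt 0) (rt 0) (rt 1) s1).
have e3 : exec (Const (rt 1) 1) s2 (bitlen 1) s3 by constructor.
have e4 : exec (Arith Defs.Add (rv 2) (rv 2) (rt 1)) s3 (bitlen a + bitlen 1) s4.
  by rewrite /s4 -ha; exact: (ExecArith Defs.Add (rv 2) (rv 2) (rt 1) s3).
have hh := nbits_half v0.
have [|||||k5 [s5 [e5 l5 v5 m5 f5]]] := IH (v %/ 2) _ s4 (a + 1).
- by lia.
- by lia.
- by rewrite -addnA add1n -hh.
- by [].
- by rewrite /s4 /= /upd eqxx.
eexists; exists s5; split.
- eapply ExecWhileTrue; [by rewrite hv; lia| |exact: e5].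
  by eapply ExecSeq; [exact: e1|eapply ExecSeq; [exact: e2|eapply ExecSeq; [exact: e3|exact: e4]]].
- have b1 : bitlen v <= W by apply: bitlen_le.
  have b2 : bitlen a <= W by apply: bitlen_le => //; lia.
  have -> : bitlen 1 = 1 by []. have -> : bitlen 2 = 2 by [].
  by rewrite hv hh mulSn; lia.
- by rewrite v5 hh; lia.
- by rewrite m5.
- move=> r h1 h2; rewrite f5 // /s4 /s3 /s2 /s1 /= /upd (negbTE h2).
  by rewrite (negbTE (h1 1)) (negbTE (h1 0)).
Qed.

Section Machine.
Variable input : seq nat.

Definition in_m : nat := nth 0 input 0.
Definition in_n : nat := nth 0 input 1.
Definition in_L : nat := size input.
(* [in_N] exceeds both the number of cells and the bit length of any product of
   distinct cells of the input.  The exponent 16 covers the number of rounds of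
   the linear programming subroutine and the growth of the weights. *)
Definition in_N : nat :=
  nbits (\prod_(0 <= a < in_L) (nth 0 input a + 1)) + in_L + 100.
Definition in_q : nat := in_N ^ 16.
Definition env0 : env := fun x =>
  match x with
  | 0 => in_q | 1 => 2 ^ in_q | 2 => in_N | 3 => in_m | 4 => in_n | _ => 0
  end.
Definition mem0 : memory := fun k i => if k == 0 then nth 0 input i else 0.

Lemma in_N_le_q : in_N <= in_q.
Proof. by rewrite /in_q -[X in X <= _]expn1 leq_exp2l // /in_N; lia. Qed.

Lemma prodS_gt0 (F : nat -> nat) a b : 0 < \prod_(a <= i < b) (F i + 1).
Proof. by apply: prodn_gt0 => i; rewrite addn1. Qed.

Lemma input_lt a : nth 0 input a < 2 ^ in_N.
Proof.
case: (ltnP a in_L) => aL; last by rewrite nth_default // expn_gt0.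
have : nth 0 input a + 1 <= \prod_(0 <= i < in_L) (nth 0 input i + 1).
  rewrite (@big_cat_nat _ _ _ a) //= ?(ltnW aL) // [X in _ <= _ * X]big_ltn //=.
  have h1 := prodS_gt0 (nth 0 input) 0 a; have h2 := prodS_gt0 (nth 0 input) a.+1 in_L.
  by rewrite mulnCA leq_pmulr // muln_gt0 h1 h2.
rewrite addn1 => /leq_trans; apply.
apply: leq_trans (ltnW (nbits_lt _)) _; rewrite leq_exp2l // /in_N; lia.
Qed.

Lemma in_L_le_bits : in_L <= bitsize input.
Proof.
rewrite /bitsize /in_L -sum1_size; apply: leq_sum => i _; exact: ltn0Sn.
Qed.

(** Each factor [a + 1] is at most [2 ^ bitlen a], so the product is at most [2 ^ bitsize input].
    This is what makes a polynomial in [in_N] a polynomial in the size of the instance. *)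
Lemma in_N_le_bits : in_N <= 2 * bitsize input + 101.
Proof.
have h : \prod_(0 <= a < in_L) (nth 0 input a + 1) <= 2 ^ bitsize input.
  have -> : \prod_(0 <= a < in_L) (nth 0 input a + 1) = \prod_(a <- input) (a + 1).
    by rewrite [RHS](big_nth 0).
  rewrite /bitsize expn_sum; elim/big_ind2: _ => // [a b c d ab cd|i _].
    exact: leq_mul.
  by rewrite addn1; apply: trunc_log_ltn.
have := @nbits_le _ (bitsize input).+1 (leq_ltn_trans h _).
rewrite ltn_exp2l // => /(_ (ltnSn _)); have := in_L_le_bits; rewrite /in_N; lia.
Qed.

Hypothesis Lin : in_L = 2 * (in_m * in_n + in_m + in_n + in_n + 1).

Lemma prologue_sizes_ok t : exists k s', [/\ exec prologue_sizes (init input t) k s',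
  k <= 30 * (in_q + 9), ram s' = nth 0 input, reg s' 0 = in_L &
  forall x, reg s' (rv x) = match x with 0 => in_L | 3 => in_m | 4 => in_n | _ => 0 end].
Proof.
have bl v : v <= in_L -> bitlen v <= in_q.
  move=> h; apply: bitlen_le.
    apply: leq_ltn_trans h _; apply: leq_trans (@ltn_expl 2 in_L isT) _.
    by rewrite leq_exp2l //; have := in_N_le_q; rewrite /in_N; lia.
  by have := in_N_le_q; rewrite /in_N; lia.
eexists; eexists; split.
- do 11 (eapply ExecSeq; [constructor|]).
  by rewrite /mov; eapply ExecSeq; constructor.
- rewrite /= /upd /= -/in_m -/in_n.
  have mL : in_m <= in_L by rewrite Lin; set mn := in_m * in_n; lia.
  have nL : in_n <= in_L by rewrite Lin; set mn := in_m * in_n; lia.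
  have b1 := bl _ mL; have b2 := bl _ nL.
  move: Lin; set mn := in_m * in_n => LE.
  have b3 : bitlen mn <= in_q by apply: bl; lia.
  have b4 : bitlen (mn + in_m) <= in_q by apply: bl; lia.
  have b5 : bitlen (mn + in_m + in_n) <= in_q by apply: bl; lia.
  have b6 : bitlen (mn + in_m + in_n + in_n) <= in_q by apply: bl; lia.
  have b7 : bitlen (mn + in_m + in_n + in_n + 1) <= in_q by apply: bl; lia.
  have b8 : bitlen (mn + in_m + in_n + in_n + 1 + (mn + in_m + in_n + in_n + 1)) <= in_q by apply: bl; lia.
  have c0 : bitlen 0 = 1 by []. have c1 : bitlen 1 = 1 by [].
  rewrite c0 c1; lia.
- by [].
- by rewrite /= /upd /= -/in_m -/in_n Lin; lia.
- move=> x; rewrite /= /upd /= -/in_m -/in_n.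
  by do 5 (case: x => [|x]; first by rewrite //= ?Lin; lia).
Qed.

Lemma in_q_ge : 100 <= in_q.
Proof. by apply: leq_trans in_N_le_q; rewrite /in_N; lia. Qed.

Lemma mem0_goodm : goodm in_q.+1 mem0.
Proof.
move=> k i; rewrite /mem0; case: eqP => _; last by rewrite expn_gt0.
apply: leq_trans (input_lt _) _; rewrite leq_exp2l //.
by apply: leq_trans in_N_le_q _.
Qed.

(** The cost is kept as a function of [in_q] alone, with words of [in_q.+1] bits since the cap is
    [2 ^ in_q]; [machine_ok] can then bound it by composing two polynomials. *)
Lemma machine_exec p t : wfP p -> exists k s',
  [/\ exec (machine p) (init input t) k s',
    k <= 30 * (in_q + 9) + (tE in_q in_q.+1 input_prod + (in_q * (4 * in_q.+1 + 9) + 1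
      + (9 * (in_q + 9) + ((tE in_q in_q.+1 (sqE (sqE (sqE (sqE (Var 2))))) + in_q + 9)
      + ((tE in_q in_q.+1 (Big BProd 5 (Cst 2)) + in_q + 9) + tP in_q in_q.+1 p))))) &
    forall j, j <= in_L -> ram s' j = evalP in_L p env0 mem0 0 j].
Proof.
move=> wp.
have qW : in_q < 2 ^ in_q.+1 by apply: leq_trans (@ltn_expl 2 in_q isT) _; rewrite leq_exp2l.
have Nq := in_N_le_q; have q100 := in_q_ge.
have LN : in_L <= in_N by rewrite /in_N; lia.
have LW : in_L < 2 ^ in_q.+1 by lia.
have mL : in_m <= in_L by rewrite Lin; set mn := in_m * in_n; lia.
have nL : in_n <= in_L by rewrite Lin; set mn := in_m * in_n; lia.
have bl v : v <= in_q -> bitlen v <= in_q.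
  move=> h; apply: bitlen_le; last by lia.
  by apply: leq_ltn_trans h _; apply: ltn_expl.
have [k1 [s1 [e1 l1 m1 r1 v1]]] := prologue_sizes_ok t.
have rep1 : rep in_L mem0 s1.
  split=> // k i hk hi; rewrite m1 /addr /mem0; case: eqP => // /eqP k0.
  by rewrite nth_default // -/in_L; lia.
have g1 : good in_q in_q.+1 (env_of s1).
  split; first by rewrite /env_of v1; lia.
  by move=> x; rewrite /env_of v1; case: x => [|[|[|[|[|x]]]]]; lia.
have [k2 [s2 [e2 l2 v2 f2 m2]]] := @compE_ok _ _ _ qW LW isT mem0 input_prod 0 s1 isT mem0_goodm g1 rep1.
pose prd := \prod_(0 <= a < in_L) (nth 0 input a + 1).
have v2' : reg s2 (rt 0) = prd.
  rewrite v2 /= {1}/env_of v1 /prd big_nat [RHS]big_nat.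
  apply: eq_bigr => a /andP[_ aL].
  by rewrite /upd /= /clampi /= /mem0 /=; congr (nth _ _ _ + 1); lia.
have NE : in_N = nbits prd + in_L + 100 by [].
have nbq : nbits prd <= in_q by lia.
have v22 : reg s2 (rv 2) = 0 by rewrite (frame_rv _ f2) v1.
have [||k3 [s3 [e3 l3 v3 m3 f3]]] := @count_bits_ok in_q.+1 s2 prd 0 _ _ isT v2' v22.
- apply: leq_trans (nbits_lt _) _; rewrite leq_exp2l //; lia.
- by lia.
pose s4 := set_reg (set_reg (set_reg s3 (rv 2) (reg s3 (rv 2) + reg s3 0)) (rt 0) 100) (rv 2)
  (reg s3 (rv 2) + reg s3 0 + 100).
have r30 : reg s3 0 = in_L.
  rewrite f3 //; first by rewrite (frame_r0 f2).
have e4 : exec prologue_N s3 (bitlen (reg s3 (rv 2)) + bitlen (reg s3 0) +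
    (bitlen 100 + (bitlen (reg s3 (rv 2) + reg s3 0) + bitlen 100))) s4.
  by apply: ExecSeq; [constructor|apply: ExecSeq; [constructor|exact: (ExecArith Defs.Add (rv 2) (rv 2) (rt 0))]].
have v42 : reg s4 (rv 2) = in_N by rewrite /s4 /= /upd /= v3 r30; lia.
have v4 x : x != 2 -> reg s4 (rv x) = reg s1 (rv x).
  move=> x2; rewrite /s4 /= /upd rv_inj (negbTE x2) rv_rt.
  rewrite f3 ?rv_inj // => [|u]; last by rewrite rv_rt.
  by rewrite (frame_rv _ f2).
have m4 : ram s4 = ram s1 by rewrite /= m3 m2.
have r40 : reg s4 0 = in_L by rewrite /s4 /= /upd /=.
clearbody s4.
have rep4 : rep in_L mem0 s4 by split=> // *; rewrite m4; case: rep1 => _; apply.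
have g4 : good in_q in_q.+1 (env_of s4).
  have h x : env_of s4 x <= in_q.
    rewrite /env_of; case: (eqVneq x 2) => [->|x2]; first by rewrite v42.
    by rewrite v4 // v1; case: x {x2} => [|[|[|[|[|x]]]]]; lia.
  by split=> // x; apply: leq_ltn_trans (h x) qW.
have [k5 [s5 [e5 l5 v5 f5 m5]]] := @compE_ok _ _ _ qW LW isT mem0
  (sqE (sqE (sqE (sqE (Var 2))))) 0 s4 isT mem0_goodm g4 rep4.
have v5' : reg s5 (rt 0) = in_q.
  by rewrite v5 /=; have -> : env_of s4 2 = in_N by []; rewrite !mulnn -!expnM.
have [s6 [e6 m6 v6 f6]] := @exec_mov (rv 0) (rt 0) s5 isT.
have v6' x : reg s6 (rv x) = if x == 0 then in_q else reg s4 (rv x).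
  case: eqP => [->|/eqP x0]; first by rewrite v6.
  by rewrite f6 ?rv_inj // (frame_rv _ f5).
have m6' : ram s6 = ram s4 by rewrite m6 m5.
have r60 : reg s6 0 = in_L by rewrite f6 // (frame_r0 f5).
have rep6 : rep in_L mem0 s6 by split=> // *; rewrite m6'; case: rep4 => _; apply.
have g6 : good in_q in_q.+1 (env_of s6).
  split; first by rewrite /env_of v6'.
  by move=> x; rewrite /env_of v6'; case: ifP => // _; case: g4 => _; apply.
have [k7 [s7 [e7 l7 v7 f7 m7]]] := @compE_ok _ _ _ qW LW isT mem0
  (Big BProd 5 (Cst 2)) 0 s6 isT mem0_goodm g6 rep6.
have v7' : reg s7 (rt 0) = 2 ^ in_q.
  by rewrite v7 /= {1}/env_of v6' /= prod_nat_const_nat subn0.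
have [s8 [e8 m8 v8 f8]] := @exec_mov (rv 1) (rt 0) s7 isT.
have v8' : env_of s8 =1 env0.
  move=> x; rewrite /env_of; case: (eqVneq x 1) => [->|x1]; first by rewrite v8 v7'.
  rewrite f8 ?rv_inj // (frame_rv _ f7) v6'; case: (eqVneq x 0) => [->//|x0].
  case: (eqVneq x 2) => [->|x2]; first by rewrite v42.
  by rewrite v4 // v1; case: x x0 x1 x2 => [|[|[|[|[|x]]]]].
have m8' : ram s8 = ram s6 by rewrite m8 m7.
have r80 : reg s8 0 = in_L by rewrite f8 // (frame_r0 f7).
have rep8 : rep in_L mem0 s8 by split=> // *; rewrite m8'; case: rep6 => _; apply.
have g8 : good in_q in_q.+1 (env_of s8).
  apply: (@good_ext _ _ env0); first by move=> x; rewrite v8'.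
  split=> // x; case: x => [|[|[|[|[|x]]]]] //=; last by rewrite expn_gt0.
  - by rewrite ltn_exp2l.
  - by lia.
  - by lia.
  - by lia.
have [k9 [s9 [e9 l9 r9 f9]]] := @compP_ok _ _ _ qW LW isT p mem0 0 s8 wp mem0_goodm g8 rep8.
rewrite (evalP_ext _ _ _ v8') in r9.
eexists; exists s9; split.
- eapply ExecSeq; first by exact: e1.
  eapply ExecSeq; first by exact: e2.
  eapply ExecSeq; first by exact: e3.
  eapply ExecSeq; first by exact: e4.
  eapply ExecSeq; first by eapply ExecSeq; [exact: e5|exact: e6].
  eapply ExecSeq; first by eapply ExecSeq; [exact: e7|exact: e8].
  exact: e9.
- have b1 : bitlen (reg s3 (rv 2)) <= in_q by apply: bl; rewrite v3.
  have b2 : bitlen (reg s3 0) <= in_q by apply: bl; rewrite r30; lia.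
  have b3 : bitlen (reg s3 (rv 2) + reg s3 0) <= in_q by apply: bl; rewrite v3 r30; lia.
  have b4 : bitlen (reg s5 (rt 0)) <= in_q by apply: bl; rewrite v5'.
  have b5 : bitlen (reg s7 (rt 0)) <= in_q.+1.
    by apply: bitlen_le => //; rewrite v7' ltn_exp2l.
  have b6 : bitlen 100 = 7 by [].
  have h3 : nbits prd * (4 * in_q.+1 + 9) <= in_q * (4 * in_q.+1 + 9) by rewrite leq_mul2r nbq orbT.
  rewrite b6; apply: leq_add; first exact: l1.
  apply: leq_add; first exact: l2.
  by lia.
- move=> j jL; case: r9 => _ /(_ 0 j isT) <- //.
Qed.
End Machine.

Lemma machine_ok p : wfP p -> exists pp : {poly nat}, forall input t,
  in_L input = 2 * (in_m input * in_n input + in_m input + in_n input + in_n input + 1) ->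
  exists k s', [/\ exec (machine p) (init input t) k s',
    k <= (pp.[bitsize input])%R &
    forall j, j <= in_L input ->
      ram s' j = evalP (in_L input) p (env0 input) (mem0 input) 0 j].
Proof.
move=> wp.
pose F q := 30 * (q + 9) + (tE q q.+1 input_prod + (q * (4 * q.+1 + 9) + 1
      + (9 * (q + 9) + ((tE q q.+1 (sqE (sqE (sqE (sqE (Var 2))))) + q + 9)
      + ((tE q q.+1 (Big BProd 5 (Cst 2)) + q + 9) + tP q q.+1 p))))).
have [P1 hP1] : pbounded F.
  by rewrite /F; repeat first [apply: pb_tE | apply: pb_tP | progress pb].
have [P2 hP2] : pbounded (fun b => (2 * b + 101) ^ 16).
  apply: (@pb_ext (fun b => iterop 16 muln (2 * b + 101) 1)); first by move=> x; rewrite /expn /expn_rec.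
  by rewrite /=; pb.
exists (P1 \Po P2)%R => input t hL.
have [k [s' [e l h]]] := machine_exec hL t wp.
exists k, s'; split => //; apply: leq_trans l _.
apply: leq_trans (hP1 _) _; rewrite horner_comp; apply: poly_nat_mono.
apply: leq_trans (hP2 _); rewrite leq_exp2r //; exact: in_N_le_bits.
Qed.

Local Open Scope ring_scope.

(** * Local ratio for items with at most two rows *)

Section LocalRatio.
Variables (I K : finType) (sz : I -> K -> nat) (b : I -> nat).

(** The room that [e] leaves in row [i]. The value 1 is right even when [e] fills the row: sizes are
    integers, so any other item of the row blocks [e] by itself, and its [gi] is 1. *)
Definition den (i : I) (e : K) : nat := maxn 1 (b i - sz i e).
Definition gi (i : I) (e f : K) : rat := (minn (sz i f) (den i e))%:R / (den i e)%:R.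
Definition gr (e f : K) : rat := \sum_(i | sz i e != 0%N) gi i e f.
(** A bound on the value that [x] loses when [e] is picked, per unit of [w e]: the item [e]
    disappears, and each other weight drops by at most [w e * gr e f]. *)
Definition charge (e : K) (x : K -> rat) : rat := x e + \sum_(f | f != e) gr e f * x f.
Definition rowterm (i : I) (e : K) (x : K -> rat) : rat :=
  \sum_(f | f != e) gi i e f * x f.
Definition load (i : I) (x : K -> rat) : rat := \sum_k (sz i k)%:R * x k.

Record frac_feasible (R : {set K}) (x : K -> rat) : Prop := FracFeasible {
  ff_ge0 : forall k, 0 <= x k;
  ff_le1 : forall k, x k <= 1;
  ff_supp : forall k, k \notin R -> x k = 0;
  ff_load : forall i, load i x <= (b i)%:R
}.

Definition fits (k : K) : Prop := forall i, (sz i k <= b i)%N.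
Definition ends (k : K) : {set I} := [set i | sz i k != 0%N].

Lemma chargeE e x : charge e x = x e + \sum_(i in ends e) rowterm i e x.
Proof.
rewrite /charge /gr /rowterm; congr (_ + _).
under eq_bigr do rewrite mulr_suml.
rewrite exchange_big /=; apply: eq_bigl => i; by rewrite inE.
Qed.

Lemma den_gt0 i e : 0 < (den i e)%:R :> rat.
Proof. by rewrite ltr0n leq_max. Qed.

Lemma gi_ge0 i e f : 0 <= gi i e f.
Proof. by rewrite divr_ge0 ?ler0n. Qed.

Lemma gi_le1 i e f : gi i e f <= 1.
Proof. by rewrite ler_pdivrMr ?den_gt0 // mul1r ler_nat geq_minr. Qed.

Lemma gi_lin i e f : gi i e f <= (sz i f)%:R / (den i e)%:R.
Proof. by rewrite ler_pM2r ?invr_gt0 ?den_gt0 // ler_nat geq_minl. Qed.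

Lemma gi0 i e f : sz i f = 0%N -> gi i e f = 0.
Proof. by rewrite /gi => ->; rewrite min0n mul0r. Qed.

Lemma load_others i e R x : frac_feasible R x ->
  \sum_(f | f != e) (sz i f)%:R * x f <= (b i)%:R - (sz i e)%:R * x e.
Proof.
by move=> hx; have := ff_load hx i; rewrite /load (bigD1 e) //= => h; lra.
Qed.

Lemma rowterm_lin i e R x : frac_feasible R x ->
  rowterm i e x <= ((b i)%:R - (sz i e)%:R * x e) / (den i e)%:R.
Proof.
move=> hx; apply: le_trans (_ : (\sum_(f | f != e) (sz i f)%:R * x f) / (den i e)%:R <= _).
  rewrite /rowterm mulr_suml; apply: ler_sum => f _.
  rewrite [X in _ <= X]mulrAC; apply: ler_wpM2r; [exact: ff_ge0 hx f|exact: gi_lin].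
by rewrite ler_pM2r ?invr_gt0 ?den_gt0 //; apply: load_others hx.
Qed.

Lemma rowterm_full i e R x : frac_feasible R x -> fits e -> x e = 1 ->
  rowterm i e x <= 1.
Proof.
move=> hx he xe; apply: le_trans (rowterm_lin _ _ hx) _.
rewrite xe mulr1 ler_pdivrMr ?den_gt0 // mul1r -natrB // ler_nat leq_maxr //.
Qed.

(** With [a = sz i e] and [c = b i], the bound [x e + (c - a * x e) / (c - a)] is affine in [x e]
    with slope [1 - a / (c - a)], nonnegative as [2 * a <= c]; it is largest at [x e = 1], where it
    is 2. *)
Lemma rowterm_narrow i e R x : frac_feasible R x -> (0 < sz i e)%N ->
  (2 * sz i e <= b i)%N -> x e + rowterm i e x <= 2.
Proof.
move=> hx a0 ab; have := rowterm_lin i e hx.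
have -> : den i e = (b i - sz i e)%N by rewrite /den; lia.
have ab' : (sz i e <= b i)%N by lia.
rewrite natrB //; set a := (sz i e)%:R; set c := (b i)%:R => h.
have ha : 0 < a by rewrite ltr0n.
have hc : 2 * a <= c by rewrite -natrM ler_nat.
apply: le_trans (lerD (lexx _) h) _.
have d0 : 0 < c - a by lra.
rewrite -(@ler_pM2r _ (c - a)) // mulrDl divfK; last by lra.
have := ff_le1 hx e; nra.
Qed.

(* Adding [2 a - b] to the size of each of the at most two smaller items makes
   every blocker pay its share [a * gi] from the row capacity. *)
Lemma rowterm_wide i e R x (S : {set K}) : frac_feasible R x -> fits e ->
  (b i < 2 * sz i e)%N -> (#|S| <= 2)%N ->
  (forall f, x f != 0 -> sz i f != 0%N -> f \notin S -> (sz i e <= sz i f)%N) ->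
  x e + rowterm i e x <= 3.
Proof.
move=> hx he wide S2 big.
have ab := he i; set a := (sz i e)%:R : rat; set c := (b i)%:R : rat.
have a0 : 0 < a by rewrite ltr0n; lia.
have hac : a <= c by rewrite ler_nat.
have hwide : c <= 2 * a by rewrite -natrM ler_nat ltnW.
have hf f : a * (gi i e f * x f) <= (sz i f)%:R * x f + (2 * a - c) * (f \in S)%:R * x f.
  case: (eqVneq (x f) 0) => [->|xf]; first by rewrite !mulr0 addr0.
  rewrite mulrA -mulrDl; apply: ler_wpM2r; first exact: ff_ge0 hx f.
  case: (eqVneq (sz i f) 0%N) => [z|nz].
    by rewrite gi0 // mulr0 addr_ge0 ?ler0n // mulr_ge0 ?ler0n // subr_ge0.
  case: (boolP (f \in S)) => fS; last first.
    rewrite mulr0 addr0; apply: le_trans (_ : a * 1 <= _).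
      by rewrite ler_pM2l // gi_le1.
    by rewrite mulr1 ler_nat big.
  rewrite mulr1; case: (leqP (sz i f) (b i - sz i e)) => hs; last first.
    have h1 := gi_le1 i e f.
    have h2 : c - a <= (sz i f)%:R by rewrite -natrB // ler_nat ltnW.
    nra.
  have h1 := gi_lin i e f.
  have dE : den i e = (b i - sz i e)%N by rewrite /den; lia.
  rewrite dE natrB // -/a -/c in h1.
  have hs' : (sz i f)%:R <= c - a by rewrite -natrB // ler_nat.
  have s0 : 0 < (sz i f)%:R :> rat by rewrite ltr0n lt0n.
  have d0 : 0 < c - a by lra.
  apply: le_trans (_ : a * ((sz i f)%:R / (c - a)) <= _).
    by rewrite ler_pM2l.
  (* With [s] the size of [f], what remains is [s * (2 * a - c) <= (c - a) * (2 * a - c)], which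
     follows from [s <= c - a]. *)
  rewrite mulrA ler_pdivrMr //; nra.
have hS : \sum_(f | f != e) (2 * a - c) * (f \in S)%:R * x f <= (2 * a - c) * 2.
  apply: le_trans (_ : \sum_(f in S) (2 * a - c) <= _).
    rewrite big_mkcond [X in _ <= X]big_mkcond /=; apply: ler_sum => f _.
    have h0 : 0 <= 2 * a - c by lra.
    have := ff_ge0 hx f; have := ff_le1 hx f => h1 h2.
    case: (f != e); case: (f \in S) => //=; rewrite ?mulr1 ?mulr0 ?mul0r //; nra.
  rewrite sumr_const -[X in X <= _]mulr_natr; apply: ler_wpM2l; first by lra.
  by rewrite ler_nat.
have := load_others i e hx; rewrite -/a -/c => h1.
(* The right-hand side is [3 * c'] in disguise for the final bound: it equals [4 * a - c - a * x e],
   at most [3 * a - a * x e] since [a <= c]. *)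
have h2 : a * rowterm i e x <= (c - a * x e) + (2 * a - c) * 2.
  rewrite /rowterm mulr_sumr.
  apply: le_trans (_ : \sum_(f | f != e) ((sz i f)%:R * x f +
    (2 * a - c) * (f \in S)%:R * x f) <= _); first by apply: ler_sum.
  by rewrite big_split /=; lra.
rewrite -(@ler_pM2l _ a) // mulrDr; lra.
Qed.

Lemma charge_full e R x : frac_feasible R x -> fits e -> (#|ends e| <= 2)%N ->
  x e = 1 -> charge e x <= 3.
Proof.
move=> hx he e2 xe; rewrite chargeE xe.
have : \sum_(i in ends e) rowterm i e x <= \sum_(i in ends e) 1.
  by apply: ler_sum => i _; apply: rowterm_full hx _ _.
rewrite sumr_const => h; apply: le_trans (lerD (lexx _) h) _.
by rewrite -[1 in X in X + _]/(1%:R) -natrD ler_nat.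
Qed.

Definition deg (S : {set K}) (i : I) : nat := #|[set k in S | i \in ends k]|.
Definition cover_ends (S : {set K}) : {set I} := \bigcup_(k in S) ends k.

Lemma sum_deg (S : {set K}) :
  (\sum_(i in cover_ends S) deg S i = \sum_(k in S) #|ends k|)%N.
Proof.
under eq_bigr do rewrite /deg -sum1_card.
under [RHS]eq_bigr do rewrite -sum1_card.
rewrite (exchange_big_dep (fun k => k \in S)) /=; last by move=> i k _; rewrite inE => /andP[].
apply: eq_bigr => k kS; apply: eq_bigl => i.
rewrite inE kS /=; case: (boolP (i \in ends k)) => h; last by rewrite andbF.
by rewrite andbT; apply/bigcupP; exists k.
Qed.

Lemma rowterm_deg i e R x (S : {set K}) : frac_feasible R x ->
  (forall k, x k != 0 -> k \in S) -> e \in S -> i \in ends e ->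
  rowterm i e x <= (deg S i).-1%:R.
Proof.
move=> hx xS eS ie.
have -> : (deg S i).-1 = #|[set k in S | i \in ends k] :\ e|.
  by rewrite /deg (cardsD1 e [set k in S | i \in ends k]) inE eS ie.
rewrite -sumr_const /rowterm big_mkcond [X in _ <= X]big_mkcond /=; apply: ler_sum => f _.
rewrite !inE; case: (eqVneq f e) => //= fe.
case: (eqVneq (x f) 0) => [->|xf]; first by rewrite mulr0; case: ifP.
rewrite (xS _ xf) /=; case: (eqVneq (sz i f) 0%N) => [z|nz] /=; first by rewrite gi0 // mul0r.
have h1 := gi_le1 i e f; have h2 := gi_ge0 i e f; have h3 := ff_le1 hx f; have h4 := ff_ge0 hx f.
nra.
Qed.

(** Degree counting in the graph with rows as vertices and items as edges. If no item is cheap, the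
    items with two shared rows meet each of their rows at least twice, and more often where another
    item hangs. Hall's condition bounds the average degree by 2, so all degrees are 2 and nothing
    hangs; but then each row charges an item at most 1, and every item is cheap. *)
Lemma hall_cheap R x (S : {set K}) : frac_feasible R x ->
  (forall k, (k \in S) = (x k != 0)) -> S != set0 ->
  (forall k, k \in S -> fits k) -> (forall k, k \in S -> (#|ends k| <= 2)%N) ->
  (forall Q : {set K}, Q \subset S -> (#|Q| <= #|cover_ends Q|)%N) ->
  exists2 e, e \in S & charge e x <= 3.
Proof.
move=> hx hS S0 fS eS hall.
case: (boolP [exists e in S, charge e x <= 3]) => [/existsP[e /andP[]]|]; first by exists e.
move=> /existsPn no; exfalso.
have xS k : x k != 0 -> k \in S by rewrite hS.
have {}no e : e \in S -> ~~ (charge e x <= 3) by move=> h; have := no e; rewrite h.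
(* Hubs are the rows that [k] shares with other items of the support; a row met by [k] alone adds
   nothing to its charge. *)
pose hubs k := [set i in ends k | (1 < deg S i)%N].
have hub_sub k : hubs k \subset ends k by apply/subsetP => i; rewrite inE => /andP[].
have charge_hub e : e \in S -> charge e x <= x e + \sum_(i in hubs e) rowterm i e x.
  move=> he; rewrite chargeE lerD2l (bigID (mem (hubs e))) /=.
  rewrite -[X in _ <= X]addr0; apply: lerD.
    rewrite le_eqVlt; apply/orP; left; apply/eqP/eq_bigl => i.
    by rewrite andb_idl // => /(subsetP (hub_sub e)).
  apply: sumr_le0 => i /andP[ie]; rewrite inE ie /= -leqNgt => d1.
  apply: le_trans (rowterm_deg hx xS he ie) _.
  by case: (deg S i) d1 => [|[]].
have hub_gt0 k : k \in S -> (0 < #|hubs k|)%N.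
  move=> kS; rewrite lt0n cards_eq0; apply/negP => /eqP h0.
  have := no k kS; apply/negP/negPn; apply: le_trans (charge_hub _ kS) _.
  by rewrite h0 big_set0 addr0; apply: le_trans (ff_le1 hx k) _.
pose S' := [set k in S | (1 < #|hubs k|)%N].
have S'S : S' \subset S by apply/subsetP => k; rewrite inE => /andP[].
have ends_hub k : k \in S' -> hubs k = ends k /\ #|ends k| = 2%N.
  rewrite inE => /andP[kS h]; have := eS k kS; have := subset_leq_card (hub_sub k).
  move=> h1 h2; have E : #|ends k| = 2%N by lia.
  by split=> //; apply/eqP; rewrite eqEcard hub_sub; lia.
(* Otherwise the smallest one-hub item at [u] would be cheap: the only items at [u] that can be
   smaller are those of [S'], and [rowterm_wide] tolerates two of them. *)
have leaf_deg k u : k \in S -> k \notin S' -> u \in hubs k -> (2 < deg S' u)%N.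
  move=> kS kS' uk; rewrite ltnNge; apply/negP => d2.
  pose leaf k := [&& k \in S, k \notin S' & u \in hubs k].
  have lk : leaf k by apply/and3P.
  case: (arg_minnP (sz u) lk) => e /and3P[es es' eu] emin.
  have hubE : hubs e = [set u].
    apply/esym/eqP; rewrite eqEcard sub1set eu cards1.
    by move: es'; rewrite inE es /= -leqNgt.
  have ue : u \in ends e by apply: (subsetP (hub_sub e)).
  have := no e es; apply/negP/negPn; apply: le_trans (charge_hub _ es) _.
  rewrite hubE big_set1.
  case: (leqP (2 * sz u e) (b u)) => w.
    apply: le_trans (rowterm_narrow hx _ w) _ => //.
    by move: ue; rewrite inE lt0n.
  apply: (rowterm_wide hx (fS _ es) w d2) => f xf uf.
  rewrite !inE xS //= uf andbT => nf; apply: emin; apply/and3P; split; rewrite ?xS //.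
    by rewrite inE xS.
  by rewrite !inE uf; move: eu; rewrite inE => /andP[].
(* If no one-hub item meets [v], all items of the support at [v] belong to [S'], and a hub has at
   least two. *)
have deg2 v : v \in cover_ends S' -> (2 <= deg S' v)%N /\
    ((exists2 k, k \in S :\: S' & v \in hubs k) -> (2 < deg S' v)%N).
  case/bigcupP => k kS' vk; have [hE e2] := ends_hub k kS'.
  have vb : (1 < deg S v)%N by move: vk; rewrite -hE inE => /andP[].
  split; last by case=> k'; rewrite inE => /andP[n1 n2] n3; apply: leaf_deg n3.
  case: (boolP [exists k', [&& k' \in S, k' \notin S' & v \in hubs k']]).
    by case/existsP => k' /and3P[n1 n2 n3]; apply: ltnW; apply: leaf_deg n3.
  move=> /existsPn nl; apply: (leq_trans vb); apply: subset_leq_card.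
  apply/subsetP => k'; rewrite !inE => /andP[k'S k'v]; rewrite k'v andbT k'S /=.
  have := nl k'; rewrite k'S !inE k'v k'S /= => /nandP[|].
    by rewrite negbK.
  by rewrite ltnNge negbK => h; have := leq_trans vb h; rewrite ltnn.
have sumS' : (\sum_(i in cover_ends S') deg S' i = 2 * #|S'|)%N.
  rewrite sum_deg (eq_bigr (fun=> 2%N)); last by move=> k /ends_hub[].
  by rewrite sum_nat_const mulnC.
have H := hall S' S'S.
have deg2' v : v \in cover_ends S' -> deg S' v = 2%N.
  move=> hv; apply/eqP; rewrite eqn_leq (deg2 v hv).1 andbT leqNgt; apply/negP => d3.
  have : (2 * #|cover_ends S'| < \sum_(i in cover_ends S') deg S' i)%N.
    rewrite (bigD1 v) //= mulnC -sum_nat_const (bigD1 v) //= -addSn leq_add //.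
    by apply: leq_sum => i /andP[hi _]; case: (deg2 i hi).
  by rewrite sumS'; lia.
have SS' : S' = S.
  apply/eqP; rewrite eqEsubset S'S; apply/subsetP => k kS; apply/negPn/negP => kS'.
  have /card_gt0P[u uk] := hub_gt0 k kS.
  have d3 := leaf_deg k u kS kS' uk.
  have hu : u \in cover_ends S'.
    have : (0 < deg S' u)%N by lia.
    by case/card_gt0P => k'; rewrite inE => /andP[n1 n2]; apply/bigcupP; exists k'.
  by have := deg2' u hu; lia.
case/set0Pn: S0 => e es.
have := no e es; apply/negP/negPn; rewrite chargeE.
have : \sum_(i in ends e) rowterm i e x <= \sum_(i in ends e) 1.
  apply: ler_sum => i ie; apply: le_trans (rowterm_deg hx xS es ie) _.
  by rewrite -[S in deg S]SS' deg2' //; apply/bigcupP; exists e => //; rewrite SS'.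
rewrite sumr_const => h; apply: le_trans (lerD (ff_le1 hx e) h) _.
by rewrite -[1 in X in X + _]/(1%:R) -natrD ler_nat; have := eS e es.
Qed.

(** There are fewer equations than unknowns, because a direction supported in [Q] is constrained
    only by the rows that [Q] meets. *)
Lemma kernel_dir (Q : {set K}) : (#|cover_ends Q| < #|Q|)%N ->
  exists d : K -> rat, [/\ exists k, d k != 0, forall k, k \notin Q -> d k = 0 &
    forall i, \sum_k (sz i k)%:R * d k = 0].
Proof.
move=> h; set V := cover_ends Q.
pose B : 'M[rat]_(#|Q|, #|V|) := \matrix_(a, c) (sz (enum_val c) (enum_val a))%:R.
have rB : ~~ row_free B.
  by rewrite /row_free; have := rank_leq_col B; apply: contraL => /eqP ->; rewrite -ltnNge.
rewrite -kermx_eq0 in rB; have /rowV0Pn[u ku u0] := rB.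
have uB : u *m B = 0 by apply/sub_kermxP.
pose d k := \sum_(a < #|Q| | enum_val a == k) u 0 a.
have dE a : d (enum_val a) = u 0 a.
  rewrite /d (big_pred1 a) // => a'; by rewrite /= (inj_eq enum_val_inj).
have dQ k : k \notin Q -> d k = 0.
  move=> kQ; rewrite /d big1 // => a /eqP ak; by rewrite -ak enum_valP in kQ.
exists d; split => //.
  have /rV0Pn[a ha] := u0; by exists (enum_val a); rewrite dE.
move=> i; rewrite (bigID (mem Q)) /= [X in _ + X]big1 ?addr0; last first.
  by move=> k /dQ ->; rewrite mulr0.
rewrite big_enum_val /=; under eq_bigr do rewrite dE.
case: (boolP (i \in V)) => iV; last first.
  rewrite big1 // => a _; have -> : sz i (enum_val a) = 0%N; last by rewrite mul0r.
  apply/eqP/negPn/negP => nz; case/negP: iV; apply/bigcupP; exists (enum_val a).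
    exact: enum_valP.
  by rewrite inE.
have /matrixP/(_ 0 (enum_rank_in iV i)) := uB; rewrite !mxE => E; rewrite -[RHS]E.
by apply: eq_bigr => a _; rewrite !mxE enum_rankK_in // mulrC.
Qed.

(* As long as some items outnumber the rows they meet, a direction in the kernel of
   their constraint matrix allows to make one more coordinate integral without
   losing value. *)
Lemma cheap_vertex (R : {set K}) (w : K -> rat) z : frac_feasible R z -> R != set0 ->
  (forall k, k \in R -> fits k) -> (forall k, k \in R -> (#|ends k| <= 2)%N) ->
  exists e z', [/\ e \in R, frac_feasible R z', \sum_k w k * z k <= \sum_k w k * z' k &
    charge e z' <= 3].
Proof.
move=> hz R0 fR eR; have [n] := ubnP #|[set k | z k != 0]|.
elim: n z hz => // n IH z hz; set S := [set k | z k != 0]; rewrite ltnS => Sn.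
have SR k : k \in S -> k \in R.
  by rewrite inE; apply: contraR => /(ff_supp hz) ->.
have [S0|S0] := eqVneq S set0.
  case/set0Pn: R0 => e eR'; exists e, z; split => //.
  have z0 k : z k = 0.
    apply/eqP/negPn/negP => h; have : k \in S by rewrite inE.
    by rewrite S0 inE.
  by rewrite /charge z0 big1 ?addr0 // => f _; rewrite z0 mulr0.
case: (boolP [forall Q : {set K}, (Q \subset S) ==> (#|Q| <= #|cover_ends Q|)%N]).
  move=> /forallP hall.
  have [k|||Q QS|e eS ce] := hall_cheap hz _ S0 _ _ _; first by rewrite inE.
  - by move=> k /SR; apply: fR.
  - by move=> k /SR; apply: eR.
  - by have := hall Q; rewrite QS.
  - by exists e, z; split=> //; apply: SR.
rewrite negb_forall => /existsP[Q]; rewrite negb_imply -ltnNge => /andP[QS /kernel_dir].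
case=> d0 [[k0 d0k0] d0Q d0s].
(* Of two opposite directions, one does not decrease the value. *)
have [d [dn dQ ds dw]] : exists d : K -> rat, [/\ exists k, d k != 0,
    forall k, k \notin Q -> d k = 0, forall i, \sum_k (sz i k)%:R * d k = 0 &
    0 <= \sum_k w k * d k].
  case: (lerP 0 (\sum_k w k * d0 k)) => h; first by exists d0; split=> //; exists k0.
  exists (fun k => - d0 k); split.
  - by exists k0; rewrite oppr_eq0.
  - by move=> k /d0Q ->; rewrite oppr0.
  - by move=> i; under eq_bigr do rewrite mulrN; rewrite sumrN d0s oppr0.
  - by under eq_bigr do rewrite mulrN; rewrite sumrN oppr_ge0 ltW.
case: dn => k1 dk1.
have xi01 k := ff_ge0 hz k; have xi1 k := ff_le1 hz k.
(* The step length at which coordinate [k] reaches 1 if it increases, 0 if it decreases; the least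
   of them is the longest step that stays in the box. *)
pose ratio k := if 0 < d k then (1 - z k) / d k else z k / - d k.
case: (arg_minP (P := fun k => d k != 0) ratio dk1) => k2 dk2 hmin.
set th := ratio k2.
have rat_ge0 k : d k != 0 -> 0 <= ratio k.
  rewrite /ratio => dk; case: ltrP => h.
    by rewrite divr_ge0 ?(ltW h) // subr_ge0.
  by rewrite divr_ge0 // oppr_ge0.
have th0 : 0 <= th by apply: rat_ge0.
pose z' k := z k + th * d k.
have z'01 k : 0 <= z' k <= 1.
  rewrite /z'; case: (eqVneq (d k) 0) => [->|dk]; first by rewrite mulr0 addr0 xi01 xi1.
  have := hmin k dk; rewrite -/th {1}/ratio; case: ltrP => h.
    rewrite ler_pdivlMr // => h'; have := xi01 k; have := xi1 k.
    have : 0 <= th * d k by rewrite mulr_ge0 // ltW.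
    by move=> *; apply/andP; split; lra.
  have hd : 0 < - d k by rewrite oppr_gt0 lt_neqAle dk.
  rewrite ler_pdivlMr // => h'; have := xi01 k; have := xi1 k.
  have : th * d k <= 0 by rewrite mulr_ge0_le0.
  by move=> *; apply/andP; split; lra.
have z'f : frac_feasible R z'.
  split.
  - by move=> k; case/andP: (z'01 k).
  - by move=> k; case/andP: (z'01 k).
  - move=> k kR; rewrite /z' (ff_supp hz kR) dQ ?mulr0 ?addr0 //.
    by apply: contra kR => kQ; apply: SR; apply: (subsetP QS).
  - move=> i; rewrite /load; under eq_bigr do rewrite /z' mulrDr mulrCA.
    by rewrite big_split /= -mulr_sumr ds mulr0 addr0; apply: ff_load hz i.
have wz' : \sum_k w k * z k <= \sum_k w k * z' k.
  under [X in _ <= X]eq_bigr do rewrite /z' mulrDr mulrCA.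
  by rewrite big_split /= -mulr_sumr lerDl mulr_ge0.
have k2S : k2 \in S.
  by apply: (subsetP QS); apply: contraNT dk2 => /dQ ->.
(* A coordinate that reaches 1 ends the search, its item being cheap by [charge_full]; one that
   reaches 0 shrinks the support, on which the induction runs. *)
case: (ltrP 0 (d k2)) => dpos.
  have z1 : z' k2 = 1.
    by rewrite /z' /th /ratio dpos divfK // addrC subrK.
  exists k2, z'; split => //; first exact: SR.
  by apply: (charge_full z'f _ _ z1); [apply/fR/SR|apply/eR/SR].
have z2 : z' k2 = 0.
  rewrite /z' /th /ratio ltNge dpos /= invrN mulrN mulNr divfK // subrr //.
have [|e [z'' [h1 h2 h3 h4]]] := IH z' z'f.
  apply: leq_trans Sn; apply: proper_card; apply/properP; split.
    apply/subsetP => k; rewrite !inE /z'; apply: contra => /eqP zk.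
    rewrite zk dQ ?mulr0 ?addr0 //; apply/negP => /(subsetP QS).
    by rewrite inE zk eqxx.
  by exists k2 => //; rewrite inE z2 eqxx.
by exists e, z''; split => //; apply: le_trans wz' h3.
Qed.

(* The charges are multiplied by [denprod e] so that the weights stay integral. *)
Definition denprod (e : K) : nat := (\prod_(i | sz i e != 0) den i e)%N.
Definition grn (e f : K) : nat :=
  (\sum_(i | sz i e != 0) denprod e %/ den i e * minn (sz i f) (den i e))%N.

Lemma denprod_gt0 e : (0 < denprod e)%N.
Proof. by apply: prodn_gt0 => i; rewrite leq_max. Qed.

Lemma grnE e f : (grn e f)%:R = (denprod e)%:R * gr e f :> rat.
Proof.
rewrite /grn /gr natr_sum mulr_sumr; apply: eq_bigr => i ie.
have d0 : (0 < den i e)%N by rewrite leq_max.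
rewrite natrM /gi mulrA mulrAC; congr (_ * _).
have dv : (den i e %| denprod e)%N by rewrite /denprod (bigD1 i) //= dvdn_mulr.
by rewrite -[in RHS](divnK dv) natrM mulfK // pnatr_eq0 -lt0n.
Qed.

Definition active (w : {ffun K -> nat}) : {set K} := [set k | w k != 0%N].
(** Truncated subtraction gives weight 0 to the items whose reduced weight would be negative, so
    that they leave [active] for good. *)
Definition local_step (e : K) (w : {ffun K -> nat}) : {ffun K -> nat} :=
  [ffun f => if f == e then 0%N else (denprod e * w f - w e * grn e f)%N].
Definition sload (S : {set K}) (i : I) : nat := (\sum_(k in S) sz i k)%N.
Definition insert (e : K) (S : {set K}) : {set K} :=
  if [forall i, (sload S i + sz i e <= b i)%N] then e |: S else S.
Definition weight (w : {ffun K -> nat}) (S : {set K}) : nat := (\sum_(k in S) w k)%N.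

Lemma active_step e w : active (local_step e w) \subset active w :\ e.
Proof.
apply/subsetP => f; rewrite !inE ffunE; case: (eqVneq f e) => //= _ h.
by apply/negP => /eqP wf; move: h; rewrite wf muln0 sub0n.
Qed.

Definition good_pick (eta : rat) (w : {ffun K -> nat}) (e : K) : Prop :=
  w e != 0%N /\
  exists x, [/\ frac_feasible (active w) x, charge e x <= 3 &
    forall z, frac_feasible (active w) z ->
      (1 - eta) * \sum_k (w k)%:R * z k <= \sum_k (w k)%:R * x k].

(** A relation and not a function, since any pick with [good_pick] will do. [e] is inserted after
    the recursive solution is known, so later picks take precedence. *)
Inductive solved (eta : rat) : {ffun K -> nat} -> {set K} -> Prop :=
| SolvedNil w : active w = set0 -> solved eta w set0
| SolvedStep w e S : good_pick eta w e -> solved eta (local_step e w) S ->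
    solved eta w (insert e S).

Lemma solved_active eta w S : solved eta w S -> S \subset active w.
Proof.
elim=> {w S} [w _|w e S [we _] _ IH]; first exact: sub0set.
have h : S \subset active w.
  by apply: subset_trans IH _; apply: subset_trans (active_step _ _) _; apply: subD1set.
rewrite /insert; case: ifP => // _.
by apply/subsetP => k; rewrite in_setU1 => /orP[/eqP->|/(subsetP h)//]; rewrite inE.
Qed.

Lemma solved_feasible eta w S i : solved eta w S -> (sload S i <= b i)%N.
Proof.
elim=> {w S} [w _|w e S [we _] sS IH]; first by rewrite /sload big_set0.
rewrite /insert; case: ifP => // /forallP/(_ i) h; apply: leq_trans h.
rewrite /sload big_setU1 /=; first by rewrite addnC.
by apply/negP => /(subsetP (solved_active sS)); rewrite inE ffunE eqxx.
Qed.

(** If [e] is inserted, its own weight is gained. If it does not fit, some row [i] has load above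
    [b i - sz i e], so the sizes of [S] truncated at [den i e] add up to at least [den i e], and the
    weight that the step took from [S] already amounts to [denprod e * w e]. *)
Lemma insert_weight e w (S : {set K}) : fits e -> S \subset active (local_step e w) ->
  (forall i, (sload S i <= b i)%N) -> (weight (local_step e w) S + denprod e * w e <= denprod e * weight w (insert e S))%N.
Proof.
move=> Fe SA SF; have eS : e \notin S.
  by apply/negP => /(subsetP SA); rewrite inE ffunE eqxx.
(* Items of [S] have positive reduced weight, so the truncated subtraction is exact on them. *)
have wE f : f \in S -> (denprod e * w f = local_step e w f + w e * grn e f)%N.
  move=> fS; have := subsetP SA _ fS; rewrite inE ffunE.
  have -> : f == e = false by apply: contraNF eS => /eqP <-.
  by lia.
have wS : (denprod e * weight w S = weight (local_step e w) S + w e * \sum_(f in S) grn e f)%N.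
  rewrite /weight !big_distrr /= -big_split /=; apply: eq_bigr => f fS.
  by rewrite wE.
rewrite /insert; case: (boolP [forall i, _]) => [_|].
  have -> : weight w (e |: S) = (w e + weight w S)%N by rewrite /weight big_setU1.
  by rewrite mulnDr wS; lia.
rewrite negb_forall => /existsP[i]; rewrite -ltnNge => bi.
rewrite wS leq_add2l mulnC leq_mul2l; apply/orP; right.
have ie : sz i e != 0%N by have := SF i; lia.
have d0 : (0 < den i e)%N by rewrite leq_max.
(* Either a single item reaches [den i e], or no size is truncated and the sum is the whole load. *)
have hm : (den i e <= \sum_(f in S) minn (sz i f) (den i e))%N.
  case: (boolP [exists f in S, (den i e <= sz i f)%N]) => [/existsP[f /andP[fS hf]]|].
    by rewrite (bigD1 f) //= (minn_idPr hf) leq_addr.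
  move=> /existsPn no; apply: leq_trans (_ : (sload S i <= _)%N).
    by have := Fe i; rewrite /den; lia.
  rewrite /sload; apply: leq_sum => f fS; have := no f; rewrite fS /= -ltnNge.
  by lia.
apply: leq_trans (_ : (denprod e %/ den i e * \sum_(f in S) minn (sz i f) (den i e) <= _)%N).
  have dv : (den i e %| denprod e)%N by rewrite /denprod (bigD1 i) //= dvdn_mulr.
  by rewrite -[X in (X <= _)%N](divnK dv) leq_mul2l hm orbT.
rewrite big_distrr /=; apply: leq_sum => f _.
by rewrite /grn (bigD1 i) //= leq_addr.
Qed.

(** With [P = denprod e], the fractional solution [x] of the pick loses at most [3 * P * w e] in
    value, while the integral one gains at least [P * w e] by [insert_weight]; the ratio 3 is thus
    preserved, up to a factor [1 - eta] for comparing [x] with the optimum. Each round deactivates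
    [e], which bounds the number of factors. *)
Theorem solved_ratio (eta : rat) w S : 0 <= eta <= 1 -> solved eta w S ->
  (forall k, k \in active w -> fits k) ->
  forall r z, (#|active w| <= r)%N -> frac_feasible (active w) z ->
    (1 - eta) ^+ r * \sum_k (w k)%:R * z k <= 3 * (weight w S)%:R.
Proof.
move=> /andP[eta0 eta1]; elim=> {w S} [w a0|w e S [we [x [hx cx mx]]] sS IH] fR r z wr hz.
  rewrite big1 ?mulr0 ?mulr_ge0 // => k _.
  by rewrite (ff_supp hz) ?mulr0 // a0 inE.
have ea : e \in active w by rewrite inE.
case: r wr => [|r] wr.
  by move: wr; rewrite leqn0 cards_eq0 => /eqP a0; rewrite a0 inE in ea.
set w' := local_step e w in sS IH.
have aw' : active w' \subset active w :\ e := active_step e w.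
have w'r : (#|active w'| <= r)%N.
  have := subset_leq_card aw'; have := cardsD1 e (active w); rewrite ea; lia.
have fR' k : k \in active w' -> fits k.
  by move=> /(subsetP aw'); rewrite in_setD1 => /andP[_]; apply: fR.
(* The induction hypothesis asks for a solution supported in the new active set; the items cut off
   have new weight 0, so no value is lost. *)
pose x' k := if k \in active w' then x k else 0.
have hx' : frac_feasible (active w') x'.
  split.
  - by move=> k; rewrite /x'; case: ifP => // _; apply: ff_ge0 hx k.
  - by move=> k; rewrite /x'; case: ifP => // _; apply: ff_le1 hx k.
  - by move=> k h; rewrite /x' (negbTE h).
  - move=> i; apply: le_trans (ff_load hx i); apply: ler_sum => k _.
    rewrite /x'; case: ifP => // _; rewrite mulr0 mulr_ge0 ?ler0n //.
    exact: ff_ge0 hx k.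
have IHx := IH fR' r x' w'r hx'.
set P := (denprod e)%:R : rat.
have P0 : 0 < P by rewrite ltr0n denprod_gt0.
have hw' : P * (\sum_k (w k)%:R * x k) - 3 * (P * (w e)%:R) <= \sum_k (w' k)%:R * x' k.
  have h1 : P * (\sum_k (w k)%:R * x k) - P * (w e)%:R * charge e x <= \sum_k (w' k)%:R * x' k.
    have -> : \sum_k (w' k)%:R * x' k = \sum_(k | k != e) (w' k)%:R * x k.
      rewrite (bigD1 e) //= [w' e]ffunE eqxx mul0r add0r; apply: eq_bigr => k ke.
      by rewrite /x' inE; case: eqP => //= ->; rewrite !mul0r.
    rewrite (bigD1 e) //= /charge !mulrDr.
    have -> : P * ((w e)%:R * x e) = P * (w e)%:R * x e by rewrite mulrA.
    rewrite opprD addrACA subrr add0r !mulr_sumr -sumrB; apply: ler_sum => k ke.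
    rewrite !mulrA -mulrBl; apply: ler_wpM2r; first exact: ff_ge0 hx k.
    rewrite [w' k]ffunE (negbTE ke) mulrAC -grnE -!natrM.
    rewrite lerBlDr -natrD ler_nat [(grn e k * _)%N]mulnC; lia.
  apply: le_trans h1; rewrite lerD2l lerN2 [3 * _]mulrC; apply: ler_wpM2l => //.
  by rewrite mulr_ge0 ?ler0n // ltW.
have hins : (weight w' S)%:R + P * (w e)%:R <= P * (weight w (insert e S))%:R.
  rewrite -!natrM -natrD ler_nat; apply: insert_weight; [exact: fR|exact: solved_active sS|].
  by move=> i; apply: solved_feasible sS.
have hmx := mx z hz.
set A := \sum_k (w k)%:R * z k in hmx *; set B := \sum_k (w k)%:R * x k in hmx hw'.
set E := (1 - eta) ^+ r in IHx *.
have E0 : 0 <= E by rewrite exprn_ge0 // subr_ge0.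
have E1 : E <= 1 by rewrite exprn_ile1 // ?subr_ge0 // lerBlDr lerDl.
rewrite -(@ler_pM2l _ P) //.
have L0 : 0 <= P * (w e)%:R by rewrite mulr_ge0 ?ler0n // ltW.
have t1 : E * (P * B - 3 * (P * (w e)%:R)) <= 3 * (weight w' S)%:R.
  by apply: le_trans IHx; apply: ler_wpM2l.
have t2 : E * ((1 - eta) * A) <= E * B by apply: ler_wpM2l.
have t3 : P * (E * ((1 - eta) * A)) <= P * (E * B) by rewrite ler_pM2l.
have t4 : E * (3 * (P * (w e)%:R)) <= 3 * (P * (w e)%:R).
  by rewrite ler_piMl // mulr_ge0.
have -> : (1 - eta) ^+ r.+1 = E * (1 - eta) by rewrite exprSr.
have t5 : P * (3 * (weight w (insert e S))%:R) >= 3 * (weight w' S)%:R + 3 * (P * (w e)%:R).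
  by lra.
apply: le_trans t5.
have -> : P * (E * (1 - eta) * A) = P * (E * ((1 - eta) * A)) by ring.
have t6 : E * (P * B - 3 * (P * (w e)%:R)) = P * (E * B) - E * (3 * (P * (w e)%:R)) by ring.
lra.
Qed.
End LocalRatio.

(** * Approximate packing linear programs *)

(* A greedy algorithm with quadratic potential: [cnt] counts how often each item
   was chosen, [s] is the scale for which [cnt / s] has at least the value of every
   packing of capacity 1, and the potential is the sum of the squares of the excesses [exc] of the loads
   over [s].  The next item minimises price per weight. *)
Section Packing.
Variables (J K : finType) (a : J -> K -> nat) (w : K -> nat) (G T : nat) (rel : {set J}).

Definition ld (cnt : K -> nat) (j : J) : nat := (\sum_k cnt k * a j k)%N.
Definition exc (cnt : K -> nat) (s : nat) (j : J) : nat := (ld cnt j - s)%N.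
Definition excT (cnt : K -> nat) (s : nat) : nat := (\sum_j exc cnt s j)%N.
Definition price (cnt : K -> nat) (s : nat) (k : K) : nat := (\sum_j exc cnt s j * a j k)%N.

Definition act : {set K} := [set k | w k != 0%N].

Hypothesis aG : forall j k, k \in act -> (a j k <= G)%N.
(** The number of steps must depend on [#|rel|] and not on [#|J|]: in the program [J] has
    [2 * q + 1] elements, and the steps are only [q]. *)
Hypothesis arel : forall j k, k \in act -> j \notin rel -> a j k = 0%N.
Hypothesis GT : (2 * T <= G)%N.

Definition best_item (cnt : K -> nat) (s : nat) (k0 : K) : Prop :=
  k0 \in act /\
  forall k, k \in act -> (price cnt s k0 * w k <= price cnt s k * w k0)%N.

Definition packable (G' : rat) (z : K -> rat) : Prop :=
  [/\ 0 <= G', forall k, 0 <= z k, forall k, k \notin act -> z k = 0 &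
      forall j, \sum_k (a j k)%:R * z k <= G'].

(** In [mi_val] the capacity [G'] is arbitrary, because rounding the coefficients enlarges the
    capacity of the competitors to [G + n]. *)
Record mwu_inv (t : nat) (cnt : K -> nat) (s : nat) : Prop := MwuInv {
  mi_sum : (\sum_k cnt k = t)%N;
  mi_act : forall k, k \notin act -> cnt k = 0%N;
  mi_pot : (\sum_j exc cnt s j ^ 2 <= t * (2 * #|rel| * G ^ 2))%N;
  mi_val : forall G' z, packable G' z ->
    s%:R * (\sum_k (w k)%:R * z k) <= (\sum_k (w k)%:R * (cnt k)%:R) * G' :> rat
}.

Lemma mwu_init : mwu_inv 0 (fun=> 0%N) 0.
Proof.
split=> //; first by rewrite big1.
- rewrite mul0n leqn0 sum_nat_eq0; apply/forallP => j; apply/implyP => _.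
  by rewrite /exc /ld big1.
- by move=> G' z _; rewrite mul0r big1 ?mul0r // => k _; rewrite mulr0.
Qed.

Lemma ld_le t cnt s j : mwu_inv t cnt s -> (ld cnt j <= t * G)%N.
Proof.
move=> h; rewrite -(mi_sum h) big_distrl /=; apply: leq_sum => k _.
case: (boolP (k \in act)) => ka; first by rewrite leq_mul2l aG // orbT.
by rewrite (mi_act h ka).
Qed.

Lemma ld_irrel t cnt s j : mwu_inv t cnt s -> j \notin rel -> ld cnt j = 0%N.
Proof.
move=> h jr; rewrite /ld big1 // => k _.
case: (boolP (k \in act)) => ka; first by rewrite arel // muln0.
by rewrite (mi_act h ka).
Qed.

Lemma excT_le t cnt s : mwu_inv t cnt s -> (excT cnt s <= #|rel| * (t * G))%N.
Proof.
move=> h; rewrite /excT (bigID (mem rel)) /= [X in (_ + X)%N]big1 ?addn0.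
  rewrite -sum_nat_const; apply: leq_sum => j _.
  exact: leq_trans (leq_subr _ _) (ld_le _ h).
by move=> j jr; rewrite /exc (ld_irrel h jr).
Qed.

Lemma price_le cnt s k : k \in act -> (price cnt s k <= G * excT cnt s)%N.
Proof.
move=> ka; rewrite /excT big_distrr /=; apply: leq_sum => j _.
by rewrite mulnC leq_mul2r aG ?orbT.
Qed.

(** Expansion of a square: the excess changes by [c - kp], whose square is at most [g ^ 2], and
    truncation at 0 only helps. The negative cross term stands on the left to stay in [nat]. *)
Lemma exc_step l s c kp (g := G) : (c <= g)%N -> (kp <= g)%N ->
  ((l + c - (s + kp)) ^ 2 + 2 * (l - s) * kp <= (l - s) ^ 2 + 2 * (l - s) * c + g ^ 2)%N.
Proof.
move=> cg kg; rewrite -!mulnn.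
case: (leqP l s) => ls; first by (have -> : (l - s = 0)%N by lia); nia.
have [y ->] : exists y, l = (s + y)%N by exists (l - s)%N; lia.
have -> : (s + y - s = y)%N by lia.
have -> : (s + y + c - (s + kp) = y + c - kp)%N by lia.
case: (leqP kp (y + c)) => h; last by (have -> : (y + c - kp = 0)%N by lia); nia.
have [u E] : exists u, (y + c = kp + u)%N by exists (y + c - kp)%N; lia.
have -> : (y + c - kp = u)%N by lia.
case: (leqP kp c) => kc.
  have [v Ev] : exists v, (c = kp + v)%N by exists (c - kp)%N; lia.
  have -> : u = (y + v)%N by lia.
  nia.
have [v Ev] : exists v, (kp = c + v)%N by exists (kp - c)%N; lia.
have Ey : (y = u + v)%N by lia.
nia.
Qed.

(** The scale grows by the average of the column of [k0] weighted by the excesses, so the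
    first-order change of the potential vanishes up to rounding. For [mi_val], a packing of capacity
    [G'] has total price at most [excT * G'], and [k0] has the least price per weight. *)
Lemma mwu_step t cnt s k0 : (t < T)%N -> mwu_inv t cnt s -> best_item cnt s k0 ->
  mwu_inv t.+1 (fun k => if k == k0 then (cnt k).+1 else cnt k)
    (s + price cnt s k0 %/ excT cnt s).
Proof.
move=> tT h [k0a hbest]; set kp := (_ %/ _)%N; set cnt' := fun k => _.
have ldS j : ld cnt' j = (ld cnt j + a j k0)%N.
  rewrite /ld (bigD1 k0) //= [in RHS](bigD1 k0) //= /cnt' eqxx mulSn -!addnA addnC -!addnA.
  by congr (_ + (_ + _))%N; rewrite ?[RHS]addnC //; apply: eq_bigr => k /negbTE ->.
have kpG : (kp <= G)%N.
  case: (posnP (excT cnt s)) => Y0; first by rewrite /kp Y0 divn0.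
  by rewrite -(leq_pmul2r Y0); apply: leq_trans (leq_trunc_div _ _) _; apply: price_le.
split.
- rewrite (bigD1 k0) //= /cnt' eqxx addSn -(mi_sum h) [in RHS](bigD1 k0) //=.
  by congr (_ + _).+1; apply: eq_bigr => k /negbTE ->.
- move=> k ka; rewrite /cnt' (mi_act h ka); case: eqP => // kk.
  by rewrite kk k0a in ka.
- have key : (\sum_j exc cnt' (s + kp) j ^ 2 + 2 * excT cnt s * kp <=
      \sum_j exc cnt s j ^ 2 + 2 * price cnt s k0 + #|rel| * G ^ 2)%N.
    rewrite /excT /price !big_distrr /= big_distrl /= -!big_split /=.
    apply: leq_trans (_ : (\sum_j (exc cnt s j ^ 2 + 2 * (exc cnt s j * a j k0) +
      (j \in rel) * G ^ 2) <= _)%N); last first.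
      rewrite big_split /= leq_add2l -big_distrl /= leq_mul2r; apply/orP; right.
      rewrite -sum1_card [X in (_ <= X)%N]big_mkcond /=.
      by apply: leq_sum => j _; case: (j \in rel).
    apply: leq_sum => j _; rewrite /exc ldS; case: (boolP (j \in rel)) => jr.
      have := @exc_step (ld cnt j) s (a j k0) kp (aG j k0a) kpG.
      by rewrite mul1n !mulnA.
    by rewrite (ld_irrel h jr) (arel k0a jr).
  have hY := excT_le h.
  have hdiv : (price cnt s k0 <= kp * excT cnt s + excT cnt s)%N.
    case: (posnP (excT cnt s)) => Y0.
      by have := price_le cnt s k0a; rewrite Y0 muln0 leqn0 => /eqP ->.
    by rewrite {1}(divn_eq (price cnt s k0) (excT cnt s)) leq_add2l ltnW // ltn_mod.
  (* Rounding [kp] down costs at most [2 * excT] in potential; by [2 * T <= G] this is one more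
     [#|rel| * G ^ 2], whence the factor 2 in [mi_pot]. *)
  have hG : (2 * (#|rel| * (t * G)) <= #|rel| * G ^ 2)%N.
    by rewrite mulnCA leq_mul2l -mulnn; apply/orP; right; nia.
  have := mi_pot h; rewrite mulSn.
  set X := (\sum_j exc cnt s j ^ 2)%N in key *; set X' := (\sum_j _)%N in key *.
  set M2 := (#|rel| * G ^ 2)%N in key hG *.
  have -> : (2 * #|rel| * G ^ 2 = 2 * M2)%N by rewrite /M2 mulnA.
  by set t2 := (t * _)%N; nia.
- move=> G' z hz; have [G0 z0 zs za] := hz; have hv := mi_val h hz.
  have -> : \sum_k (w k)%:R * (cnt' k)%:R = (w k0)%:R + \sum_k (w k)%:R * (cnt k)%:R :> rat.
    rewrite (bigD1 k0) //= [in RHS](bigD1 k0) //= /cnt' eqxx -addn1 natrD mulrDr mulr1.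
    rewrite addrA [in RHS](addrC (w k0)%:R); congr (_ + _).
    by apply: eq_bigr => k /negbTE ->.
  rewrite natrD !mulrDl addrC; apply: lerD => //.
  set wz := \sum_k _.
  have wz0 : 0 <= wz by apply: sumr_ge0 => k _; rewrite mulr_ge0.
  case: (posnP (excT cnt s)) => Y0.
    by rewrite /kp Y0 divn0 mul0r mulr_ge0 ?ler0n.
  have h1 : (price cnt s k0)%:R * wz <= (w k0)%:R * ((excT cnt s)%:R * G').
    apply: le_trans (_ : (w k0)%:R * (\sum_k (price cnt s k)%:R * z k) <= _).
      rewrite /wz !mulr_sumr; apply: ler_sum => k _; rewrite !mulrA.
      case: (boolP (k \in act)) => ka; last by rewrite zs // !mulr0.
      apply: ler_wpM2r => //; rewrite -!natrM ler_nat [X in (_ <= X)%N]mulnC.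
      exact: hbest.
    apply: ler_wpM2l; first exact: ler0n.
    under eq_bigr do rewrite /price natr_sum mulr_suml.
    rewrite exchange_big /= /excT natr_sum mulr_suml; apply: ler_sum => j _.
    under eq_bigr do rewrite natrM -mulrA.
    by rewrite -mulr_sumr; apply: ler_wpM2l => //; apply: ler0n.
  have Y0' : 0 < (excT cnt s)%:R :> rat by rewrite ltr0n.
  rewrite -(@ler_pM2l _ (excT cnt s)%:R) //; apply: le_trans (_ : (price cnt s k0)%:R * wz <= _).
    rewrite mulrA; apply: ler_wpM2r => //; rewrite -natrM ler_nat mulnC.
    exact: leq_trunc_div.
  by apply: le_trans h1 _; rewrite mulrCA.
Qed.

(** By the potential, the total excess [Y] grows like [G] times the square root of [T], while the
    box rows force [s + Y] to be at least [G * T / n]. So for large [T], dividing by [s + Y] instead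
    of [s], which restores feasibility, loses a factor [1 - 1 / (10 n)] only; passing from capacity
    [G + n] to [G] loses as much. *)
Lemma mwu_final (box : K -> J) n cnt s : mwu_inv T cnt s ->
  (forall k, k \in act -> a (box k) k = G) -> (#|act| <= n)%N -> (0 < n)%N -> (0 < T)%N ->
  (200 * n ^ 4 * #|rel| ^ 3 <= T)%N -> (10 * n ^ 2 <= G)%N -> act != set0 ->
  [/\ (0 < s + excT cnt s)%N, forall j, (ld cnt j <= s + excT cnt s)%N &
    forall z, packable (G%:R + n%:R) z ->
      (1 - (5 * n%:R)^-1) * (\sum_k (w k)%:R * z k) <=
      (\sum_k (w k)%:R * (cnt k)%:R) * G%:R / (s + excT cnt s)%:R].
Proof.
move=> h hbox hn n0 T0 hT hG a0; set Y := excT cnt s; set Lam := (s + Y)%N.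
have hld j : (ld cnt j <= Lam)%N.
  rewrite /Lam /Y /excT (bigD1 j) //= /exc; lia.
(* The row [box k] has load at least [G * cnt k], and the [T] steps are shared among at most [n]
   items. *)
have hbig : (G * T <= Lam * n)%N.
  have : (T <= \sum_(k in act) cnt k)%N.
    rewrite -(mi_sum h) (bigID (mem act)) /= [X in (_ + X)%N]big1 ?addn0 // => k ka.
    exact: mi_act h _ ka.
  move=> h1; apply: leq_trans (leq_mul (leqnn G) h1) _.
  rewrite big_distrr /=; apply: leq_trans (_ : (\sum_(k in act) Lam <= _)%N).
    apply: leq_sum => k ka; apply: leq_trans (hld (box k)).
    by rewrite /ld (bigD1 k) //= hbox // mulnC leq_addr.
  by rewrite sum_nat_const mulnC leq_mul2l hn orbT.
have G0 : (0 < G)%N by lia.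
have L0 : (0 < Lam)%N by case: (Lam) hbig => //; rewrite mul0n leqn0 muln_eq0; lia.
(* [Y] is at most [#|rel|] times the largest excess, so [Y ^ 2 <= 2 * #|rel| ^ 3 * T * G ^ 2]; the
   200 in the hypothesis on [T] is [2 * 10 ^ 2]. *)
have hY : (10 * n * Y <= Lam)%N.
  have hpot := mi_pot h.
  have [Y1|[j0 hj0]] : Y = 0%N \/ exists j0, (Y <= #|rel| * exc cnt s j0)%N.
    case: (posnP #|rel|) => [r0|r0].
      left; apply/eqP; rewrite -leqn0; have := excT_le h; rewrite r0; lia.
    right; case/card_gt0P: r0 => j1 j1r.
    case: (@arg_maxnP _ j1 xpredT (exc cnt s) isT) => j0 _ hj0; exists j0.
    rewrite /Y /excT (bigID (mem rel)) /= [X in (_ + X)%N]big1 ?addn0.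
      by rewrite -sum_nat_const; apply: leq_sum => j _; apply: hj0.
    by move=> j jr; rewrite /exc (ld_irrel h jr).
  - by rewrite Y1 muln0.
  have h2 : (exc cnt s j0 ^ 2 <= T * (2 * #|rel| * G ^ 2))%N.
    by apply: leq_trans hpot; rewrite (bigD1 j0) //= leq_addr.
  have h3 : (Y ^ 2 <= #|rel| ^ 2 * (T * (2 * #|rel| * G ^ 2)))%N.
    apply: leq_trans (leq_mul (leqnn _) h2); rewrite -expnMn leq_exp2r //.
  have h4 : ((10 * n * Y * n) ^ 2 <= (Lam * n) ^ 2)%N.
    apply: leq_trans (_ : ((G * T) ^ 2 <= _)%N); last by rewrite leq_exp2r.
    have -> : ((10 * n * Y * n) ^ 2 = 100 * n ^ 4 * Y ^ 2)%N.
      by rewrite !expnMn -!mulnA; ring.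
    apply: leq_trans (leq_mul (leqnn _) h3) _.
    have -> : (100 * n ^ 4 * (#|rel| ^ 2 * (T * (2 * #|rel| * G ^ 2))) =
      (200 * n ^ 4 * #|rel| ^ 3) * T * G ^ 2)%N by ring.
    have -> : ((G * T) ^ 2 = T * T * G ^ 2)%N by ring.
    by rewrite leq_mul2r leq_mul2r hT !orbT.
  by move: h4; rewrite leq_exp2r // leq_pmul2r.
split=> // z hz; have hv := mi_val h hz; have [_ z0 _ _] := hz.
set C := \sum_k (w k)%:R * (cnt k)%:R in hv *; set A := \sum_k (w k)%:R * z k in hv *.
have A0 : 0 <= A by apply: sumr_ge0 => k _; rewrite mulr_ge0.
have C0 : 0 <= C by apply: sumr_ge0 => k _; rewrite mulr_ge0.
have n0' : 0 < n%:R :> rat by rewrite ltr0n.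
set d := (5 * n%:R)^-1 : rat.
have d0 : 0 < d by rewrite invr_gt0 mulr_gt0.
have dn : d * n%:R = 5^-1 by rewrite /d invfM mulfVK // gt_eqF.
have d1 : d <= 5^-1.
  rewrite -dn -[X in X <= _]mulr1; apply: ler_wpM2l; first exact: ltW.
  by rewrite -[1]/(1%:R) ler_nat.
have L0' : 0 < Lam%:R :> rat by rewrite ltr0n.
have G0' : 0 < G%:R :> rat by rewrite ltr0n.
have hs : (1 - d / 2) * Lam%:R <= s%:R.
  have hY' : 10 * n%:R * Y%:R <= Lam%:R :> rat by rewrite -!natrM ler_nat.
  have LE : Lam%:R = s%:R + Y%:R :> rat by rewrite natrD.
  have : Y%:R <= d / 2 * Lam%:R.
    rewrite -(@ler_pM2l _ (10 * n%:R)); last by rewrite mulr_gt0.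
    have -> : 10 * n%:R * (d / 2 * Lam%:R) = 5 * (d * n%:R) * Lam%:R by field.
    by rewrite dn; lra.
  by lra.
have hg : (1 - d / 2) * (G%:R + n%:R) <= G%:R.
  have hG' : 10 * n%:R ^+ 2 <= G%:R :> rat by rewrite -natrX -natrM ler_nat.
  have : n%:R <= d / 2 * G%:R.
    rewrite -(@ler_pM2l _ (10 * n%:R)); last by rewrite mulr_gt0.
    have -> : 10 * n%:R * (d / 2 * G%:R) = 5 * (d * n%:R) * G%:R by field.
    by rewrite dn; lra.
  by nra.
have e0 : 0 <= 1 - d / 2 by lra.
rewrite ler_pdivlMr //.
have t1 : (1 - d / 2) * Lam%:R * A <= C * (G%:R + n%:R).
  by apply: le_trans hv; apply: ler_wpM2r.
have t2 : (1 - d / 2) * ((1 - d / 2) * Lam%:R * A) <= C * G%:R.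
  apply: le_trans (_ : (1 - d / 2) * (C * (G%:R + n%:R)) <= _); first exact: ler_wpM2l.
  by rewrite mulrCA; apply: ler_wpM2l.
apply: le_trans t2.
have LA : 0 <= Lam%:R * A by rewrite mulr_ge0 // ltW.
have -> : (1 - d) * A * Lam%:R = (1 - d) * (Lam%:R * A) by ring.
rewrite -mulrA mulrA; apply: ler_wpM2r => //.
have := sqr_ge0 d; lra.
Qed.
End Packing.

(** * Candidate programs: load rows, box rows and one charge row *)

Section Candidates.
Variables (I K : finType) (sz : I -> K -> nat) (b : I -> nat) (G T n : nat).

(** The ceiling of a quotient; [d = 0] gives 0, which suits a row of capacity 0, where fitting items
    have size 0. *)
Definition cdiv (m d : nat) : nat := ((m + d.-1) %/ d)%N.

Lemma cdiv_ge m d : (0 < d)%N -> (m <= cdiv m d * d)%N.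
Proof.
move=> d0; rewrite /cdiv; have := divn_eq (m + d.-1) d; have := ltn_pmod (m + d.-1) d0; lia.
Qed.

Lemma cdiv_le m d : (cdiv m d * d <= m + d.-1)%N.
Proof. exact: leq_trunc_div. Qed.

Lemma cdiv_le_nat m d c : (m <= c * d)%N -> (cdiv m d <= c)%N.
Proof.
case: (posnP d) => [->|d0] h; first by rewrite /cdiv divn0.
by rewrite -ltnS /cdiv ltn_divLR // mulSn; lia.
Qed.

Definition vcoef (i : I) (k : K) : nat := cdiv (G * sz i k) (b i).
Definition hcoef (e f : K) : nat := if f == e then denprod sz b e else grn sz b e f.
Definition ccoef (e f : K) : nat := cdiv (G * hcoef e f) (3 * denprod sz b e).
(** All capacities are scaled to [G]: [b i] for a load row, 1 for the box of an item, 3 for the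
    charge of [e]. Coefficients are rounded up, so that respecting the integral rows implies the
    original constraints. *)
Definition arow (e : K) (j : option (I + K)) (k : K) : nat :=
  match j with
  | Some (inl i) => vcoef i k
  | Some (inr k') => if k == k' then G else 0%N
  | None => ccoef e k
  end.

Lemma chargeE_hcoef e x :
  (denprod sz b e)%:R * charge sz b e x = \sum_f (hcoef e f)%:R * x f.
Proof.
rewrite /charge mulrDr [RHS](bigD1 e) //= /hcoef eqxx; congr (_ + _).
rewrite mulr_sumr; apply: eq_bigr => f /negbTE ->.
by rewrite grnE mulrA.
Qed.

Variables (w : {ffun K -> nat}) (Irel : {set I}).
Hypothesis Hfit : forall k, k \in active w -> fits sz b k.
Hypothesis Hends : forall k, k \in active w -> (#|ends sz k| <= 2)%N.
Hypothesis Hrel : forall i k, k \in active w -> i \notin Irel -> sz i k = 0%N.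
Hypotheses (Hn : (#|active w| <= n)%N) (n0 : (0 < n)%N) (T0 : (0 < T)%N).
Hypothesis HT : (200 * n ^ 4 * (#|Irel| + n + 1) ^ 3 <= T)%N.
Hypotheses (HG : (10 * n ^ 2 <= G)%N) (GT2 : (2 * T <= G)%N) (A0 : active w != set0).

Definition rel_rows : {set option (I + K)} :=
  [set j | match j with
           | Some (inl i) => i \in Irel
           | Some (inr k) => k \in active w
           | None => true
           end].

Lemma act_active : act w = active w.
Proof. by apply/setP => k; rewrite !inE. Qed.

Lemma card_rel_rows : (#|rel_rows| <= #|Irel| + n + 1)%N.
Proof.
have /subset_leq_card : rel_rows \subset None |: ((fun i => Some (inl i)) @: Irel :|:
                             (fun k => Some (inr k)) @: active w).
  apply/subsetP => j; rewrite 3!inE in_setU; case: j => [[i|k]|] //= h.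
  - by rewrite imset_f.
  - by rewrite (imset_f (fun k => Some (inr k))) ?orbT.
move/leq_trans; apply.
rewrite cardsU1; apply: leq_trans (leq_add (leq_b1 _) (leq_card_setU _ _)) _.
have h1 := leq_imset_card (fun i : I => Some (inl i) : option (I + K)) Irel.
have h2 := leq_imset_card (fun k : K => Some (inr k) : option (I + K)) (active w).
by apply: leq_trans (leq_add (leqnn 1) (leq_add h1 h2)) _; lia.
Qed.

(** Each truncated term is at most [denprod e], and [e] meets at most two rows. Against the capacity
    3 this keeps the coefficients of the charge row at most [G]. *)
Lemma grn_le e f : e \in active w -> (grn sz b e f <= 2 * denprod sz b e)%N.
Proof.
move=> ea; apply: leq_trans (_ : (\sum_(i in ends sz e) denprod sz b e <= _)%N); last first.
  by rewrite sum_nat_const leq_mul2r Hends ?orbT.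
rewrite /grn; under eq_bigl do rewrite -[_ != _]andTb.
rewrite [X in (_ <= X)%N](eq_bigl (fun i => sz i e != 0%N)); last by move=> i; rewrite inE.
apply: leq_sum => i ie; apply: leq_trans (_ : (denprod sz b e %/ den sz b i e * den sz b i e <= _)%N).
  by rewrite leq_mul2l geq_minr orbT.
exact: leq_trunc_div.
Qed.

Lemma arow_le e j k : e \in active w -> k \in act w -> (arow e j k <= G)%N.
Proof.
rewrite act_active => ea ka; case: j => [[i|k']|] /=; last 1 first.
- apply: cdiv_le_nat; rewrite leq_mul2l /hcoef; apply/orP; right.
  case: eqP => _; first by rewrite leq_pmull.
  by apply: leq_trans (grn_le k ea) _; rewrite leq_mul2r orbT.
- by apply: cdiv_le_nat; rewrite leq_mul2l Hfit ?orbT.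
- by case: ifP.
Qed.

Lemma arow_rel e j k : k \in act w -> j \notin rel_rows -> arow e j k = 0%N.
Proof.
rewrite act_active => ka; rewrite inE; case: j => [[i|k']|] //= h.
  rewrite /vcoef (Hrel ka h) muln0 /cdiv add0n.
  by case: (b i) => [|d] /=; rewrite ?divn0 // divn_small.
by case: eqP => // E; rewrite -E ka in h.
Qed.

Definition candidate_inv (e : K) (cnt : K -> nat) (s : nat) : Prop :=
  mwu_inv (arow e) w G rel_rows T cnt s.
Definition cval (cnt : K -> nat) : nat := (\sum_k w k * cnt k)%N.
Definition cscale (e : K) (cnt : K -> nat) (s : nat) : nat := (s + excT (arow e) cnt s)%N.

Lemma cvalE cnt : (cval cnt)%:R = \sum_k (w k)%:R * (cnt k)%:R :> rat.
Proof. by rewrite /cval natr_sum; apply: eq_bigr => k _; rewrite natrM. Qed.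

Lemma candidate_final e cnt s : e \in active w -> candidate_inv e cnt s ->
  [/\ (0 < cscale e cnt s)%N, forall j, (ld (arow e) cnt j <= cscale e cnt s)%N &
    forall z, packable (arow e) w (G%:R + n%:R) z ->
      (1 - (5 * n%:R)^-1) * (\sum_k (w k)%:R * z k) <=
      (cval cnt)%:R * G%:R / (cscale e cnt s)%:R].
Proof.
move=> ea h; rewrite cvalE.
have hle j k : k \in act w -> (arow e j k <= G)%N by apply: arow_le.
have hrel j k : k \in act w -> j \notin rel_rows -> arow e j k = 0%N by apply: arow_rel.
have := @mwu_final _ _ (arow e) w G T rel_rows hle hrel; move=> H.
apply: (H GT2 (fun k => Some (inr k)) n cnt s h) => //.
- by move=> k _; rewrite /= eqxx.
- by apply: leq_trans HT; rewrite leq_mul2l leq_exp2r // card_rel_rows orbT.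
Qed.

Lemma sum_le_n R z : frac_feasible sz b R z -> R \subset active w ->
  \sum_k z k <= n%:R.
Proof.
move=> hz Rw; apply: le_trans (_ : #|active w|%:R <= _); last by rewrite ler_nat.
rewrite -sumr_const [X in _ <= X]big_mkcond /=; apply: ler_sum => k _.
case: ifP => kw; first exact: ff_le1 hz k.
by rewrite (ff_supp hz) //; apply/negP => /(subsetP Rw); rewrite kw.
Qed.

(** Rounding up adds at most 1 to each coefficient, hence at most [\sum_k z k <= n] to each load:
    this is the origin of the capacity [G + n]. *)
Lemma packable_of_feasible e z : e \in active w -> frac_feasible sz b (active w) z ->
  charge sz b e z <= 3 -> packable (arow e) w (G%:R + n%:R) z.
Proof.
move=> ea hz hc; have hsum := sum_le_n hz (subxx _).
have z0 := ff_ge0 hz; have Gr : 0 <= G%:R :> rat by apply: ler0n.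
have nr : 0 <= n%:R :> rat by apply: ler0n.
have hceil m d : (0 < d)%N -> (cdiv m d)%:R <= m%:R / d%:R + 1 :> rat.
  move=> d0; have d0' : 0 < d%:R :> rat by rewrite ltr0n.
  rewrite -(@ler_pM2r _ d%:R) // mulrDl divfK ?gt_eqF // mul1r -natrM -natrD ler_nat.
  by have := cdiv_le m d; lia.
split=> //; [by rewrite addr_ge0|by rewrite act_active; exact: ff_supp hz|].
case=> [[i|k']|] /=.
- case: (posnP (b i)) => b0.
    rewrite big1 ?addr_ge0 // => k _; rewrite /vcoef b0 /cdiv divn0 mul0r //.
  apply: le_trans (_ : \sum_k (G%:R / (b i)%:R * ((sz i k)%:R * z k) + z k) <= _).
    apply: ler_sum => k _; have := hceil (G * sz i k)%N (b i) b0.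
    move=> /(ler_wpM2r (z0 k)) /le_trans; apply.
    by rewrite mulrDl mul1r natrM lerD2r le_eqVlt; apply/orP; left; apply/eqP; ring.
  rewrite big_split /= -mulr_sumr; apply: lerD => //.
  have b0' : 0 < (b i)%:R :> rat by rewrite ltr0n.
  rewrite mulrAC ler_pdivrMr //; apply: ler_wpM2l => //; exact: ff_load hz i.
- rewrite (bigD1 k') //= eqxx big1 ?addr0; last by move=> k /negbTE ->; rewrite mul0r.
  apply: le_trans (_ : G%:R <= _); last by rewrite lerDl.
  by rewrite ler_piMr //; exact: ff_le1 hz k'.
- set P := denprod sz b e; have P0 : (0 < P)%N by apply: denprod_gt0.
  have P0' : 0 < P%:R :> rat by rewrite ltr0n.
  apply: le_trans (_ : \sum_k (G%:R / (3 * P)%:R * ((hcoef e k)%:R * z k) + z k) <= _).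
    apply: ler_sum => k _; have := @hceil (G * hcoef e k)%N (3 * P)%N.
    rewrite muln_gt0 P0 => /(_ isT) /(ler_wpM2r (z0 k)) /le_trans; apply.
    by rewrite mulrDl mul1r natrM lerD2r le_eqVlt; apply/orP; left; apply/eqP; ring.
  rewrite big_split /= -mulr_sumr -chargeE_hcoef -/P; apply: lerD => //.
  have -> : G%:R / (3 * P)%:R * (P%:R * charge sz b e z) = G%:R * (charge sz b e z / 3) :> rat.
    by rewrite natrM; field; rewrite gt_eqF.
  by rewrite ler_piMr //; lra.
Qed.

(** For the item [e] supplied by [cheap_vertex], the charge constraint costs no value, so the
    candidate [e] is nearly optimal for the whole relaxation; [e0] does at least as well, the ratios
    [cval / cscale] being compared by cross multiplication. *)
Lemma pick_ok e0 cnt s0 :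
  e0 \in active w -> candidate_inv e0 cnt s0 ->
  (forall e, e \in active w -> exists cnt' s', candidate_inv e cnt' s' /\
    (cval cnt' * cscale e0 cnt s0 <= cval cnt * cscale e cnt' s')%N) ->
  good_pick sz b (5 * n%:R)^-1 w e0.
Proof.
move=> e0a hinv0 hbest; split; first by move: e0a; rewrite inE.
set Lam := cscale e0 _ _ in hbest.
have [L0 hld _] := candidate_final e0a hinv0; rewrite -/Lam in L0 hld.
have L0' : 0 < Lam%:R :> rat by rewrite ltr0n.
pose x k : rat := (cnt k)%:R * G%:R / Lam%:R.
have wx : \sum_k (w k)%:R * x k = (cval cnt)%:R * G%:R / Lam%:R.
  by rewrite cvalE !mulr_suml; apply: eq_bigr => k _; rewrite /x !mulrA.
(* Common form of the load and charge constraints: the row [js] dominates [G * c k / B], and its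
   load is at most [Lam]. *)
have hsc (c : K -> nat) (B j : nat) (js : option (I + K)) :
    (forall k, (G * c k <= arow e0 js k * B)%N \/ cnt k = 0%N) ->
    \sum_k (c k)%:R * x k <= B%:R.
  move=> hc; have -> : \sum_k (c k)%:R * x k = (\sum_k G * c k * cnt k)%N%:R / Lam%:R.
    rewrite natr_sum mulr_suml; apply: eq_bigr => k _; rewrite /x !natrM; ring.
  rewrite ler_pdivrMr // -natrM ler_nat.
  apply: leq_trans (_ : (B * ld (arow e0) cnt js <= _)%N); last by rewrite leq_mul2l hld orbT.
  rewrite /ld big_distrr /=; apply: leq_sum => k _.
  case: (hc k) => [h|->]; last by rewrite muln0.
  by apply: leq_trans (leq_mul h (leqnn (cnt k))) _; lia.
have cnt0 k : k \notin active w -> cnt k = 0%N.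
  by move=> h; apply: (mi_act hinv0); rewrite act_active.
exists x; split.
- split.
  + by move=> k; rewrite /x divr_ge0 ?mulr_ge0.
  + move=> k; rewrite /x ler_pdivrMr // mul1r -natrM ler_nat.
    apply: leq_trans (hld (Some (inr k))).
    by rewrite /ld (bigD1 k) //= eqxx leq_addr.
  + by move=> k h; rewrite /x cnt0 // !mul0r.
  + move=> i; apply: (hsc (sz i) (b i) 0%N (Some (inl i))) => k /=.
    case: (boolP (k \in active w)) => ka; last by right; apply: cnt0.
    left; rewrite /vcoef; case: (posnP (b i)) => b0; last exact: cdiv_ge.
    by have := Hfit ka i; rewrite b0 leqn0 => /eqP ->; rewrite muln0.
- have P0' : 0 < (denprod sz b e0)%:R :> rat by rewrite ltr0n denprod_gt0.
  rewrite -(@ler_pM2l _ (denprod sz b e0)%:R) // chargeE_hcoef -natrM mulnC.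
  apply: (hsc (hcoef e0) _ 0%N None) => k; left => /=.
  by apply: cdiv_ge; rewrite muln_gt0 denprod_gt0.
- move=> z hz.
  have [e [z' [ea hz' wz' cz']]] := cheap_vertex (fun k => (w k)%:R) hz A0 Hfit Hends.
  have n1 : 1 <= n%:R :> rat by rewrite -[1]/(1%:R) ler_nat.
  have eta0 : 0 <= 1 - (5 * n%:R)^-1 :> rat.
    rewrite subr_ge0 invf_le1; lra.
  apply: le_trans (ler_wpM2l eta0 wz') _.
  have [cnt' [s' [hinv hb]]] := hbest e ea.
  have [Le _ hf] := candidate_final ea hinv.
  apply: le_trans (hf z' (packable_of_feasible ea hz' cz')) _.
  rewrite wx ler_pdivrMr ?ltr0n // mulrAC ler_pdivlMr //.
  rewrite -!natrM ler_nat -mulnA [(G * Lam)%N]mulnC mulnA.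
  by apply: leq_trans (leq_mul hb (leqnn G)) _; lia.
Qed.
End Candidates.

Local Close Scope ring_scope.

(** * The program *)

Definition eadd := Bin Defs.Add.
Definition esub := Bin Defs.Sub.
Definition emul := Bin Defs.Mul.
Definition ediv := Bin Defs.Div.
Definition emin (a c : expr) := esub a (esub a c).
Definition elt (a c : expr) := Ite (esub c a) (Cst 1) (Cst 0).
Definition eeq (a c : expr) := Ite (esub a c) (Cst 0) (Ite (esub c a) (Cst 0) (Cst 1)).
Definition ecdiv (a c : expr) := ediv (eadd a (esub c (Cst 1))) c.
Definition cell (k : nat) := Rd k (Cst 0).

Definition xq := Var 0.
Definition xcap := Var 1.
Definition xN := Var 2.
Definition xm := Var 3.
Definition xn := Var 4.

(* Arrays: DE, A, B, CO hold the common denominator and the integral A, b, c; U the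
   bounds of the variables; MU, SZ, W the multiplicities, sizes and weights of the
   binary items; CNT, S, KS, KA the state of the packing subroutine; BE, BC, BL the
   best candidate so far with its value and scale; STK, SEL the stack of picked
   items and the selection. *)
Notation kU := 1. Notation kMU := 2. Notation kSZ := 3. Notation kB := 4.
Notation kW := 5. Notation kCNT := 6. Notation kS := 7. Notation kKS := 8.
Notation kKA := 9. Notation kC := 10. Notation kL := 11. Notation kF := 12.
Notation kBC := 13. Notation kBL := 14. Notation kBE := 15. Notation kLA := 16.
Notation kSTK := 17. Notation kSEL := 18. Notation kOUT := 19. Notation kDE := 20.
Notation kA := 21. Notation kCO := 22.

Definition eSZ i k := Rd kSZ (eadd (emul i xq) k).
Definition eden i e :=
  Ite (esub (Rd kB i) (eSZ i e)) (esub (Rd kB i) (eSZ i e)) (Cst 1).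
Definition eP e := Big BProd 26 (Ite (eSZ (Var 26) e) (eden (Var 26) e) (Cst 1)).
Definition egrn e f := Big BSum 25 (Ite (eSZ (Var 25) e)
  (emul (ediv (eP e) (eden (Var 25) e)) (emin (eSZ (Var 25) f) (eden (Var 25) e)))
  (Cst 0)).
Definition eh e f := Ite (eeq f e) (eP e) (egrn e f).
(** The subroutine makes [T = q] steps; [4 * q] meets both [2 * T <= G] and [10 * n ^ 2 <= G]. *)
Definition eG := emul (Cst 4) xq.
Definition ev i k := ecdiv (emul eG (eSZ i k)) (Rd kB i).
Definition ec e k := ecdiv (emul eG (eh e k)) (emul (Cst 3) (eP e)).
Definition elv i := Big BSum 24 (emul (Rd kCNT (Var 24)) (ev i (Var 24))).
Definition elc e := Big BSum 24 (emul (Rd kCNT (Var 24)) (ec e (Var 24))).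
Definition eyv i := esub (elv i) (cell kS).
Definition eyb k := esub (emul (Rd kCNT k) eG) (cell kS).
Definition eyc e := esub (elc e) (cell kS).
Definition eY e :=
  eadd (eadd (Big BSum 23 (eyv (Var 23))) (Big BSum 23 (eyb (Var 23)))) (eyc e).
Definition eD e k :=
  eadd (eadd (Big BSum 23 (emul (eyv (Var 23)) (ev (Var 23) k))) (emul (eyb k) eG))
       (emul (eyc e) (ec e k)).
Definition egood e k := Ite (Rd kW k)
  (Ite (Big BSum 22 (Ite (Rd kW (Var 22))
      (elt (emul (eD e (Var 22)) (Rd kW k)) (emul (eD e k) (Rd kW (Var 22)))) (Cst 0)))
    (Cst 0) (Cst 1)) (Cst 0).
(** The language has no search: the first best item is the number of indices up to which no index is
    good. *)
Definition efirst e := Big BSum 20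
  (Ite (Big BSum 21 (Ite (elt (Var 20) (Var 21)) (Cst 0) (egood e (Var 21))))
    (Cst 0) (Cst 1)).

Definition pmwu_step :=
  PSeq (Wr kKS (Cst 0) (efirst (Var 6)))
 (PSeq (Wr kKA (Cst 0) (ediv (eD (Var 6) (cell kKS)) (eY (Var 6))))
 (PSeq (Wr kS (Cst 0) (eadd (cell kS) (cell kKA)))
       (Wr kCNT (cell kKS) (eadd (Rd kCNT (cell kKS)) (Cst 1))))).
Definition pmwu :=
  PSeq (For 7 (Wr kCNT (Var 7) (Cst 0)))
 (PSeq (Wr kS (Cst 0) (Cst 0)) (For 7 pmwu_step)).
(** The outcome of the comparison is stored in [kF] beforehand, because the updates overwrite the
    cells that it compares. *)
Definition pcand :=
  PSeq pmwu
 (PSeq (Wr kC (Cst 0) (Big BSum 22 (emul (Rd kW (Var 22)) (Rd kCNT (Var 22)))))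
 (PSeq (Wr kL (Cst 0) (eadd (cell kS) (eY (Var 6))))
 (PSeq (Wr kF (Cst 0) (Ite (Rd kW (Var 6))
    (elt (emul (cell kBC) (cell kL)) (emul (cell kC) (cell kBL))) (Cst 0)))
 (PSeq (Wr kBE (Cst 0) (Ite (cell kF) (Var 6) (cell kBE)))
 (PSeq (Wr kBC (Cst 0) (Ite (cell kF) (cell kC) (cell kBC)))
       (Wr kBL (Cst 0) (Ite (cell kF) (cell kL) (cell kBL)))))))).
(** The initial ratio [0 / 1] loses against every active candidate. The stack records [e + 1], so
    that 0 can mark a round without active items. *)
Definition pround :=
  PSeq (Wr kBC (Cst 0) (Cst 0))
 (PSeq (Wr kBL (Cst 0) (Cst 1))
 (PSeq (Wr kBE (Cst 0) (Cst 0))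
 (PSeq (For 6 pcand)
 (PSeq (Wr kLA (Cst 0) (Rd kW (cell kBE)))
 (PSeq (Wr kSTK (Var 5) (Ite (cell kLA) (eadd (cell kBE) (Cst 1)) (Cst 0)))
       (For 7 (Wr kW (Var 7) (Ite (eeq (Var 7) (cell kBE)) (Cst 0)
         (esub (emul (eP (cell kBE)) (Rd kW (Var 7)))
               (emul (cell kLA) (egrn (cell kBE) (Var 7)))))))))))).
(** Loops run downwards, so the first round writes at index [q - 1]; reflecting the index makes the
    insertions begin with the last pick. *)
Definition estk := Rd kSTK (esub (esub xq (Cst 1)) (Var 5)).
Definition pinsert :=
  PSeq (Wr kF (Cst 0) (Ite estk
    (Ite (Big BSum 23 (elt (Rd kB (Var 23))
       (eadd (Big BSum 24 (emul (Rd kSEL (Var 24)) (eSZ (Var 23) (Var 24))))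
             (eSZ (Var 23) (esub estk (Cst 1)))))) (Cst 0) (Cst 1)) (Cst 0)))
       (Wr kSEL (esub estk (Cst 1)) (Ite (cell kF) (Cst 1) (Rd kSEL (esub estk (Cst 1))))).

Definition eA0 i j := let o := emul (Cst 2) (eadd (emul i xn) j) in
  emul (Rd 0 (eadd (Cst 2) o)) (ediv (cell kDE) (Rd 0 (eadd (Cst 3) o))).
Definition eob := eadd (Cst 2) (emul (Cst 2) (emul xm xn)).
Definition eoc := eadd eob (emul (Cst 2) xm).
Definition eod := eadd eoc (emul (Cst 2) xn).
Definition erat o i :=
  emul (Rd 0 (eadd o (emul (Cst 2) i)))
       (ediv (cell kDE) (Rd 0 (eadd o (eadd (emul (Cst 2) i) (Cst 1))))).
Definition eA i j := Rd kA (eadd (emul i xq) j).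
Definition ecol k := ediv k xN.
Definition epow l := Big BProd 22 (Ite (elt (Var 22) l) (Cst 2) (Cst 1)).
Definition elev k := esub k (emul (ediv k xN) xN).

(** A common multiple of the denominators: the product of all nonzero cells avoids telling
    denominators from other cells and still has at most [N] bits. *)
Definition pdelta := Wr kDE (Cst 0) (Big BProd 22 (Ite (Rd 0 (Var 22)) (Rd 0 (Var 22)) (Cst 1))).
Definition pB := For 5 (Wr kB (Var 5) (Ite (elt (Var 5) xm) (erat eob (Var 5)) (Cst 0))).
Definition pA := For 5 (For 6 (Wr kA (eadd (emul (Var 5) xq) (Var 6))
  (Ite (elt (Var 5) xm) (Ite (elt (Var 6) xn) (eA0 (Var 5) (Var 6)) (Cst 0)) (Cst 0)))).
Definition pCO := For 5 (Wr kCO (Var 5) (Ite (elt (Var 5) xn) (erat eoc (Var 5)) (Cst 0))).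
(** Where [d] is infinite, the sum of the integral [b i] is a valid bound as soon as the column has
    a nonzero entry. A null column gets 0: either it has no cost, or the program is unbounded. *)
Definition pU0 := For 5 (Wr kU (Var 5) (Ite (elt (Var 5) xn)
  (Ite (Rd 0 (eadd eod (emul (Cst 2) (Var 5))))
       (Rd 0 (eadd eod (eadd (emul (Cst 2) (Var 5)) (Cst 1))))
       (Ite (Big BSum 22 (eA (Var 22) (Var 5))) (Big BSum 22 (Rd kB (Var 22))) (Cst 0)))
  (Cst 0))).
Definition pU1 := For 5 (For 6 (Wr kU (Var 5) (Ite (eA (Var 6) (Var 5))
  (emin (Rd kU (Var 5)) (ediv (Rd kB (Var 6)) (eA (Var 6) (Var 5)))) (Rd kU (Var 5))))).
Definition pMU := For 5 (Wr kMU (Var 5)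
  (emin (epow (elev (Var 5)))
        (esub (Rd kU (ecol (Var 5))) (esub (epow (elev (Var 5))) (Cst 1))))).
Definition pSZ := For 5 (For 6 (Wr kSZ (eadd (emul (Var 5) xq) (Var 6))
  (emul (Rd kMU (Var 6)) (eA (Var 5) (ecol (Var 6)))))).
Definition pW := For 5 (Wr kW (Var 5) (emul (Rd kMU (Var 5)) (Rd kCO (ecol (Var 5))))).
Definition pOUT := For 5 (Wr kOUT (Var 5) (Big BSum 22 (Ite (eeq (ecol (Var 22)) (Var 5))
  (emul (Rd kSEL (Var 22)) (Rd kMU (Var 22))) (Cst 0)))).
(** The loop has [q] iterations, and those from [n] on must not disturb the output: their index
    [xcap] is clamped to the spare cell [L]. *)
Definition pfin := For 5 (Wr 0 (Ite (elt (Var 5) xn) (Var 5) xcap) (Rd kOUT (Var 5))).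

Definition pinit := PSeq pdelta (PSeq pB (PSeq pA (PSeq pCO (PSeq pU0 (PSeq pU1
  (PSeq pMU (PSeq pSZ pW))))))).
Definition main_prog :=
  PSeq pinit (PSeq (For 5 pround) (PSeq (For 5 pinsert) (PSeq pOUT pfin))).

Lemma wf_main : wfP main_prog.
Proof. by []. Qed.

(* [n_foo] is, up to conversion, the value of the expression [efoo]. *)
Section Mirror.
Variables (q : nat) (sz : nat -> nat -> nat) (b w cnt : nat -> nat) (s : nat).

Definition n_min (a c : nat) := a - (a - c).
Definition n_lt (a c : nat) := if c - a != 0 then 1 else 0.
Definition n_eq (a c : nat) := if a - c != 0 then 0 else if c - a != 0 then 0 else 1.
Definition n_cdiv (a c : nat) := (a + (c - 1)) %/ c.
Definition n_den i e := if b i - sz i e != 0 then b i - sz i e else 1.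
Definition n_P e := \prod_(0 <= i < q) (if sz i e != 0 then n_den i e else 1).
Definition n_grn e f := \sum_(0 <= i < q)
  (if sz i e != 0 then n_P e %/ n_den i e * n_min (sz i f) (n_den i e) else 0).
Definition n_h e f := if n_eq f e != 0 then n_P e else n_grn e f.
Definition n_G := 4 * q.
Definition n_v i k := n_cdiv (n_G * sz i k) (b i).
Definition n_c e k := n_cdiv (n_G * n_h e k) (3 * n_P e).
Definition n_lv i := \sum_(0 <= k < q) cnt k * n_v i k.
Definition n_lc e := \sum_(0 <= k < q) cnt k * n_c e k.
Definition n_Y e := \sum_(0 <= i < q) (n_lv i - s) + \sum_(0 <= k < q) (cnt k * n_G - s)
  + (n_lc e - s).
Definition n_D e k := \sum_(0 <= i < q) (n_lv i - s) * n_v i k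
  + (cnt k * n_G - s) * n_G + (n_lc e - s) * n_c e k.
Definition n_good e k := if w k != 0 then
   if \sum_(0 <= k' < q) (if w k' != 0 then n_lt (n_D e k' * w k) (n_D e k * w k') else 0) != 0
   then 0 else 1 else 0.
Definition n_first e := \sum_(0 <= k < q)
  (if \sum_(0 <= k' < q) (if n_lt k k' != 0 then 0 else n_good e k') != 0 then 0 else 1).
End Mirror.

Definition szA (A : memory) (q i k : nat) : nat := A kSZ (i * q + k).

Lemma n_minE a c : n_min a c = minn a c.
Proof. by rewrite /n_min; lia. Qed.

Lemma n_ltE a c : n_lt a c = (a < c).
Proof. by rewrite /n_lt subn_eq0 -ltnNge; case: ltnP. Qed.

Lemma n_eqE a c : n_eq a c = (a == c).
Proof. by rewrite /n_eq !subn_eq0; case: ltngtP. Qed.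

Lemma big_optsum (I K : finType) (F : option (I + K) -> nat) :
  \sum_j F j = \sum_i F (Some (inl i)) + \sum_k F (Some (inr k)) + F None.
Proof.
rewrite (bigD1 None) //= addnC; congr (_ + _).
rewrite (reindex_omap Some id) /=; last by case.
under eq_bigl do rewrite eqxx.
rewrite (bigID (fun j : I + K => if j is inl _ then true else false)) /=; congr (_ + _).
  rewrite (reindex_omap inl (fun j : I + K => if j is inl i then Some i else None)) /=.
    by apply: eq_bigl => i; rewrite eqxx.
  by case.
rewrite (reindex_omap inr (fun j : I + K => if j is inr i then Some i else None)) /=.
  by apply: eq_bigl => i; rewrite eqxx.
by case.
Qed.

(** * Agreement of the program's arithmetic with the finite-type notions *)

Section Bridge.
Variables (q : nat) (sz : nat -> nat -> nat) (b w cnt : nat -> nat) (s : nat).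
Let I := 'I_q.
Definition osz (i k : I) : nat := sz i k.
Definition obv (i : I) : nat := b i.
Definition ofw : {ffun I -> nat} := [ffun k : I => w k].
Definition ocnt (k : I) : nat := cnt k.

Lemma n_denE (i e : I) : n_den sz b i e = den osz obv i e.
Proof. by rewrite /n_den /den /osz /obv; case: (b i - sz i e) => [|d] //=; lia. Qed.

Lemma n_PE (e : I) : n_P q sz b e = denprod osz obv e.
Proof.
rewrite /n_P /denprod big_mkord [RHS]big_mkcond /=; apply: eq_bigr => i _.
by rewrite n_denE.
Qed.

Lemma n_grnE (e f : I) : n_grn q sz b e f = grn osz obv e f.
Proof.
rewrite /n_grn /grn big_mkord [RHS]big_mkcond /=; apply: eq_bigr => i _.
by rewrite n_denE n_PE n_minE.
Qed.

Lemma n_hE (e f : I) : n_h q sz b e f = hcoef osz obv e f.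
Proof.
rewrite /n_h /hcoef n_eqE n_PE n_grnE.
by rewrite -[in RHS]val_eqE /=; case: (nat_of_ord f == e).
Qed.

Lemma n_vE (i k : I) : n_v q sz b i k = vcoef osz obv (4 * q) i k.
Proof. by rewrite /n_v /vcoef /n_cdiv /cdiv subn1. Qed.

Lemma n_cE (e k : I) : n_c q sz b e k = ccoef osz obv (4 * q) e k.
Proof. by rewrite /n_c /ccoef /n_cdiv /cdiv subn1 n_PE n_hE. Qed.

Let ar e := arow osz obv (4 * q) e.

Lemma n_lvE (e i : I) : n_lv q sz b cnt i = ld (ar e) ocnt (Some (inl i)).
Proof. by rewrite /n_lv /ld big_mkord; apply: eq_bigr => k _; rewrite n_vE. Qed.

Lemma n_lbE (e k : I) : cnt k * n_G q = ld (ar e) ocnt (Some (inr k)).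
Proof.
rewrite /ld (bigD1 k) //= eqxx big1 ?addn0 // => k' /negbTE kk.
by rewrite /= kk muln0.
Qed.

Lemma n_lcE (e : I) : n_lc q sz b cnt e = ld (ar e) ocnt None.
Proof. by rewrite /n_lc /ld big_mkord; apply: eq_bigr => k _; rewrite n_cE. Qed.

Lemma n_YE (e : I) : n_Y q sz b cnt s e = excT (ar e) ocnt s.
Proof.
rewrite /n_Y /excT big_optsum /exc -n_lcE !big_mkord; congr (_ + _ + _).
  by apply: eq_bigr => i _; rewrite -n_lvE.
by apply: eq_bigr => i _; rewrite -n_lbE.
Qed.

Lemma n_DE (e k : I) : n_D q sz b cnt s e k = price (ar e) ocnt s k.
Proof.
rewrite /n_D /price big_optsum /exc -n_lcE !big_mkord; congr (_ + _ + _); last by rewrite n_cE.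
  by apply: eq_bigr => i _; rewrite -n_lvE n_vE.
rewrite [RHS](bigD1 k) //= eqxx -n_lbE big1 ?addn0 // => k' kk.
by rewrite eq_sym (negbTE kk) muln0.
Qed.

Lemma n_goodP (e k : I) : reflect (best_item (ar e) ofw ocnt s k)
  (n_good q sz b w cnt s e k != 0).
Proof.
apply: (iffP idP).
  rewrite /n_good; case: (boolP (w k != 0)) => // wk.
  set Sg := \sum_(0 <= k' < q) _; case: (eqVneq Sg 0) => //= /eqP + _.
  rewrite /Sg sum_nat_seq_eq0 => /allP h.
  split=> [|k']; first by rewrite inE ffunE.
  rewrite inE ffunE => wk'; have := h k'; rewrite mem_index_iota ltn_ord => /(_ isT).
  rewrite /= wk' n_ltE -!n_DE !ffunE; lia.
case; rewrite inE ffunE => wk h; rewrite /n_good wk.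
set Sg := \sum_(0 <= k' < q) _; case: (eqVneq Sg 0) => //= .
rewrite /Sg sum_nat_seq_neq0 => /hasP[k'].
rewrite mem_index_iota => /andP[_ kq] /=; case: (boolP (w k' != 0)) => // wk'.
have := h (Ordinal kq); rewrite inE /ofw !ffunE wk' -!n_DE n_ltE /= => /(_ isT); lia.
Qed.

Lemma n_firstP (e : I) : (exists k : I, best_item (ar e) ofw ocnt s k) ->
  exists2 k : I, n_first q sz b w cnt s e = k & best_item (ar e) ofw ocnt s k.
Proof.
case=> k0 /n_goodP hk0.
have [k hk hmin] := arg_minnP (P := fun k : I => n_good q sz b w cnt s e k != 0) (fun k : I => k : nat) hk0.
exists k; last exact/n_goodP.
rewrite /n_first (@big_cat_nat _ _ _ k) //=; last by rewrite ltnW.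
rewrite [X in _ + X]big_nat [X in _ + X]big1 ?addn0.
  rewrite big_nat (eq_bigr (fun=> 1)).
    by rewrite -big_nat sum_nat_const_nat subn0 muln1.
  move=> k1 /andP[_ k1k].
  set Sg := \sum_(0 <= k' < q) _; case: (eqVneq Sg 0) => //=.
  rewrite /Sg sum_nat_seq_neq0 => /hasP[k2].
  rewrite mem_index_iota => /andP[_ k2q] /=; rewrite n_ltE; case: ltnP => //= k21 h.
  by have := hmin (Ordinal k2q) h; rewrite /=; lia.
move=> k1 /andP[kk1 k1q]; set Sg := \sum_(0 <= k' < q) _; case: (eqVneq Sg 0) => //= /eqP.
rewrite /Sg sum_nat_seq_eq0 => /allP/(_ k).
rewrite mem_index_iota ltn_ord => /(_ isT) /=; rewrite n_ltE ltnNge kk1 /=.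
by rewrite (negbTE hk).
Qed.
End Bridge.

(** * Correctness of the rounds *)

Fixpoint wkeys (p : prog) : seq nat :=
  match p with
  | Wr k _ _ => [:: k]
  | PSeq p1 p2 => wkeys p1 ++ wkeys p2
  | For _ p => wkeys p
  end.

Lemma loop_inv (T : Type) (P : nat -> T -> Prop) n f x :
  P n x -> (forall i y, i < n -> P i.+1 y -> P i (f i y)) -> P 0 (loop n f x).
Proof.
elim: n x => //= n IH x hx hs; apply: IH; first by apply: hs.
by move=> i y hi; apply: hs; lia.
Qed.

Lemma evalP_frame L p s A k : k \notin wkeys p -> evalP L p s A k = A k.
Proof.
elim: p s A => [k' a e|p1 IH1 p2 IH2|x p IH] s A /=.
- by rewrite inE /updm => /negbTE ->.
- by rewrite mem_cat negb_or => /andP[h1 h2]; rewrite IH2 // IH1.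
- move=> h; apply: (@loop_inv _ (fun _ A' => A' k = A k)) => // i y _ hy.
  by rewrite IH.
Qed.

Lemma updm_eq A k i v : updm A k i v k i = v.
Proof. by rewrite /updm eqxx /upd eqxx. Qed.

Lemma updm_neq A k i v j : j != i -> updm A k i v k j = A k j.
Proof. by rewrite /updm eqxx /upd => /negbTE ->. Qed.

(* The loop may overwrite the cells it reads, as long as iteration [i] reads no
   cell of array [k] other than the one it writes. *)
Lemma loop_fill n k (ad v : nat -> nat) f (A : memory) :
  (forall i A', i < n -> (forall k', k' != k -> A' k' = A k') ->
     A' k (ad i) = A k (ad i) -> f i A' = updm A' k (ad i) (v i)) ->
  (forall i j, i < n -> j < n -> ad i = ad j -> i = j) ->
  [/\ forall k', k' != k -> loop n f A k' = A k',
      forall i, i < n -> loop n f A k (ad i) = v i &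
      forall x, (forall i, i < n -> x != ad i) -> loop n f A k x = A k x].
Proof.
move=> hf hinj.
pose P m (A' : memory) := [/\ forall k', k' != k -> A' k' = A k',
      forall i, m <= i < n -> A' k (ad i) = v i,
      forall i, i < m -> i < n -> A' k (ad i) = A k (ad i) &
      forall x, (forall i, i < n -> x != ad i) -> A' k x = A k x].
have : P 0 (loop n f A); last by case=> h1 h2 _ h3; split.
apply: loop_inv; first by split=> // i; lia.
move=> m A' mn [h1 h2 h4 h3]; rewrite hf //; last by apply: h4.
split.
- by move=> k' kk; rewrite /updm (negbTE kk); apply: h1.
- move=> i hi; case: (eqVneq i m) => [->|im]; first by rewrite updm_eq.
  rewrite updm_neq ?h2 //; first by lia.
  by apply/negP => /eqP h; have := hinj i m; lia.
- move=> i im iN; rewrite updm_neq ?h4 //; first by lia.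
  by apply/negP => /eqP h; have := hinj i m; lia.
- by move=> x hx; rewrite updm_neq ?h3 // hx.
Qed.

Lemma evalP_For L x p s A :
  evalP L (For x p) s A = loop (s 0) (fun i A' => evalP L p (upd s x i) A') A.
Proof. by []. Qed.

Lemma evalP_Seq L p1 p2 s A : evalP L (PSeq p1 p2) s A = evalP L p2 s (evalP L p1 s A).
Proof. by []. Qed.

Lemma evalP_Wr L k a e s A : evalP L (Wr k a e) s A =
  updm A k (clampi L k (evalE L s A a)) (minn (evalE L s A e) (s 1)).
Proof. by []. Qed.

Arguments evalP : simpl never.
Arguments evalE : simpl never.

Lemma mwu_inv_ext (J K : finType) (a : J -> K -> nat) w G rel t cnt cnt' s :
  cnt =1 cnt' -> mwu_inv a w G rel t cnt s -> mwu_inv a w G rel t cnt' s.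
Proof.
move=> E h; have El j : ld a cnt' j = ld a cnt j.
  by apply: eq_bigr => k _; rewrite E.
split.
- by rewrite -(mi_sum h); apply: eq_bigr => k _; rewrite E.
- by move=> k hk; rewrite -E; apply: mi_act h _ hk.
- apply: leq_trans (mi_pot h); apply: leq_sum => j _; rewrite /exc El //.
- move=> G' z hz; have := mi_val h hz; congr (_ <= _ * _)%R.
  by apply: eq_bigr => k _; rewrite E.
Qed.

Lemma cnt_le_sum (K : finType) (c : K -> nat) k : c k <= \sum_k c k.
Proof. by rewrite (bigD1 k) //= leq_addr. Qed.

(** The values stored by the packing subroutine: an item number, a step of the scale, the scale
    after [q] steps, and the scale plus the excess over at most [2 * q + 1] rows. *)
Lemma small_bounds q : 100 <= q ->
  [/\ q.+1 <= 100 * q ^ 4, 4 * q <= 100 * q ^ 4, q * (4 * q) <= 100 * q ^ 4 &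
      q * (4 * q) + (q + q).+1 * (q * (4 * q)) <= 100 * q ^ 4].
Proof.
move=> q1; have E : q ^ 4 = (q * q) * (q * q) by rewrite !expnS expn0; lia.
have h2 : 100 * q <= q * q by rewrite leq_mul2r q1 orbT.
have h3 : 1 * (q * q) <= (q * q) * (q * q) by rewrite leq_mul2r; apply/orP; right; lia.
have h4 : q * (q * q) <= (q * q) * (q * q) by rewrite leq_mul2r; apply/orP; right; lia.
rewrite E; split; lia.
Qed.

Section Run.
Variables (L q cap n : nat) (mSZ mB : nat -> nat) (R0 Irel : {set 'I_q}).
Let sz i k := mSZ (i * q + k).
Let Sz := @osz q sz.
Let Bv := @obv q mB.
Hypothesis Hfit : forall k, k \in R0 -> fits Sz Bv k.
Hypothesis Hends : forall k, k \in R0 -> #|ends Sz k| <= 2.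
Hypothesis Hrel : forall i k, k \in R0 -> i \notin Irel -> Sz i k = 0.
Hypotheses (Hn : #|R0| <= n) (n0 : 0 < n).
Hypothesis HT : 200 * n ^ 4 * (#|Irel| + n + 1) ^ 3 <= q.
Hypothesis Hcap : 100 * q ^ 4 <= cap.

Definition inst (A : memory) : Prop := A kSZ = mSZ /\ A kB = mB.

Definition runenv (s : env) : Prop := s 0 = q /\ s 1 = cap.

Lemma n_le_q : 10 * n ^ 2 <= q.
Proof.
apply: leq_trans HT; set M := (_ ^ 3).
have M1 : 0 < M by rewrite expn_gt0 addn1.
have h1 : n ^ 2 <= n ^ 4 by rewrite leq_pexp2l.
nia.
Qed.

Lemma q_gt0 : 0 < q.
Proof. by apply: leq_trans n_le_q; rewrite muln_gt0 expn_gt0 n0. Qed.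

Lemma q_ge100 : 100 <= q.
Proof.
apply: leq_trans HT; have : 0 < n ^ 4 * (#|Irel| + n + 1) ^ 3.
  by rewrite muln_gt0 !expn_gt0 n0 addn1.
by rewrite -mulnA; lia.
Qed.

Lemma caps : [/\ q.+1 <= cap, 4 * q <= cap, q * (4 * q) <= cap &
  q * (4 * q) + (q + q).+1 * (q * (4 * q)) <= cap].
Proof.
have [h1 h2 h3 h4] := small_bounds q_ge100.
by split; apply: leq_trans Hcap.
Qed.

Section Weights.
Variable mW : nat -> nat.
Let w := ofw q mW.
Hypothesis wR : active w \subset R0.

Let Hfit' k : k \in active w -> fits Sz Bv k.
Proof. by move=> h; apply: Hfit; apply: (subsetP wR). Qed.
Let Hends' k : k \in active w -> #|ends Sz k| <= 2.
Proof. by move=> h; apply: Hends; apply: (subsetP wR). Qed.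
Let Hrel' i k : k \in active w -> i \notin Irel -> Sz i k = 0.
Proof. by move=> h; apply: Hrel; apply: (subsetP wR). Qed.
Let Hn' : #|active w| <= n.
Proof. exact: leq_trans (subset_leq_card wR) Hn. Qed.
Let HG : 10 * n ^ 2 <= 4 * q.
Proof. by have := n_le_q; lia. Qed.
Let GT2 : 2 * q <= 4 * q.
Proof. by lia. Qed.

Definition cinv := candidate_inv Sz Bv (4 * q) q w Irel.

(** Symbolic execution by conversion: the [n_] functions have exactly the shape of the evaluated
    expressions. *)
Lemma pmwu_stepE s A : evalP L pmwu_step s A =
  let ks := minn (n_first (s 0) (szA A (s 0)) (A kB) (A kW) (A kCNT) (A kS 0) (s 6)) (s 1) in
  let ka := minn (n_D (s 0) (szA A (s 0)) (A kB) (A kCNT) (A kS 0) (s 6) ks %/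
                  n_Y (s 0) (szA A (s 0)) (A kB) (A kCNT) (A kS 0) (s 6)) (s 1) in
  updm (updm (updm (updm A kKS 0 ks) kKA 0 ka) kS 0 (minn (A kS 0 + ka) (s 1)))
    kCNT ks (minn (A kCNT ks + 1) (s 1)).
Proof. by []. Qed.

(** The minimum of price per weight is found along the enumeration; the cross-multiplied comparison
    is transitive because active weights are positive. *)
Lemma best_item_exists (J K : finType) (a : J -> K -> nat) (v : K -> nat) cnt t :
  act v != set0 -> exists k, best_item a v cnt t k.
Proof.
case/set0Pn => k0 hk0.
pose le k k' := price a cnt t k * v k' <= price a cnt t k' * v k.
have [k [ka hk]] : exists k, k \in act v /\ forall k', k' \in enum (act v) -> le k k'.
  have hsub : {subset enum (act v) <= act v} by move=> k; rewrite mem_enum.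
  elim: (enum (act v)) hsub => [|k1 l IH] hsub; first by exists k0.
  have [|k [ka hk]] := IH; first by move=> k hk; apply: hsub; rewrite inE hk orbT.
  have k1a : k1 \in act v by apply: hsub; rewrite inE eqxx.
  case: (boolP (le k k1)) => h.
    by exists k; split=> // k'; rewrite inE => /orP[/eqP->|/hk].
  exists k1; split=> // k'; rewrite inE => /orP[/eqP->|hk']; first by rewrite /le.
  have := hk k' hk'; move: h; rewrite /le -ltnNge => h1 h2.
  move: ka k1a; rewrite !inE -!lt0n => ka k1a.
  have k'0 : 0 < v k'.
    have : k' \in act v by apply: hsub; rewrite inE hk' orbT.
    by rewrite inE lt0n.
  rewrite -(leq_pmul2l ka).
  have t1 := leq_mul (ltnW h1) (leqnn (v k')).
  have t2 := leq_mul h2 (leqnn (v k1)).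
  move: t1 t2; set p := price _ _ _ _; set p1 := price _ _ _ _; set p' := price _ _ _ _.
  clear; nia.
by exists k; split=> // k' hk'; apply: hk; rewrite mem_enum.
Qed.

Lemma arow_le_q (e : 'I_q) j k : e \in active w -> k \in act w ->
  arow Sz Bv (4 * q) e j k <= 4 * q.
Proof. exact: (arow_le (4 * q) Hfit' Hends'). Qed.

Lemma pmwu_ok (e : 'I_q) s A : runenv s -> s 6 = e -> e \in active w ->
  inst A -> A kW = mW ->
  let A' := evalP L pmwu s A in
  cinv e (@ocnt q (A' kCNT)) (A' kS 0) /\ A' kS 0 <= q * (4 * q).
Proof.
move=> [s0 s1] s6 ea [iS iB] iW; rewrite /pmwu.
set P0 := For 7 (Wr kCNT _ _).
change (let A' := evalP L (For 7 pmwu_step) s (evalP L (Wr kS (Cst 0) (Cst 0)) s (evalP L P0 s A)) in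
  cinv e (@ocnt q (A' kCNT)) (A' kS 0) /\ A' kS 0 <= q * (4 * q)).
have q0 := q_gt0; have q100 := q_ge100.
have Hle j k : k \in act w -> arow Sz Bv (4 * q) e j k <= 4 * q by apply: arow_le_q.
have Hre j k : k \in act w -> j \notin rel_rows w Irel -> arow Sz Bv (4 * q) e j k = 0.
  exact: (@arow_rel _ _ Sz Bv (4 * q) w Irel Hrel' e j k).
set A1 := evalP L P0 s A; set A2 := evalP L (Wr kS (Cst 0) (Cst 0)) s A1.
have A1f k : k != kCNT -> A1 k = A k.
  by move=> h; apply: evalP_frame; rewrite inE.
have A1c i : i < q -> A1 kCNT i = 0.
  move=> iq; rewrite /A1 evalP_For s0.
  have [|i1 j1 _ _ //|_ h _] := @loop_fill q kCNT id (fun=> 0)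
    (fun i0 A' => evalP L (Wr kCNT (Var 7) (Cst 0)) (upd s 7 i0) A') A.
    by move=> i0 A' _ _ _; rewrite evalP_Wr min0n.
  exact: h.
have A2S : A2 kS 0 = 0 by rewrite /A2 evalP_Wr updm_eq min0n.
(* The counter runs down: with [t] iterations left, [q - t] steps have been made. *)
pose P t (A' : memory) := [/\ inst A', A' kW = mW,
  mwu_inv (arow Sz Bv (4 * q) e) w (4 * q) (rel_rows w Irel) (q - t) (@ocnt q (A' kCNT)) (A' kS 0) &
  A' kS 0 <= (q - t) * (4 * q)].
have : P 0 (evalP L (For 7 pmwu_step) s A2); last first.
  by rewrite /P subn0 => -[_ _ h1 h2]; split.
rewrite evalP_For s0; apply: loop_inv.
  split.
  - by split; rewrite -?iS -?iB; apply: A1f.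
  - by rewrite -iW; apply: A1f.
  - rewrite subnn A2S; apply: (@mwu_inv_ext _ _ _ _ _ _ _ (fun=> 0)); last exact: mwu_init.
    by move=> k; rewrite /ocnt; change (0 = A1 kCNT k); rewrite A1c.
  - by rewrite A2S.
move=> t A' tq [[iS' iB'] iW' hinv hS].
set s' := upd s 7 t.
have e0 : s' 0 = q by [].
have e1 : s' 1 = cap by [].
have e6 : s' 6 = e by [].
rewrite pmwu_stepE; cbv zeta; rewrite e0 e1 e6 iW'.
have szE : szA A' q = sz by rewrite /szA iS'.
rewrite szE iB'.
have [] := @n_firstP q sz mB mW (A' kCNT) (A' kS 0) e.
  apply: best_item_exists; rewrite act_active; apply/set0Pn; by exists e.
move=> k0 -> hk0.
have k0cap : minn k0 cap = k0.
  by apply/minn_idPl; case: caps => c1 _ _ _; apply: leq_trans (ltnW (ltn_ord k0)) (ltnW c1).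
rewrite k0cap n_DE n_YE.
set kp := (_ %/ _).
have kpG : kp <= 4 * q.
  rewrite /kp; set Y := excT _ _ _; case: (posnP Y) => Y0; first by rewrite Y0 divn0.
  rewrite -(leq_pmul2r Y0); apply: leq_trans (leq_trunc_div _ _) _.
  exact: (price_le Hle _ _ (proj1 hk0)).
have kpcap : minn kp cap = kp.
  by apply/minn_idPl; case: caps => _ c1 _ _; apply: leq_trans c1.
rewrite /= kpcap.
have hq : q - t = (q - t.+1).+1 by lia.
have S'le : A' kS 0 + kp <= (q - t) * (4 * q).
  by rewrite hq mulSn addnC leq_add.
have Scap : minn (A' kS 0 + kp) cap = A' kS 0 + kp.
  apply/minn_idPl; case: caps => _ _ c1 _; apply: leq_trans c1; apply: leq_trans S'le _.
  by rewrite leq_mul2r leq_subr orbT.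
have ccap : minn (A' kCNT k0 + 1) cap = A' kCNT k0 + 1.
  apply/minn_idPl; case: caps => c1 _ _ _; apply: leq_trans c1.
  have := cnt_le_sum (@ocnt q (A' kCNT)) k0; rewrite (mi_sum hinv) {1}/ocnt; lia.
rewrite Scap ccap; split=> //.
- have tT : q - t.+1 < q by lia.
  have := mwu_step Hle Hre GT2 tT hinv hk0.
  rewrite -/kp -hq; apply: mwu_inv_ext => k.
  rewrite /ocnt /updm /= /upd; case: (eqVneq k k0) => [->|kk]; first by rewrite eqxx addn1.
  by rewrite (negbTE (_ : nat_of_ord k != k0)).
Qed.

Definition pcand_tail := if pcand is PSeq _ p then p else pcand.

Lemma pcand_tailE s A : evalP L pcand_tail s A =
  let c := minn (\sum_(0 <= k < s 0) A kW k * A kCNT k) (s 1) in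
  let l := minn (A kS 0 + n_Y (s 0) (szA A (s 0)) (A kB) (A kCNT) (A kS 0) (s 6)) (s 1) in
  let f := minn (if A kW (s 6) != 0 then n_lt (A kBC 0 * l) (c * A kBL 0) else 0) (s 1) in
  updm (updm (updm (updm (updm (updm A kC 0 c) kL 0 l) kF 0 f)
    kBE 0 (minn (if f != 0 then s 6 else A kBE 0) (s 1)))
    kBC 0 (minn (if f != 0 then c else A kBC 0) (s 1)))
    kBL 0 (minn (if f != 0 then l else A kBL 0) (s 1)).
Proof. by []. Qed.

(** Every step chose an item of positive weight. Positivity is what lets the first active candidate
    replace the initial ratio [0 / 1]. *)
Lemma cval_gt0 (e : 'I_q) cnt s0 : cinv e cnt s0 -> 0 < cval w cnt.
Proof.
move=> h; have q0 := q_gt0; rewrite lt0n; apply/negP; rewrite sum_nat_eq0 => /forallP hz.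
have : \sum_k cnt k = q := mi_sum h.
rewrite big1 => [|k _]; first by lia.
have := hz k; rewrite muln_eq0 => /orP[wk|/eqP//].
by apply: (mi_act h); rewrite inE negbK.
Qed.

Variable wB : nat.
Hypothesis HwB : forall k, k < q -> mW k <= wB.
Hypothesis HwBcap : wB * q <= cap.

Lemma cval_le (e : 'I_q) cnt s0 : cinv e cnt s0 -> cval w cnt <= cap.
Proof.
move=> h; apply: leq_trans HwBcap; rewrite -[X in _ * X](mi_sum h) big_distrr /=.
by apply: leq_sum => k _; rewrite leq_mul2r ffunE HwB ?orbT.
Qed.

Lemma cscale_le (e : 'I_q) cnt s0 : e \in active w -> cinv e cnt s0 ->
  s0 <= q * (4 * q) -> cscale Sz Bv (4 * q) e cnt s0 <= cap.
Proof.
move=> ea h hs; rewrite /cscale.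
have := @excT_le _ _ _ _ _ _ (fun j k => @arow_le_q e j k ea)
  (fun j k => @arow_rel _ _ Sz Bv (4 * q) w Irel Hrel' e j k) _ _ _ h.
have := max_card (mem (rel_rows w Irel)).
rewrite card_option card_sum !card_ord => hc hx.
case: caps => _ _ _; apply: leq_trans; apply: leq_add => //.
by apply: leq_trans hx _; rewrite leq_mul2r hc orbT.
Qed.

(** Candidates are tried in decreasing order, so those from [t] on have been seen; the first case is
    the initial state, kept as long as none of them was active. *)
Definition best_so_far (t : nat) (A : memory) : Prop :=
  (A kBC 0 = 0 /\ A kBL 0 = 1 /\ A kBE 0 = 0 /\ forall e : 'I_q, t <= e -> e \notin active w) \/
  exists (e0 : 'I_q) cnt s0, [/\ A kBE 0 = e0, e0 \in active w, cinv e0 cnt s0,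
    A kBC 0 = cval w cnt /\ A kBL 0 = cscale Sz Bv (4 * q) e0 cnt s0 &
    forall e : 'I_q, t <= e -> e \in active w -> exists cnt' s', cinv e cnt' s' /\
      cval w cnt' * A kBL 0 <= A kBC 0 * cscale Sz Bv (4 * q) e cnt' s'].

Lemma pcand_step (t : nat) s A : t < q -> runenv s -> s 6 = t -> inst A -> A kW = mW ->
  A kBC 0 <= cap -> A kBL 0 <= cap -> A kBE 0 <= cap ->
  best_so_far t.+1 A ->
  let A' := evalP L pcand s A in
  [/\ best_so_far t A', A' kBC 0 <= cap, A' kBL 0 <= cap & A' kBE 0 <= cap].
Proof.
move=> tq rs s6 iA iW hBC hBL hBE hbest.
have -> : evalP L pcand s A = evalP L pcand_tail s (evalP L pmwu s A) by [].
set A1 := evalP L pmwu s A.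
have A1f k : k \notin [:: kCNT; kS; kKS; kKA] -> A1 k = A k.
  by move=> h; apply: evalP_frame; rewrite !inE in h *; lia.
have [s0 s1] := rs.
pose c := minn (\sum_(0 <= k < s 0) A1 kW k * A1 kCNT k) (s 1).
pose l := minn (A1 kS 0 + n_Y (s 0) (szA A1 (s 0)) (A1 kB) (A1 kCNT) (A1 kS 0) (s 6)) (s 1).
pose f := minn (if A1 kW (s 6) != 0 then n_lt (A1 kBC 0 * l) (c * A1 kBL 0) else 0) (s 1).
rewrite pcand_tailE; cbv zeta; rewrite -/c -/l -/f.
set A' := updm _ kBL _ _.
have E1 : A' kBE 0 = minn (if f != 0 then t else A1 kBE 0) cap by rewrite -s1 -s6.
have E2 : A' kBC 0 = minn (if f != 0 then c else A1 kBC 0) cap by rewrite -s1.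
have E3 : A' kBL 0 = minn (if f != 0 then l else A1 kBL 0) cap by rewrite -s1.
split; last 3 first; [by rewrite E2 geq_minr|by rewrite E3 geq_minr|by rewrite E1 geq_minr|].
have tcap : t <= cap by case: caps; lia.
have c1 : 1 <= cap by case: caps; lia.
pose e := Ordinal tq.
have W1 : A1 kW = mW by rewrite A1f.
case: (boolP (e \in active w)) => ea; last first.
  have we : mW t = 0 by move: ea; rewrite inE ffunE negbK => /eqP.
  have f0 : f = 0 by rewrite /f W1 s6 we /= min0n.
  rewrite f0 /= in E1 E2 E3.
  rewrite !A1f // in E1 E2 E3.
  rewrite (minn_idPl hBE) in E1; rewrite (minn_idPl hBC) in E2; rewrite (minn_idPl hBL) in E3.
  case: hbest => [[h1 [h2 [h3 h4]]]|[e0 [cnt [s0' [h1 h2 h3 [h4 h5] h6]]]]].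
    left; rewrite E1 E2 E3; split=> //; split=> //; split=> // e' te.
    case: (ltnP t e') => h; first by apply: h4.
    by have -> : e' = e by apply: val_inj => /=; lia.
  right; exists e0, cnt, s0'; rewrite E1 E2 E3; split=> // e' te ea'.
  case: (ltnP t e') => h; first by apply: h6.
  by have E : e' = e by [apply: val_inj => /=; lia]; rewrite -E ea' in ea.
have [hinv hS] := pmwu_ok rs (s6 : s 6 = e) ea iA iW; rewrite -/A1 in hinv hS.
set cnt := ocnt _ in hinv; set sc := A1 kS 0 in hinv hS.
have cE : c = cval w cnt.
  have -> : c = minn (cval w cnt) cap.
    rewrite /c s0 s1 big_mkord; congr minn; apply: eq_bigr => k _.
    by rewrite /cnt /ocnt ffunE W1.
  by apply/minn_idPl; apply: cval_le hinv.
have lE : l = cscale Sz Bv (4 * q) e cnt sc.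
  have -> : l = minn (cscale Sz Bv (4 * q) e cnt sc) cap.
    rewrite /l s0 s1 s6 /cscale -n_YE; case: iA => iS iB.
    by rewrite /szA (A1f kSZ) // (A1f kB) // iS iB.
  by apply/minn_idPl; apply: cscale_le.
have wt : mW t != 0 by move: ea; rewrite inE ffunE.
have fE : f = (A kBC 0 * l < c * A kBL 0).
  rewrite /f s1 s6 W1 wt n_ltE !A1f //; apply/minn_idPl.
  by case: (_ < _).
have c0 : 0 < c by rewrite cE; apply: cval_gt0 hinv.
have A0 : active w != set0 by apply/set0Pn; exists e.
have scale_gt0 (e' : 'I_q) cnt' s' : e' \in active w -> cinv e' cnt' s' ->
    0 < cscale Sz Bv (4 * q) e' cnt' s'.
  move=> ea' h'; have [] := candidate_final Hfit' Hends' Hrel' Hn' n0 q_gt0 HT HG GT2 A0 ea' h'.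
  by [].
have ccap : c <= cap by rewrite cE; apply: cval_le hinv.
have lcap : l <= cap by rewrite lE; apply: cscale_le.
rewrite !A1f // in E1 E2 E3.
case: hbest => [[h1 [h2 [h3 h4]]]|[e0 [cnt0 [s0' [h1 h2 h3 [h4 h5] h6]]]]].
  have f1 : f = 1 by rewrite fE h1 h2 mul0n muln1 c0.
  rewrite f1 /= in E1 E2 E3.
  right; exists e, cnt, sc; rewrite E1 E2 E3 (minn_idPl tcap) (minn_idPl ccap) (minn_idPl lcap).
  split=> // e' te ea'; case: (ltnP t e') => h; first by have := h4 e' h; rewrite ea'.
  have -> : e' = e by apply: val_inj => /=; lia.
  by exists cnt, sc; split=> //; rewrite cE lE.
case: (ltnP (A kBC 0 * l) (c * A kBL 0)) fE => hlt fE; rewrite fE /= in E1 E2 E3.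
  right; exists e, cnt, sc; rewrite E1 E2 E3 (minn_idPl tcap) (minn_idPl ccap) (minn_idPl lcap).
  split=> // e' te ea'; case: (ltnP t e') => h; last first.
    have -> : e' = e by apply: val_inj => /=; lia.
    by exists cnt, sc; split=> //; rewrite cE lE.
  have [cnt' [s' [hc' hb']]] := h6 e' h ea'; exists cnt', s'; split=> //.
  (* Chaining two cross-multiplied comparisons requires cancelling the middle scale. *)
  have bl0 : 0 < A kBL 0 by rewrite h5; apply: scale_gt0.
  rewrite -(leq_pmul2r bl0).
  set v' := cval w cnt' in hb' *; set l' := cscale _ _ _ e' _ _ in hb' *.
  have t1 := leq_mul hb' (leqnn l); have t2 := leq_mul (ltnW hlt) (leqnn l').
  move: t1 t2; clear; nia.
right; exists e0, cnt0, s0'; rewrite E1 E2 E3 (minn_idPl hBE) (minn_idPl hBC) (minn_idPl hBL).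
split=> // e' te ea'; case: (ltnP t e') => h; first by apply: h6.
have -> : e' = e by apply: val_inj => /=; lia.
by exists cnt, sc; split=> //; rewrite -cE -lE.
Qed.

Lemma pcand_ok s A : runenv s -> inst A -> A kW = mW ->
  A kBC 0 = 0 -> A kBL 0 = 1 -> A kBE 0 = 0 ->
  let A' := evalP L (For 6 pcand) s A in
  (active w = set0 /\ A' kBE 0 = 0) \/
  exists2 e : 'I_q, A' kBE 0 = e & good_pick Sz Bv (5 * n%:R)^-1%R w e.
Proof.
move=> rs iA iW h1 h2 h3.
pose Q t (A' : memory) := [/\ inst A', A' kW = mW, best_so_far t A' &
  [/\ A' kBC 0 <= cap, A' kBL 0 <= cap & A' kBE 0 <= cap]].
have c1 : 1 <= cap by case: caps; lia.
have : Q 0 (evalP L (For 6 pcand) s A).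
  rewrite evalP_For (rs.1); apply: loop_inv.
    split=> //; last by rewrite h1 h2 h3.
    by left; do 3 split=> //; move=> e; have := ltn_ord e; lia.
  move=> t A' tq [iA' iW' hb [b1 b2 b3]].
  have rs' : runenv (upd s 6 t) by case: rs.
  have fr k : k \notin wkeys pcand -> evalP L pcand (upd s 6 t) A' k = A' k.
    exact: evalP_frame.
  have [g1 g2 g3 g4] := pcand_step tq rs' (erefl : upd s 6 t 6 = t) iA' iW' b1 b2 b3 hb.
  split=> //; last by rewrite fr.
  by case: iA' => *; split; rewrite fr.
case=> _ _ hb _; cbv zeta; case: hb => [[_ [_ [hE hn]]]|[e0 [cnt [s0 [hE ea hinv [hC hL] hall]]]]].
  by left; split=> //; apply/setP => e; rewrite in_set0; apply/negbTE; apply: hn.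
right; exists e0 => //.
have A0 : active w != set0 by apply/set0Pn; exists e0.
apply: (pick_ok Hfit' Hends' Hrel' Hn' n0 q_gt0 HT HG GT2 A0 ea hinv) => e ea'.
have [//|cnt' [s' [h4 h5]]] := hall e _ ea'; exists cnt', s'; split=> //.
by rewrite -hC -hL.
Qed.
End Weights.

Definition pupd := For 7 (Wr kW (Var 7) (Ite (eeq (Var 7) (cell kBE)) (Cst 0)
  (esub (emul (eP (cell kBE)) (Rd kW (Var 7))) (emul (cell kLA) (egrn (cell kBE) (Var 7)))))).

Lemma proundE s A : evalP L pround s A =
  let A1 := evalP L (For 6 pcand) s
    (updm (updm (updm A kBC 0 (minn 0 (s 1))) kBL 0 (minn 1 (s 1))) kBE 0 (minn 0 (s 1))) in
  let la := minn (A1 kW (A1 kBE 0)) (s 1) in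
  evalP L pupd s (updm (updm A1 kLA 0 la) kSTK (s 5)
    (minn (if la != 0 then A1 kBE 0 + 1 else 0) (s 1))).
Proof. by []. Qed.

Lemma pupd_stepE s A : evalP L (Wr kW (Var 7) (Ite (eeq (Var 7) (cell kBE)) (Cst 0)
  (esub (emul (eP (cell kBE)) (Rd kW (Var 7))) (emul (cell kLA) (egrn (cell kBE) (Var 7)))))) s A =
  updm A kW (s 7) (minn (if n_eq (s 7) (A kBE 0) != 0 then 0 else
    n_P (s 0) (szA A (s 0)) (A kB) (A kBE 0) * A kW (s 7) -
    A kLA 0 * n_grn (s 0) (szA A (s 0)) (A kB) (A kBE 0) (s 7)) (s 1)).
Proof. by []. Qed.

Let eta : rat := ((5 * n%:R)^-1)%R.

(** The first case is an idle round: the loop runs [q] times, even after all weights have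
    vanished. *)
Definition rstep (w w' : {ffun 'I_q -> nat}) (stk : nat) : Prop :=
  (active w = set0 /\ stk = 0 /\ active w' = set0) \/
  exists e : 'I_q, [/\ good_pick Sz Bv eta w e, stk = e.+1 & w' = local_step Sz Bv e w].

Variables (W0 Pm : nat).
Hypothesis HPm : forall e, e \in R0 -> denprod Sz Bv e <= Pm.
Hypothesis Pm0 : 0 < Pm.
Hypothesis Hcap2 : W0 * Pm ^ n.+1 * q <= cap.

Lemma round_ok s A r : runenv s -> s 5 = r -> inst A ->
  active (ofw q (A kW)) \subset R0 -> (forall k, k < q -> A kW k <= W0 * Pm ^ n) ->
  let A' := evalP L pround s A in
  [/\ inst A', rstep (ofw q (A kW)) (ofw q (A' kW)) (A' kSTK r) &
      forall x, x != r -> A' kSTK x = A kSTK x].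
Proof.
move=> rs s5 iA wR hW; have [s0 s1] := rs.
have q0 := q_gt0.
have cap1 : 1 <= cap by case: caps; lia.
have capP : W0 * Pm ^ n * Pm <= cap.
  by apply: leq_trans Hcap2; rewrite expnSr mulnA leq_pmulr.
have capq : W0 * Pm ^ n * q <= cap.
  by apply: leq_trans Hcap2; rewrite expnSr leq_mul2r leq_mul2l leq_pmulr ?orbT.
have capw : W0 * Pm ^ n <= cap by apply: leq_trans capq; rewrite leq_pmulr.
have qcap : q.+1 <= cap by case: caps.
rewrite proundE s1 s5 min0n (minn_idPl cap1).
set Ai := updm _ _ _ _; set A1 := evalP L (For 6 pcand) s Ai; cbv zeta.
have A1f k : k \notin wkeys pcand -> A1 k = A k.
  move=> h; rewrite /A1 evalP_frame //; move: h; rewrite /Ai /updm !inE !negb_or.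
  by repeat case/andP => ?; move=> *; repeat (case: eqP => [?|_]; first by subst).
have iAi : inst Ai by case: iA.
set w := ofw q (A kW).
have hpick := pcand_ok wR hW capq rs iAi (erefl : Ai kW = A kW) erefl erefl erefl.
rewrite -/A1 -/w in hpick.
set la := minn _ _; set A2 := updm _ _ _ _.
have A2f k : k \notin [:: kLA; kSTK] -> A2 k = A1 k.
  by rewrite !inE negb_or => /andP[/negbTE h1 /negbTE h2]; rewrite /A2 /updm h2 h1.
have A2W : A2 kW = A kW by rewrite A2f // A1f.
have A2B : A2 kB = mB by rewrite A2f // A1f //; case: iA.
have A2S : A2 kSZ = mSZ by rewrite A2f // A1f //; case: iA.
have A2E : A2 kBE 0 = A1 kBE 0 by rewrite A2f.
have A2L : A2 kLA 0 = la by rewrite /A2 /updm.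
have A2T x : A2 kSTK x = if x == r then minn (if la != 0 then A1 kBE 0 + 1 else 0) cap else A kSTK x.
  rewrite /A2 /updm /= /upd /=; case: ifP => // _.
  by rewrite A1f.
set A' := evalP L pupd s A2.
pose v i := minn (if n_eq i (A1 kBE 0) != 0 then 0 else
    n_P q sz mB (A1 kBE 0) * A kW i - la * n_grn q sz mB (A1 kBE 0) i) cap.
have [|i1 j1 _ _ //|A'f A'W _] := @loop_fill q kW id v
    (fun i0 A0 => evalP L (Wr kW (Var 7) (Ite (eeq (Var 7) (cell kBE)) (Cst 0)
  (esub (emul (eP (cell kBE)) (Rd kW (Var 7))) (emul (cell kLA) (egrn (cell kBE) (Var 7))))))
      (upd s 7 i0) A0) A2.
  move=> i0 A0 i0q hA0 hA0i; rewrite pupd_stepE /=.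
  have -> : upd s 7 i0 0 = q by [].
  have -> : upd s 7 i0 1 = cap by [].
  have -> : upd s 7 i0 7 = i0 by [].
  have z1 : szA A0 q = sz by rewrite /szA (hA0 kSZ) // A2S.
  rewrite z1 (hA0 kB) // (hA0 kBE) // (hA0 kLA) // hA0i A2B A2L A2E A2W.
  by [].
have A'E : A' = loop q (fun i0 A0 => evalP L (Wr kW (Var 7) (Ite (eeq (Var 7) (cell kBE)) (Cst 0)
  (esub (emul (eP (cell kBE)) (Rd kW (Var 7))) (emul (cell kLA) (egrn (cell kBE) (Var 7))))))
      (upd s 7 i0) A0) A2 by rewrite /A' /pupd evalP_For s0.
rewrite -A'E in A'f A'W.
split.
- by split; rewrite A'f.
- rewrite (A'f kSTK) // A2T eqxx.
  case: hpick => [[a0 hE]|[e hE hg]].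
    left; split=> //.
    have w0 k : k < q -> A kW k = 0.
      move=> kq; have := in_set0 (Ordinal kq); rewrite -a0 inE ffunE /=.
      by move=> /negbFE/eqP.
    have la0 : la = 0 by rewrite /la hE A1f // w0 // min0n.
    rewrite la0 /= min0n; split=> //; apply/setP => k; rewrite in_set0 inE ffunE; apply/negbTE; rewrite negbK; apply/eqP.
    rewrite A'W // /v la0 mul0n w0 // muln0 subn0.
    by case: ifP; rewrite min0n.
  right; exists e.
  have we : A kW e != 0 by case: hg; rewrite ffunE.
  have laE : la = A kW e.
    by rewrite /la hE A1f //; apply/minn_idPl; apply: leq_trans (hW _ _) capw.
  have eR : e \in R0 by apply: (subsetP wR); rewrite inE ffunE.
  split=> //.
    rewrite laE we hE addn1; apply/minn_idPl; apply: leq_trans qcap.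
    by have := ltn_ord e; lia.
  apply/ffunP => k; rewrite !ffunE A'W // /v hE n_PE n_grnE laE n_eqE.
  rewrite -val_eqE /=; case: (nat_of_ord k == e) => /=; first by rewrite min0n.
  apply/minn_idPl; apply: leq_trans (leq_subr _ _) _; apply: leq_trans capP.
  by rewrite mulnC; apply: leq_mul; [apply: hW|apply: HPm].
- by move=> x xr; rewrite A'f // A2T (negbTE xr).
Qed.

Lemma rounds_ok s A : runenv s -> inst A -> active (ofw q (A kW)) \subset R0 ->
  (forall k, k < q -> A kW k <= W0) ->
  let A' := evalP L (For 5 pround) s A in
  exists wseq : nat -> {ffun 'I_q -> nat},
    [/\ wseq q = ofw q (A kW), active (wseq 0) = set0 &
      forall r, r < q -> rstep (wseq r.+1) (wseq r) (A' kSTK r)].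
Proof.
move=> rs iA wR hW; have q0 := q_gt0.
(* A round with a pick multiplies the weights by at most [Pm] and deactivates an item, so the
   exponent may grow as the active set shrinks. At most [t] active items with [t] rounds left means
   none at the end. *)
pose Q t (A' : memory) := inst A' /\ exists wseq : nat -> {ffun 'I_q -> nat},
  [/\ wseq q = ofw q (A kW), wseq t = ofw q (A' kW),
    forall r, t <= r < q -> rstep (wseq r.+1) (wseq r) (A' kSTK r),
    active (wseq t) \subset R0 /\ #|active (wseq t)| <= t &
    forall k, wseq t k <= W0 * Pm ^ (n - #|active (wseq t)|)].
have : Q 0 (evalP L (For 5 pround) s A); last first.
  case=> _ [wseq [h1 _ h2 [_ h3] _]]; exists wseq; split=> //.
  by apply/eqP; rewrite -cards_eq0 -leqn0.
rewrite evalP_For rs.1; apply: loop_inv.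
  split=> //; exists (fun=> ofw q (A kW)); split=> //; first by lia.
    by split=> //; apply: leq_trans (max_card _) _; rewrite card_ord.
  move=> k; rewrite ffunE; apply: leq_trans (hW _ (ltn_ord k)) _.
  by rewrite -[X in X <= _]muln1 leq_mul2l expn_gt0 Pm0 orbT.
move=> t A' tq [iA' [wseq [h1 h2 h3 [h4 h4'] h5]]].
have rs' : runenv (upd s 5 t) by case: rs.
have b1 k : k < q -> A' kW k <= W0 * Pm ^ n.
  move=> kq; have := h5 (Ordinal kq); rewrite h2 ffunE /= => /leq_trans; apply.
  by rewrite leq_mul2l leq_pexp2l ?orbT //; lia.
rewrite h2 in h4.
have [iA'' hst hstk] := round_ok rs' (erefl : upd s 5 t 5 = t) iA' h4 b1.
set A'' := evalP L pround _ A' in iA'' hst hstk *.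
split=> //; exists (fun r => if r == t then ofw q (A'' kW) else wseq r).
have qt : (q == t) = false by lia.
split.
- by rewrite qt.
- by rewrite eqxx.
- move=> r hr; have -> : (r.+1 == t) = false by lia.
  case: (eqVneq r t) => [->|rt]; first by rewrite h2.
  by rewrite hstk //; apply: h3; lia.
- rewrite eqxx; case: hst => [[_ [_ ->]]|[e [hg _ ->]]].
    by rewrite sub0set cards0.
  have hs := active_step Sz Bv e (ofw q (A' kW)).
  have ea : e \in active (ofw q (A' kW)) by rewrite inE; case: hg.
  split; first by apply: subset_trans hs _; apply: subset_trans (subD1set _ _) h4.
  have := subset_leq_card hs; have := cardsD1 e (active (ofw q (A' kW))).
  by rewrite ea; move: h4'; rewrite h2; lia.
- rewrite eqxx => k; case: hst => [[_ [_ a0]]|[e [hg _ ->]]].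
    have : k \notin active (ofw q (A'' kW)) by rewrite a0 in_set0.
    by rewrite inE negbK => /eqP ->.
  have hs := active_step Sz Bv e (ofw q (A' kW)).
  have ea : e \in active (ofw q (A' kW)) by rewrite inE; case: hg.
  have hc := subset_leq_card hs; have hc' := cardsD1 e (active (ofw q (A' kW))).
  rewrite ea in hc'.
  rewrite ffunE; case: eqP => // _; apply: leq_trans (leq_subr _ _) _.
  have eR : e \in R0 by apply: (subsetP h4).
  have := h5 k; rewrite h2 => h5k.
  apply: leq_trans (leq_mul (HPm eR) h5k) _.
  rewrite mulnCA -expnS leq_mul2l leq_pexp2l ?orbT //.
  have : #|active (ofw q (A' kW))| <= n by apply: leq_trans (subset_leq_card h4) Hn.
  by lia.
Qed.

Lemma pinsertE s A : evalP L pinsert s A =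
  let stk := A kSTK (s 0 - 1 - s 5) in
  let f := minn (if stk != 0 then
     if \sum_(0 <= i < s 0) n_lt (A kB i)
       (\sum_(0 <= k < s 0) A kSEL k * szA A (s 0) i k + szA A (s 0) i (stk - 1)) != 0
     then 0 else 1 else 0) (s 1) in
  updm (updm A kF 0 f) kSEL (stk - 1) (minn (if f != 0 then 1 else A kSEL (stk - 1)) (s 1)).
Proof. by []. Qed.

Lemma inserts_ok s A (wseq : nat -> {ffun 'I_q -> nat}) : runenv s -> inst A ->
  (forall k, k < q -> A kSEL k = 0) -> active (wseq 0) = set0 ->
  (forall r, r < q -> rstep (wseq r.+1) (wseq r) (A kSTK r)) ->
  let A' := evalP L (For 5 pinsert) s A in
  exists2 S, solved Sz Bv eta (wseq q) S & forall k : 'I_q, A' kSEL k = (k \in S).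
Proof.
move=> rs iA hsel a0 hst; have q0 := q_gt0.
have cap1 : 1 <= cap by case: caps; lia.
pose Q t (A' : memory) := [/\ inst A', A' kSTK = A kSTK &
  exists2 S, solved Sz Bv eta (wseq (q - t)) S & forall k : 'I_q, A' kSEL k = (k \in S)].
have : Q 0 (evalP L (For 5 pinsert) s A); last by rewrite /Q subn0 => -[].
rewrite evalP_For rs.1; apply: loop_inv.
  split=> //; rewrite subnn; exists set0; first exact: SolvedNil.
  by move=> k; rewrite in_set0 hsel.
move=> t A' tq [[iS iB] iT [S hS hsS]].
rewrite pinsertE.
have -> : upd s 5 t 0 = q by case: rs.
have -> : upd s 5 t 1 = cap by case: rs.
have -> : upd s 5 t 5 = t by [].
have rE : q - 1 - t = q - t.+1 by lia.
rewrite rE iT iB; have zE : szA A' q = sz by rewrite /szA iS.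
rewrite zE; set r := q - t.+1 in hS *; set stk := A kSTK r.
have rq : q - t = r.+1 by rewrite /r; lia.
cbv zeta; set f := minn _ _.
split=> //; rewrite rq.
have rlt : r < q by rewrite /r; lia.
case: (hst r rlt) => [[w0 [stk0 w1]]|[e [hg stkE wE]]].
  exists set0; first exact: SolvedNil.
  have S0 : S = set0.
    by apply/eqP; rewrite -subset0 -w1; apply: solved_active hS.
  have f0 : f = 0 by rewrite /f /stk stk0 /= min0n.
  (* An idle round still writes cell [0 - 1 = 0] of the selection, but with the value already
     there. *)
  move=> k; rewrite f0 /stk stk0 sub0n /=.
  rewrite /updm /= /upd; case: eqP => k0; last by rewrite hsS S0.
  by have := hsS k; rewrite k0 => ->; rewrite S0 in_set0 min0n.
exists (insert Sz Bv e S); first by apply: SolvedStep => //; rewrite -wE.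
have stk1 : stk - 1 = e by rewrite /stk stkE subn1.
have fE : f = [forall i, sload Sz S i + Sz i e <= Bv i].
  have -> : f = minn (if \sum_(0 <= i < q) n_lt (mB i)
       (\sum_(0 <= k < q) A' kSEL k * sz i k + sz i e) != 0 then 0 else 1) cap.
    by rewrite /f stk1 /stk stkE.
  set Sg := \sum_(0 <= i < q) _.
  have hsl (i : 'I_q) : \sum_(0 <= k < q) A' kSEL k * sz i k = sload Sz S i.
    rewrite big_mkord /sload [RHS]big_mkcond /=; apply: eq_bigr => k _.
    by rewrite hsS; case: (k \in S); rewrite ?mul1n ?mul0n.
  case: (boolP [forall i, _]) => [/forallP hall|].
    have -> : Sg = 0.
      rewrite /Sg big_mkord big1 // => i _; rewrite n_ltE hsl.
      have := hall i; rewrite /Sz /osz /Bv /obv => hi; rewrite ltnNge hi //.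
    by rewrite /= (minn_idPl cap1).
  rewrite negb_forall => /existsP[i]; rewrite -ltnNge => hi.
  have -> : Sg != 0; last by rewrite /= min0n.
  rewrite /Sg big_mkord sum_nat_eq0 negb_forall; apply/existsP; exists i.
  by rewrite /= n_ltE hsl; rewrite /Sz /osz /Bv /obv in hi *; rewrite hi.
move=> k; rewrite stk1 /updm /= /upd /insert.
have -> : (nat_of_ord k == e) = (k == e) by rewrite val_eqE.
rewrite fE; case: (boolP [forall i, _]) => _ /=.
  by rewrite in_setU1; case: eqP => //= _; rewrite ?hsS // (minn_idPl cap1).
case: (eqVneq k e) => [->|//]; rewrite hsS.
by apply/minn_idPl; case: (e \in S).
Qed.
End Run.

Lemma loop2_fill q k (v : nat -> nat -> nat) f (A : memory) :
  (forall i j A', i < q -> j < q -> (forall k', k' != k -> A' k' = A k') ->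
     f i j A' = updm A' k (i * q + j) (v i j)) ->
  let A' := loop q (fun i => loop q (f i)) A in
  (forall k', k' != k -> A' k' = A k') /\
  (forall i j, i < q -> j < q -> A' k (i * q + j) = v i j).
Proof.
move=> hf.
pose P t (A' : memory) := (forall k', k' != k -> A' k' = A k') /\
  (forall i j, t <= i < q -> j < q -> A' k (i * q + j) = v i j).
have : P 0 (loop q (fun i => loop q (f i)) A).
  apply: loop_inv; first by split=> // i j; lia.
  move=> t A' tq [h1 h2].
  have [||g1 g2 g3] := @loop_fill q k (fun j => t * q + j) (v t) (f t) A'.
  - move=> j B jq hB _; apply: hf => // k' kk; by rewrite hB // h1.
  - by move=> i j _ _; lia.
  split; first by move=> k' kk; rewrite g1 // h1.
  move=> i j hi jq; case: (eqVneq i t) => [->|it]; first by rewrite g2.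
  rewrite g3 ?h2 //; first by lia.
  move=> j' jq'; apply/eqP => E; have [|] := ltnP t i.
    by nia.
  by lia.
by case=> h1 h2; split=> // i j iq; apply: h2.
Qed.

(** * Initialisation: integral data and binary items *)

Section Init.
Variables (L q cap N m n : nat) (inp : nat -> nat) (s : env) (A0 : memory).
Hypotheses (s0 : s 0 = q) (s1 : s 1 = cap) (s2 : s 2 = N) (s3 : s 3 = m) (s4 : s 4 = n).
Hypothesis A0inp : A0 0 = inp.
Hypothesis A0zero : forall k i, k != 0 -> A0 k i = 0.

Definition gin (a : nat) : nat := inp (minn a L).
Definition delta : nat := \prod_(0 <= a < q) (if gin a != 0 then gin a else 1).
Definition ratint (o i : nat) : nat := gin (o + 2 * i) * (delta %/ gin (o + (2 * i + 1))).
Definition o_b : nat := 2 + 2 * (m * n).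
Definition o_c : nat := o_b + 2 * m.
Definition o_d : nat := o_c + 2 * n.
Definition bint (i : nat) : nat := if i < m then ratint o_b i else 0.
Definition cint (j : nat) : nat := if j < n then ratint o_c j else 0.
Definition aint (i j : nat) : nat :=
  if (i < m) && (j < n) then
    gin (2 + 2 * (i * n + j)) * (delta %/ gin (3 + 2 * (i * n + j))) else 0.
Definition ubound0 (j : nat) : nat :=
  if j < n then
    if gin (o_d + 2 * j) != 0 then gin (o_d + (2 * j + 1))
    else if \sum_(0 <= i < q) aint i j != 0 then \sum_(0 <= i < q) bint i else 0
  else 0.

(** The two upper bounds make every item fit and respect [d]. [us_att] keeps [U] from being too
    small: an optimal solution, once its costless variables are set to 0, stays below it. *)
Record ubound_spec (U : nat -> nat) : Prop := UboundSpec {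
  us_le0 : forall j, j < q -> U j <= ubound0 j;
  us_le : forall i j, i < q -> j < q -> aint i j != 0 -> U j <= bint i %/ aint i j;
  us_att : forall j, j < q -> U j = ubound0 j \/
    exists2 i, i < q & aint i j != 0 /\ U j = bint i %/ aint i j
}.

(* Item [k] stands for [mu U k] copies of variable [k %/ N]; over the residues of
   [k] mod [N] these are the powers of 2, truncated so that they add up to [U]. *)
Definition mu (U : nat -> nat) (k : nat) : nat :=
  minn (2 ^ (k %% N)) (U (k %/ N) - (2 ^ (k %% N) - 1)).

Hypothesis N0 : 0 < N.
Hypothesis Nq : N * N <= q.
(** To be [2 ^ N]; as it dominates every cell and [delta], each integral datum is at most
    [Z * Z]. *)
Variable Z : nat.
Hypotheses (ZN : 2 ^ N <= Z) (dZ : delta <= Z) (gZ : forall a, gin a <= Z)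
  (capZ : Z * Z * q * (Z * Z) <= cap).

Let Z1 : 0 < Z. Proof. by apply: leq_trans ZN; rewrite expn_gt0. Qed.
Let q0 : 0 < q. Proof. by apply: leq_trans Nq; rewrite muln_gt0 N0. Qed.
Let ZZcap x : x <= Z * Z * q -> x <= cap.
Proof. by move=> h; apply: leq_trans capZ; apply: leq_trans h _; rewrite leq_pmulr // muln_gt0 Z1. Qed.

Lemma ratint_le o i : ratint o i <= Z * Z.
Proof. by rewrite /ratint leq_mul // (leq_trans (leq_div _ _)). Qed.
Lemma bint_le i : bint i <= Z * Z.
Proof. by rewrite /bint; case: ifP => // _; apply: ratint_le. Qed.
Lemma cint_le j : cint j <= Z * Z.
Proof. by rewrite /cint; case: ifP => // _; apply: ratint_le. Qed.
Lemma aint_le i j : aint i j <= Z * Z.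
Proof. by rewrite /aint; case: ifP => // _; rewrite leq_mul // (leq_trans (leq_div _ _)). Qed.

Lemma ubound0_le j : ubound0 j <= Z * Z * q.
Proof.
rewrite /ubound0; case: ifP => // _; case: ifP => // _.
  by apply: leq_trans (gZ _) _; have := Z1; nia.
case: ifP => // _; apply: leq_trans (_ : \sum_(0 <= i < q) Z * Z <= _).
  by apply: leq_sum => i _; apply: bint_le.
by rewrite sum_nat_const_nat subn0 mulnC.
Qed.

Let A1 := evalP L pdelta s A0.
Lemma pdelta_ok : A1 kDE 0 = delta /\ forall k, k != kDE -> A1 k = A0 k.
Proof.
split; last by move=> k kk; apply: evalP_frame; rewrite inE.
have -> : A1 kDE 0 = minn (\prod_(0 <= a < s 0)
    (if A0 0 (minn a L) != 0 then A0 0 (minn a L) else 1)) (s 1) by [].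
rewrite s0 s1 A0inp; apply/minn_idPl; apply: ZZcap.
by apply: leq_trans (dZ : delta <= Z) _; have := Z1; nia.
Qed.

Let A2 := evalP L pB s A1.
Lemma pB_ok : (forall i, i < q -> A2 kB i = bint i) /\ forall k, k != kB -> A2 k = A1 k.
Proof.
have [hd hf] := pdelta_ok.
split; last by move=> k kk; apply: evalP_frame; rewrite inE.
rewrite /A2 /pB evalP_For s0.
have [||_ h _] := @loop_fill q kB id bint (fun i0 A' => evalP L
    (Wr kB (Var 5) (Ite (elt (Var 5) xm) (erat eob (Var 5)) (Cst 0))) (upd s 5 i0) A') A1.
- move=> i A' iq hA' _.
  have -> : evalP L (Wr kB (Var 5) (Ite (elt (Var 5) xm) (erat eob (Var 5)) (Cst 0))) (upd s 5 i) A'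
    = updm A' kB i (minn (if n_lt i (s 3) != 0 then
      A' 0 (minn (2 + 2 * (s 3 * s 4) + 2 * i) L) *
      (A' kDE 0 %/ A' 0 (minn (2 + 2 * (s 3 * s 4) + (2 * i + 1)) L)) else 0) (s 1)) by [].
  congr updm; rewrite !hA' // hd hf // A0inp s1 s3 s4 n_ltE.
  transitivity (minn (bint i) cap); first by rewrite /bint; case: (i < m).
  by apply/minn_idPl; apply: ZZcap; apply: leq_trans (bint_le i) _; rewrite leq_pmulr.
- by [].
- exact: h.
Qed.

Let A3 := evalP L pA s A2.
Lemma pA_ok : (forall i j, i < q -> j < q -> A3 kA (i * q + j) = aint i j) /\
  forall k, k != kA -> A3 k = A2 k.
Proof.
have [hd hf] := pdelta_ok; have [_ hf2] := pB_ok.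
split; last by move=> k kk; apply: evalP_frame; rewrite inE.
pose f i j A' := evalP L (Wr kA (eadd (emul (Var 5) xq) (Var 6))
  (Ite (elt (Var 5) xm) (Ite (elt (Var 6) xn) (eA0 (Var 5) (Var 6)) (Cst 0)) (Cst 0)))
  (upd (upd s 5 i) 6 j) A'.
have -> : A3 = loop (s 0) (fun i => loop (s 0) (f i)) A2 by [].
rewrite s0.
have [|_ h] := @loop2_fill q kA aint f A2; last exact: h.
move=> i j A' iq jq hA'.
have -> : f i j A' = updm A' kA (i * s 0 + j) (minn (if n_lt i (s 3) != 0 then
    if n_lt j (s 4) != 0 then A' 0 (minn (2 + 2 * (i * s 4 + j)) L) *
      (A' kDE 0 %/ A' 0 (minn (3 + 2 * (i * s 4 + j)) L)) else 0 else 0) (s 1)) by [].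
rewrite s0; congr updm; rewrite !hA' // !hf2 // hd hf // A0inp s1 s3 s4 !n_ltE.
transitivity (minn (aint i j) cap); first by rewrite /aint; case: (i < m); case: (j < n).
by apply/minn_idPl; apply: ZZcap; apply: leq_trans (aint_le i j) _; rewrite leq_pmulr.
Qed.

Let A4 := evalP L pCO s A3.
Lemma pCO_ok : (forall j, j < q -> A4 kCO j = cint j) /\ forall k, k != kCO -> A4 k = A3 k.
Proof.
have [hd hf] := pdelta_ok; have [_ hf2] := pB_ok; have [_ hf3] := pA_ok.
split; last by move=> k kk; apply: evalP_frame; rewrite inE.
rewrite /A4 /pCO evalP_For s0.
have [||_ h _] := @loop_fill q kCO id cint (fun i0 A' => evalP L
    (Wr kCO (Var 5) (Ite (elt (Var 5) xn) (erat eoc (Var 5)) (Cst 0))) (upd s 5 i0) A') A3.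
- move=> i A' iq hA' _.
  have -> : evalP L (Wr kCO (Var 5) (Ite (elt (Var 5) xn) (erat eoc (Var 5)) (Cst 0))) (upd s 5 i) A'
    = updm A' kCO i (minn (if n_lt i (s 4) != 0 then
      A' 0 (minn (2 + 2 * (s 3 * s 4) + 2 * s 3 + 2 * i) L) *
      (A' kDE 0 %/ A' 0 (minn (2 + 2 * (s 3 * s 4) + 2 * s 3 + (2 * i + 1)) L)) else 0) (s 1)) by [].
  congr updm; rewrite !hA' // !hf3 // !hf2 // hd hf // A0inp s1 s3 s4 n_ltE.
  transitivity (minn (cint i) cap); first by rewrite /cint; case: (i < n).
  by apply/minn_idPl; apply: ZZcap; apply: leq_trans (cint_le i) _; rewrite leq_pmulr.
- by [].
- exact: h.
Qed.

Let A5 := evalP L pU0 s A4.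
Lemma pU0_ok : (forall j, j < q -> A5 kU j = ubound0 j) /\ forall k, k != kU -> A5 k = A4 k.
Proof.
have [hd hf] := pdelta_ok; have [hB hf2] := pB_ok; have [hA hf3] := pA_ok; have [_ hf4] := pCO_ok.
split; last by move=> k kk; apply: evalP_frame; rewrite inE.
pose e := Ite (elt (Var 5) xn)
  (Ite (Rd 0 (eadd eod (emul (Cst 2) (Var 5))))
       (Rd 0 (eadd eod (eadd (emul (Cst 2) (Var 5)) (Cst 1))))
       (Ite (Big BSum 22 (eA (Var 22) (Var 5))) (Big BSum 22 (Rd kB (Var 22))) (Cst 0)))
  (Cst 0).
rewrite /A5 /pU0 evalP_For s0.
have [||_ h _] := @loop_fill q kU id ubound0 (fun i0 A' => evalP L (Wr kU (Var 5) e) (upd s 5 i0) A') A4.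
- move=> j A' jq hA' _.
  have -> : evalP L (Wr kU (Var 5) e) (upd s 5 j) A'
    = updm A' kU j (minn (if n_lt j (s 4) != 0 then
       if A' 0 (minn (2 + 2 * (s 3 * s 4) + 2 * s 3 + 2 * s 4 + 2 * j) L) != 0 then
         A' 0 (minn (2 + 2 * (s 3 * s 4) + 2 * s 3 + 2 * s 4 + (2 * j + 1)) L)
       else if \sum_(0 <= i < s 0) A' kA (i * s 0 + j) != 0
            then \sum_(0 <= i < s 0) A' kB i else 0 else 0) (s 1)) by [].
  congr updm; rewrite s0 s1 s3 s4 n_ltE.
  have -> : \sum_(0 <= i < q) A' kA (i * q + j) = \sum_(0 <= i < q) aint i j.
    rewrite big_nat [RHS]big_nat; apply: eq_bigr => i /andP[_ iq].
    by rewrite hA' // hf4 // hA.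
  have -> : \sum_(0 <= i < q) A' kB i = \sum_(0 <= i < q) bint i.
    rewrite big_nat [RHS]big_nat; apply: eq_bigr => i /andP[_ iq].
    by rewrite hA' // hf4 // hf3 // hB.
  rewrite !hA' // !hf4 // !hf3 // !hf2 // hf // A0inp.
  transitivity (minn (ubound0 j) cap); first by rewrite /ubound0; case: (j < n).
  by apply/minn_idPl; apply: ZZcap; apply: ubound0_le.
- by [].
- exact: h.
Qed.

Let A6 := evalP L pU1 s A5.
Lemma pU1_ok : ubound_spec (A6 kU) /\ forall k, k != kU -> A6 k = A5 k.
Proof.
have [hB _] := pB_ok; have [hA hf3] := pA_ok; have [_ hf4] := pCO_ok; have [hU hf5] := pU0_ok.
split; last by move=> k kk; apply: evalP_frame; rewrite inE.
pose f j i A' := evalP L (Wr kU (Var 5) (Ite (eA (Var 6) (Var 5))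
  (emin (Rd kU (Var 5)) (ediv (Rd kB (Var 6)) (eA (Var 6) (Var 5)))) (Rd kU (Var 5))))
  (upd (upd s 5 j) 6 i) A'.
have -> : A6 = loop (s 0) (fun j => loop (s 0) (f j)) A5 by [].
rewrite s0.
pose sp j t u := [/\ u <= ubound0 j,
  forall i, t <= i < q -> aint i j != 0 -> u <= bint i %/ aint i j &
  u = ubound0 j \/ exists2 i, i < q & aint i j != 0 /\ u = bint i %/ aint i j].
pose P t (A' : memory) := [/\ forall k, k != kU -> A' k = A5 k,
  forall j, j < t -> j < q -> A' kU j = ubound0 j &
  forall j, t <= j < q -> sp j 0 (A' kU j)].
have : P 0 (loop q (fun j => loop q (f j)) A5); last first.
  case=> _ _ h; split.
  - by move=> j jq; case: (h j) => //; rewrite jq.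
  - by move=> i j iq jq ha; have [_ h2 _] := h j jq; apply: h2.
  - by move=> j jq; case: (h j) => //; rewrite jq.
apply: loop_inv; first by split=> //; [move=> j _; apply: hU|move=> j; lia].
move=> j A' jq [h1 h2 h3].
pose Q t (B : memory) := [/\ forall k, k != kU -> B k = A5 k,
  forall j', j' != j -> B kU j' = A' kU j' & sp j t (B kU j)].
have : Q 0 (loop q (f j) A'); last first.
  case=> g1 g2 g3; split=> //; first by move=> j' jj j'q; rewrite g2 ?h2 //; lia.
  move=> j' hj'; case: (eqVneq j' j) => [->//|jj]; rewrite g2 //; apply: h3; lia.
apply: loop_inv.
  split=> //; rewrite h2 //; split=> //; [by move=> i; lia|by left].
move=> i B iq [g1 g2 [g3 g4 g5]].
have -> : f j i B = updm B kU j (minn (if B kA (i * s 0 + j) != 0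
    then n_min (B kU j) (B kB i %/ B kA (i * s 0 + j)) else B kU j) (s 1)) by [].
rewrite s0 s1 n_minE !(g1 kA) // !(g1 kB) // hf5 // hf4 // hA // hf5 // hf4 // hf3 // hB //.
have Bcap : B kU j <= cap by apply: ZZcap; apply: leq_trans g3 (ubound0_le j).
have -> : minn (if aint i j != 0 then minn (B kU j) (bint i %/ aint i j) else B kU j) cap =
  (if aint i j != 0 then minn (B kU j) (bint i %/ aint i j) else B kU j).
  apply/minn_idPl; case: ifP => // _; exact: leq_trans (geq_minl _ _) Bcap.
split.
- by move=> k kk; rewrite /updm (negbTE kk) g1.
- by move=> j' jj; rewrite updm_neq // g2.
rewrite updm_eq; case: (boolP (aint i j != 0)) => hai; last first.
  split=> // i' hi' ha; case: (eqVneq i' i) => [E|ii]; first by rewrite E (negbTE hai) in ha.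
  by apply: g4 => //; lia.
split.
- exact: leq_trans (geq_minl _ _) g3.
- move=> i' hi' ha; case: (eqVneq i' i) => [->|ii]; first exact: geq_minr.
  by apply: leq_trans (geq_minl _ _) _; apply: g4 => //; lia.
- case: (leqP (B kU j) (bint i %/ aint i j)) => _; first by [].
  by right; exists i.
Qed.

Let A7 := evalP L pMU s A6.
Let U := A6 kU.

Lemma mu_le k : mu U k <= 2 ^ N.
Proof.
apply: leq_trans (geq_minl _ _) _; rewrite leq_exp2l //.
by apply: ltnW; rewrite ltn_mod.
Qed.

Lemma pow_mirror l : l <= q -> \prod_(0 <= x < q) (if n_lt x l != 0 then 2 else 1) = 2 ^ l.
Proof.
move=> lq; rewrite (@big_cat_nat _ _ _ l) //= [X in _ * X]big_nat [X in _ * X]big1 ?muln1.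
  rewrite big_nat (eq_bigr (fun=> 2)); last by move=> x /andP[_ h]; rewrite n_ltE h.
  by rewrite -big_nat prod_nat_const_nat subn0.
by move=> x /andP[h _]; rewrite n_ltE ltnNge h.
Qed.

Lemma pMU_ok : (forall k, k < q -> A7 kMU k = mu U k) /\ forall k, k != kMU -> A7 k = A6 k.
Proof.
split; last by move=> k kk; apply: evalP_frame; rewrite inE.
rewrite /A7 /pMU evalP_For s0.
have [||_ h _] := @loop_fill q kMU id (mu U) (fun i0 A' => evalP L (Wr kMU (Var 5)
  (emin (epow (elev (Var 5)))
        (esub (Rd kU (ecol (Var 5))) (esub (epow (elev (Var 5))) (Cst 1))))) (upd s 5 i0) A') A6.
- move=> k A' kq hA' _.
  pose pw := \prod_(0 <= x < s 0) (if n_lt x (k - k %/ s 2 * s 2) != 0 then 2 else 1).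
  have -> : evalP L (Wr kMU (Var 5) (emin (epow (elev (Var 5)))
        (esub (Rd kU (ecol (Var 5))) (esub (epow (elev (Var 5))) (Cst 1))))) (upd s 5 k) A'
    = updm A' kMU k (minn (n_min pw (A' kU (k %/ s 2) - (pw - 1))) (s 1)) by [].
  have kE : k - k %/ N * N = k %% N by have := divn_eq k N; lia.
  have -> : pw = 2 ^ (k %% N).
    rewrite /pw s0 s2 kE pow_mirror //; apply: ltnW; apply: leq_trans (ltn_pmod k N0) _.
    by apply: leq_trans Nq; rewrite leq_pmulr.
  congr updm; rewrite n_minE hA' // s1 s2; apply/minn_idPl; apply: ZZcap.
  apply: leq_trans (mu_le k) _; apply: leq_trans ZN _.
  by rewrite -mulnA leq_pmulr // muln_gt0 Z1.
- by [].
- exact: h.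
Qed.

Let A8 := evalP L pSZ s A7.
Lemma pSZ_ok : (forall i k, i < q -> k < q -> A8 kSZ (i * q + k) = mu U k * aint i (k %/ N)) /\
  forall k, k != kSZ -> A8 k = A7 k.
Proof.
have [hA _] := pA_ok; have [_ hf4] := pCO_ok; have [_ hf5] := pU0_ok.
have [_ hf6] := pU1_ok; have [hM hf7] := pMU_ok.
split; last by move=> k kk; apply: evalP_frame; rewrite inE.
pose f i k A' := evalP L (Wr kSZ (eadd (emul (Var 5) xq) (Var 6))
  (emul (Rd kMU (Var 6)) (eA (Var 5) (ecol (Var 6))))) (upd (upd s 5 i) 6 k) A'.
have -> : A8 = loop (s 0) (fun i => loop (s 0) (f i)) A7 by [].
rewrite s0.
have [|_ h] := @loop2_fill q kSZ (fun i k => mu U k * aint i (k %/ N)) f A7; last exact: h.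
move=> i k A' iq kq hA'.
have -> : f i k A' = updm A' kSZ (i * s 0 + k)
  (minn (A' kMU k * A' kA (i * s 0 + k %/ s 2)) (s 1)) by [].
rewrite s0 s1 s2; congr updm.
rewrite (hA' kMU) // (hA' kA) // hM // hf7 // hf6 // hf5 // hf4 // hA //; last first.
  exact: leq_ltn_trans (leq_div _ _) kq.
apply/minn_idPl; apply: leq_trans capZ.
apply: leq_mul (aint_le _ _); apply: leq_trans (mu_le k) _; apply: leq_trans ZN _.
by rewrite -mulnA leq_pmulr // muln_gt0 Z1.
Qed.

Let A9 := evalP L pW s A8.
Lemma pW_ok : (forall k, k < q -> A9 kW k = mu U k * cint (k %/ N)) /\
  forall k, k != kW -> A9 k = A8 k.
Proof.
have [hC _] := pCO_ok; have [_ hf5] := pU0_ok.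
have [_ hf6] := pU1_ok; have [hM hf7] := pMU_ok; have [_ hf8] := pSZ_ok.
split; last by move=> k kk; apply: evalP_frame; rewrite inE.
rewrite /A9 /pW evalP_For s0.
have [||_ h _] := @loop_fill q kW id (fun k => mu U k * cint (k %/ N)) (fun i0 A' => evalP L
  (Wr kW (Var 5) (emul (Rd kMU (Var 5)) (Rd kCO (ecol (Var 5))))) (upd s 5 i0) A') A8.
- move=> k A' kq hA' _.
  have -> : evalP L (Wr kW (Var 5) (emul (Rd kMU (Var 5)) (Rd kCO (ecol (Var 5))))) (upd s 5 k) A'
    = updm A' kW k (minn (A' kMU k * A' kCO (k %/ s 2)) (s 1)) by [].
  congr updm; rewrite s1 s2 (hA' kMU) // (hA' kCO) // hf8 // hM // hf8 // hf7 // hf6 // hf5 // hC //; last first.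
    exact: leq_ltn_trans (leq_div _ _) kq.
  apply/minn_idPl; apply: leq_trans capZ.
  apply: leq_mul (cint_le _); apply: leq_trans (mu_le k) _; apply: leq_trans ZN _.
  by rewrite -mulnA leq_pmulr // muln_gt0 Z1.
- by [].
- exact: h.
Qed.

Lemma pinit_ok : exists U : nat -> nat, let A' := evalP L pinit s A0 in
  [/\ ubound_spec U /\ (forall i, i < q -> A' kB i = bint i),
      forall k, k < q -> A' kMU k = mu U k,
      forall i k, i < q -> k < q -> A' kSZ (i * q + k) = mu U k * aint i (k %/ N),
      forall k, k < q -> A' kW k = mu U k * cint (k %/ N) &
      forall k i, k \in [:: kSTK; kSEL; kOUT] -> A' k i = 0].
Proof.
exists U; cbv zeta; have -> : evalP L pinit s A0 = A9 by [].
have [hB _] := pB_ok; have [_ hf3] := pA_ok; have [_ hf4] := pCO_ok; have [_ hf5] := pU0_ok.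
have [hU hf6] := pU1_ok; have [hM hf7] := pMU_ok; have [hS hf8] := pSZ_ok; have [hW hf9] := pW_ok.
split.
- by split=> // i iq; rewrite hf9 // hf8 // hf7 // hf6 // hf5 // hf4 // hf3 // hB.
- by move=> k kq; rewrite hf9 // hf8 // hM.
- by move=> i k iq kq; rewrite hf9 // hS.
- exact: hW.
- have hfr k : k \notin wkeys pinit -> A9 k = A0 k by move=> h; exact: (@evalP_frame L pinit s A0 k h).
  by move=> k i; rewrite !inE => /or3P[] /eqP ->; rewrite hfr // A0zero.
Qed.
End Init.

(** * Binary splitting of a bounded variable, and elementary bounds *)

Lemma sum_rows N c Q (F : nat -> nat) : c * N <= Q -> (forall k, c * N <= k -> F k = 0) ->
  \sum_(0 <= k < Q) F k = \sum_(0 <= j < c) \sum_(0 <= l < N) F (j * N + l).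
Proof.
move=> cQ F0; rewrite (@big_cat_nat _ _ _ (c * N)) //= [X in _ + X]big_nat [X in _ + X]big1.
  rewrite addn0; elim: c {cQ F0} => [|c IH]; first by rewrite mul0n !big_nil.
  rewrite big_nat_recr //= -IH mulSnr (@big_cat_nat _ _ _ (c * N)) //= ?leq_addr //.
  by congr (_ + _); rewrite -{1}[c * N]add0n big_addn addKn; apply: eq_bigr => l _; rewrite addnC.
by move=> k /andP[/F0].
Qed.

(** With [t = 2 ^ N], the part at level [N] completes [minn U (t - 1)] to [minn U (2 * t - 1)]. *)
Lemma sum_parts U N :
  \sum_(0 <= l < N) minn (2 ^ l) (U - (2 ^ l - 1)) = minn U (2 ^ N - 1).
Proof.
elim: N => [|N IH]; first by rewrite big_nil subnn minn0.
rewrite big_nat_recr //= IH expnS; have : 0 < 2 ^ N by rewrite expn_gt0.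
by move: (2 ^ N) => t; lia.
Qed.

(** Greedy choice: the top part is taken exactly when the lower ones cannot reach [y]. In that case
    [y] is at least [2 ^ N], so the part does not exceed it. *)
Lemma subset_parts U N y : y <= minn U (2 ^ N - 1) -> exists s : nat -> bool,
  \sum_(0 <= l < N) s l * minn (2 ^ l) (U - (2 ^ l - 1)) = y.
Proof.
elim: N y => [|N IH] y.
  by rewrite subnn minn0 leqn0 => /eqP->; exists xpred0; rewrite big_nil.
have t0 : 0 < 2 ^ N by rewrite expn_gt0.
set p := minn (2 ^ N) (U - (2 ^ N - 1)); rewrite expnS => hy.
pose b := ~~ (y <= minn U (2 ^ N - 1)).
have [|s hs] := IH (y - b * p).
  move: hy; rewrite /b /p; case: leqP => h; rewrite ?mul0n ?mul1n; move: (2 ^ N) t0 h => t; lia.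
exists (fun l => if l == N then b else s l); rewrite big_nat_recr //= eqxx.
have -> : \sum_(0 <= l < N) (if l == N then b else s l) * minn (2 ^ l) (U - (2 ^ l - 1)) = y - b * p.
  rewrite -hs big_nat [RHS]big_nat; apply: eq_bigr => l /andP[_ lN].
  by rewrite ifF // ltn_eqF.
rewrite -/p subnK //; move: hy; rewrite /b /p; case: leqP => h; rewrite ?mul0n ?mul1n //.
by move: (2 ^ N) t0 h => t; lia.
Qed.

Lemma card_ord_lt Q t : #|[set k : 'I_Q | k < t]| <= t.
Proof.
have [tQ|Qt] := leqP t Q.
  rewrite -sum1dep_card (big_ord_narrow tQ) sum_nat_const card_ord; lia.
by apply: leq_trans (max_card _) _; rewrite card_ord ltnW.
Qed.

Lemma prod_le_pow (I : finType) (P : pred I) (F : I -> nat) M r : 0 < M ->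
  (forall i, P i -> F i <= M) -> #|P| <= r -> \prod_(i | P i) F i <= M ^ r.
Proof.
move=> M0 hF hr; apply: leq_trans (leq_prod hF) _.
by rewrite prod_nat_const leq_pexp2l.
Qed.

Lemma prod_two_le (f : nat -> nat) a b l : a < l -> b < l -> a != b ->
  f a * f b <= \prod_(0 <= i < l) (f i + 1).
Proof.
move=> al bl ab; rewrite big_mkord (bigD1 (Ordinal al)) //= (bigD1 (Ordinal bl)) /=; last first.
  by rewrite -val_eqE /= eq_sym.
rewrite mulnA; apply: leq_trans (_ : (f a + 1) * (f b + 1) <= _); first by rewrite leq_mul ?leq_addr.
by apply: leq_pmulr; apply: prodn_gt0 => i; rewrite addn1.
Qed.

Lemma bernoulli (e : rat) r : (0 <= e <= 1 -> 1 - r%:R * e <= (1 - e) ^+ r)%R.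
Proof.
move=> /andP[e0 e1]; elim: r => [|r IH]; first by rewrite mul0r subr0 expr0.
rewrite exprS; apply: le_trans (_ : (1 - e) * (1 - r%:R * e) <= _)%R; last first.
  by apply: ler_wpM2l IH; rewrite subr_ge0.
have r0 : (0 <= r%:R :> rat)%R by rewrite ler0n.
rewrite -natr1; have : (0 <= r%:R * (e * e))%R by rewrite !mulr_ge0.
by lra.
Qed.

Lemma flat_lt r c i j : i < r -> j < c -> i * c + j < r * c.
Proof.
move=> ir jc; apply: leq_trans (_ : i.+1 * c <= _); first by rewrite mulSnr ltn_add2l.
by rewrite leq_mul2r ir orbT.
Qed.

(** * The whole program: choice of the parameters and ratio on integral data *)

Section MainRun.
Variable input : seq nat.
Let L := in_L input.
Let N := in_N input.
Let q := in_q input.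
Let m := in_m input.
Let n := in_n input.
Let inp := nth 0 input.
Let cap := 2 ^ q.
Hypothesis Lin : L = 2 * (m * n + m + n + n + 1).

Local Notation ai := (aint L q m n inp).
Local Notation bi := (bint L q m n inp).
Local Notation ci := (cint L q m n inp).

Hypothesis sparse : forall j, #|[set i : 'I_q | ai i j != 0]| <= 2.
Hypothesis Aden : forall i j, i < m -> j < n -> 0 < inp (3 + 2 * (i * n + j)).
Hypothesis bden : forall i, i < m -> 0 < inp (o_b m n + (2 * i + 1)).

Lemma in_N_ge100 : 100 <= N. Proof. by rewrite /N /in_N leq_addl. Qed.
Lemma in_L_le_N : L <= N. Proof. by rewrite /N /in_N -addnA addnCA leq_addr. Qed.
Lemma in_m_le_L : m < L. Proof. rewrite Lin; set t := m * n; lia. Qed.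
Lemma in_n_lt_L : n < L. Proof. rewrite Lin; set t := m * n; lia. Qed.
Lemma in_qE : q = N ^ 16. Proof. by []. Qed.
Let N0 : 0 < N. Proof. by apply: leq_trans in_N_ge100. Qed.
Let Npow a c e : 0 < c -> a <= 100 ^ c -> a * N ^ e <= N ^ (c + e).
Proof.
move=> c0 h; rewrite expnD leq_mul2r; apply/orP; right; apply: leq_trans h _.
by rewrite leq_exp2r // in_N_ge100.
Qed.
Let Nle2 c : N ^ c <= 2 ^ (N * c).
Proof. by rewrite expnM; case: c => // c; rewrite leq_exp2r // ltnW // ltn_expl. Qed.
Let Nexp e : e <= 16 -> N ^ e <= q.
Proof. by move=> h; rewrite in_qE leq_pexp2l. Qed.
Let Nlin c : c <= 100 -> N * c <= q.
Proof.
move=> h; apply: leq_trans (Nexp (_ : 2 <= 16)) => //; rewrite expnS expn1 leq_mul2l.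
by rewrite (leq_trans h in_N_ge100) orbT.
Qed.

Local Notation Z := (2 ^ N).

(** With at most [N ^ 2] items and [N] rows, the steps required are at most [1600 * N ^ 14], and
    [1600 <= N ^ 2]: hence the exponent 16 of [in_q]. *)
Lemma rounds_suffice t : t <= N -> 200 * (N ^ 2) ^ 4 * (t + N ^ 2 + 1) ^ 3 <= q.
Proof.
move=> tN; apply: leq_trans (_ : 200 * (N ^ 2) ^ 4 * (2 * N ^ 2) ^ 3 <= _).
  rewrite leq_mul2l leq_exp2r //; apply/orP; right.
  rewrite mul2n -addnn addnAC leq_add2r expnS expn1.
  have := in_N_ge100; move: (N) tN => x; nia.
have -> : 200 * (N ^ 2) ^ 4 * (2 * N ^ 2) ^ 3 = 1600 * N ^ 14.
  rewrite expnMn -!expnM mulnACA -expnD; congr (_ * _).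
by apply: leq_trans (@Npow 1600 2 14 _ _) _.
Qed.

Lemma cap_mwu : 100 * q ^ 4 <= cap.
Proof.
rewrite in_qE -expnM; apply: leq_trans (@Npow _ 1 _ _ _) _ => //.
by apply: leq_trans (Nle2 _) _; rewrite /cap leq_exp2l // Nlin.
Qed.

Lemma cap_init : Z * Z * q * (Z * Z) <= cap.
Proof.
rewrite -!expnD; apply: leq_trans (_ : 2 ^ (N + N) * 2 ^ (N * 16) * 2 ^ (N + N) <= _).
  by rewrite leq_mul2r leq_mul2l; apply/orP; right; apply/orP; right; apply: Nle2.
rewrite -!expnD /cap leq_exp2l //; apply: leq_trans (Nlin (_ : 20 <= 100)) => //; lia.
Qed.

(** Weights start at most [Z ^ 3], and a pick multiplies them by a [denprod] of at most two factors
    [Z * Z]. Over [N ^ 2] rounds, with one more factor for the products formed in a round and with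
    [q], this makes [4 * N ^ 3 + 23 * N] bits, at most [27 * N ^ 3]. *)
Lemma cap_run : Z * Z * Z * ((Z * Z) ^ 2) ^ (N ^ 2).+1 * q <= cap.
Proof.
apply: leq_trans (_ : Z * Z * Z * ((Z * Z) ^ 2) ^ (N ^ 2).+1 * 2 ^ (N * 16) <= _).
  by rewrite leq_mul2l; apply/orP; right; apply: Nle2.
rewrite -!expnD -!expnM -!expnD /cap leq_exp2l //.
apply: leq_trans (Nexp (_ : 5 <= 16)) => //; apply: leq_trans (@Npow 27 2 3 _ _) => //.
by rewrite !expnS expn0 !muln1; move: (N) N0 => x; nia.
Qed.

Lemma in_q_le_cap : q <= cap. Proof. exact: ltnW (ltn_expl _ _). Qed.

Lemma ginE a : gin L inp a = inp a.
Proof. by rewrite /gin; case: (leqP a L) => // h; rewrite /inp !nth_default // ltnW. Qed.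

Lemma gin_lt a : gin L inp a < Z. Proof. by rewrite ginE; apply: input_lt. Qed.

Lemma prod_input_lt : \prod_(0 <= a < L) (inp a + 1) < Z.
Proof.
apply: leq_trans (nbits_lt _) _; rewrite leq_exp2l // /N /in_N -/L -/inp.
by rewrite -addnA leq_addr.
Qed.

Lemma delta_gt0 : 0 < delta L q inp.
Proof. by apply: prodn_gt0 => a; case: ifP => //; rewrite lt0n. Qed.

Lemma delta_lt : delta L q inp < Z.
Proof.
apply: leq_ltn_trans prod_input_lt; rewrite /delta (@big_cat_nat _ _ _ L) //=; last first.
  exact: leq_trans in_L_le_N (in_N_le_q _).
rewrite [X in _ * X]big_nat [X in _ * X]big1 ?muln1.
  by apply: leq_prod => a _; rewrite ginE; case: ifP => //; lia.
by move=> a /andP[h _]; rewrite ginE /inp nth_default.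
Qed.

Lemma dvd_delta a : a < q -> inp a != 0 -> inp a %| delta L q inp.
Proof.
move=> aq ha; rewrite /delta (bigD1_seq a) ?iota_uniq ?mem_index_iota //=.
by rewrite ginE ha dvdn_mulr.
Qed.

Lemma cell_A i j : i < m -> j < n -> 3 + 2 * (i * n + j) < L.
Proof. by rewrite Lin => im jn; have := flat_lt im jn; lia. Qed.
Lemma cell_b i : i < m -> o_b m n + (2 * i + 1) < L.
Proof. by rewrite Lin /o_b => im; set t := m * n; lia. Qed.

Let Lq : L <= q. Proof. exact: leq_trans in_L_le_N (in_N_le_q _). Qed.
Let nq : n < q. Proof. exact: leq_trans in_n_lt_L Lq. Qed.
Let mq : m < q. Proof. exact: leq_trans in_m_le_L Lq. Qed.

(* The quotient of two entries is at most the product of a numerator and a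
   denominator, that is, of two distinct cells of the input. *)
Lemma ratio_lt u i j : i < m -> j < n -> ai i j != 0 -> u * ai i j <= bi i -> u < Z.
Proof.
move=> im jn; rewrite /aint /bint im jn /= /ratint !ginE.
set An := inp (2 + 2 * _); set Ad := inp (3 + _); set bn := inp (o_b m n + 2 * i).
set bd := inp (o_b m n + (2 * i + 1)); set D := delta _ _ _ => a0 hu.
have Ad0 : 0 < Ad by apply: Aden.
have bd0 : 0 < bd by apply: bden.
have dA : Ad %| D by apply: dvd_delta; [exact: leq_trans (cell_A im jn) Lq|rewrite -lt0n].
have db : bd %| D by apply: dvd_delta; [exact: leq_trans (cell_b im) Lq|rewrite -lt0n].
have D0 : 0 < D by apply: delta_gt0.
have An0 : 0 < An by move: a0; rewrite muln_eq0 negb_or lt0n => /andP[].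
apply: leq_ltn_trans prod_input_lt; apply: leq_trans (_ : bn * Ad <= _); last first.
  apply: prod_two_le; [|exact: cell_A|].
    by apply: leq_trans (cell_b im); rewrite addn1 addnS.
  by rewrite /o_b; have := flat_lt im jn; clear; lia.
have : u * An * bd * D <= bn * Ad * D.
  have -> : u * An * bd * D = u * (An * (D %/ Ad)) * (Ad * bd) by rewrite -{1}(divnK dA); lia.
  have -> : bn * Ad * D = bn * (D %/ bd) * (Ad * bd) by rewrite -{1}(divnK db); lia.
  by rewrite leq_mul2r hu orbT.
rewrite leq_pmul2r // => h; apply: leq_trans h; rewrite -mulnA leq_pmulr //.
by rewrite muln_gt0 An0.
Qed.

Lemma aint_out i j : ~~ ((i < m) && (j < n)) -> ai i j = 0.
Proof. by rewrite /aint => /negbTE->. Qed.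

(** Ensures that [N] binary parts represent every value of a variable. For an infinite [d] the sum
    of the [b i] is too crude a bound, and [ratio_lt] takes over. *)
Lemma ubound_lt U j : ubound_spec L q m n inp U -> j < q -> U j < Z.
Proof.
move=> hU jq; have := us_le0 hU jq; rewrite /ubound0.
case: ifP => jn; last by rewrite leqn0 => /eqP->; rewrite expn_gt0.
case: ifP => _; first by move/leq_ltn_trans; apply; apply: gin_lt.
case: ifP; last by rewrite leqn0 => _ /eqP->; rewrite expn_gt0.
rewrite sum_nat_seq_neq0 => /hasP[i]; rewrite mem_index_iota /= => iq a0 _.
have im : i < m by case: (ltnP i m) => // h; rewrite aint_out ?ltnNge ?h ?andbF in a0.
apply: (ratio_lt im jn a0); apply: leq_trans (leq_trunc_div _ (ai i j)).
by rewrite leq_mul2r; apply/orP; right; apply: (us_le hU).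
Qed.

Lemma mu_le_ubound U k : mu N U k <= U (k %/ N).
Proof. exact: leq_trans (geq_minr _ _) (leq_subr _ _). Qed.

Lemma cint_out j : n <= j -> ci j = 0.
Proof. by rewrite /cint ltnNge => ->. Qed.

Let NNq : N ^ 2 <= q. Proof. exact: Nexp. Qed.
Let nN : n <= N. Proof. exact: leq_trans (ltnW in_n_lt_L) in_L_le_N. Qed.
Let nNq : n * N <= q.
Proof. by apply: leq_trans NNq; rewrite expnS expn1 leq_mul2r nN orbT. Qed.
Let rowq k : k < q -> k %/ N < q. Proof. exact: leq_ltn_trans (leq_div _ _). Qed.
Let row_cell j l : l < N -> (j * N + l) %/ N = j.
Proof. by move=> lN; rewrite divnMDl // divn_small // addn0. Qed.

Lemma sum_cells (F : nat -> nat) (G : nat -> nat) : (forall j, n <= j -> G j = 0) ->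
  \sum_(0 <= k < q) F k * G (k %/ N) =
  \sum_(0 <= j < n) G j * \sum_(0 <= l < N) F (j * N + l).
Proof.
move=> G0; rewrite (sum_rows nNq); last by move=> k h; rewrite G0 ?muln0 // leq_divRL.
apply: eq_bigr => j _; rewrite big_distrr /= big_nat [RHS]big_nat; apply: eq_bigr => l /andP[_ lN].
by rewrite row_cell // mulnC.
Qed.

Lemma output_ok s A : s 0 = q -> s 1 = cap -> s 2 = N -> s 4 = n ->
  (forall j, j < n -> \sum_(0 <= k < q) (if k %/ N == j then A kSEL k * A kMU k else 0) <= cap) ->
  forall j, j < n -> evalP L (PSeq pOUT pfin) s A 0 j =
    \sum_(0 <= k < q) (if k %/ N == j then A kSEL k * A kMU k else 0).
Proof.
move=> s0 s1 s2 s4 hcap.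
pose v j := minn (\sum_(0 <= k < q) (if k %/ N == j then A kSEL k * A kMU k else 0)) cap.
have hO j : j < q -> evalP L pOUT s A kOUT j = v j.
  rewrite /pOUT evalP_For s0.
  have [||_ h _] := @loop_fill q kOUT id v (fun i0 A' => evalP L (Wr kOUT (Var 5)
    (Big BSum 22 (Ite (eeq (ecol (Var 22)) (Var 5)) (emul (Rd kSEL (Var 22)) (Rd kMU (Var 22)))
      (Cst 0)))) (upd s 5 i0) A') A.
  - move=> i A' iq hA' _.
    have -> : evalP L (Wr kOUT (Var 5) (Big BSum 22 (Ite (eeq (ecol (Var 22)) (Var 5))
        (emul (Rd kSEL (Var 22)) (Rd kMU (Var 22))) (Cst 0)))) (upd s 5 i) A'
      = updm A' kOUT i (minn (\sum_(0 <= k < s 0)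
          (if n_eq (k %/ s 2) i != 0 then A' kSEL k * A' kMU k else 0)) (s 1)) by [].
    rewrite s0 s1 s2 (hA' kSEL) // (hA' kMU) //; congr (updm _ _ _ (minn _ _)).
    by apply: eq_bigr => k _; rewrite n_eqE; case: (k %/ N == i).
  - by [].
  - exact: h.
set B := evalP L pOUT s A in hO.
pose P t (A' : memory) := A' kOUT = B kOUT /\ forall j, t <= j < n -> A' 0 j = v j.
have : P 0 (evalP L pfin s B).
  rewrite /pfin evalP_For s0; apply: loop_inv; first by split=> // j; have := nq; lia.
  move=> t A' tq [h1 h2].
  have -> : evalP L (Wr 0 (Ite (elt (Var 5) xn) (Var 5) xcap) (Rd kOUT (Var 5))) (upd s 5 t) A'
    = updm A' 0 (minn (if n_lt t (s 4) != 0 then t else s 1) L) (minn (A' kOUT t) (s 1)) by [].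
  split=> // j hj; rewrite s1 s4 n_ltE h1 hO //.
  have nL := in_n_lt_L; have [tn|nt] := ltnP t n.
    rewrite (_ : minn _ L = t); last by rewrite /=; apply/minn_idPl; lia.
    case: (eqVneq j t) => [->|jt]; first by rewrite updm_eq /v -minnA minnn.
    rewrite updm_neq //; apply: h2; lia.
  rewrite (_ : minn _ L = L); last first.
    by rewrite /=; apply/minn_idPr; apply: leq_trans Lq in_q_le_cap.
  rewrite updm_neq; first by apply: h2; lia.
  by apply/eqP; lia.
case=> _ h j jn; rewrite evalP_Seq -/B h //.
by apply/minn_idPl; apply: hcap.
Qed.

Lemma main_prog_ok : exists2 U, ubound_spec L q m n inp U &
  let x := evalP L main_prog (env0 input) (mem0 input) 0 in
  [/\ forall j, j < n -> x j <= U j,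
      forall i, i < m -> \sum_(0 <= j < n) ai i j * x j <= bi i &
      forall y, (forall j, j < n -> y j <= U j) ->
        (forall i, i < m -> \sum_(0 <= j < n) ai i j * y j <= bi i) ->
        4 * \sum_(0 <= j < n) ci j * y j <= 15 * \sum_(0 <= j < n) ci j * x j].
Proof.
set s := env0 input.
have zz k i : k != 0 -> mem0 input k i = 0 by move=> /negbTE h; rewrite /mem0 h.
have [U] := @pinit_ok L q cap N m n inp s (mem0 input) erefl erefl erefl erefl erefl erefl zz
  N0 NNq Z (leqnn _) (ltnW delta_lt) (fun a => ltnW (gin_lt a)) cap_init.
set A1 := evalP L pinit s (mem0 input) => -[[hU hB] hMU hSZ hW hz].
exists U => //.
pose R0 := active (ofw q (A1 kW)); pose Irel := [set i : 'I_q | i < m].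
pose sz i k := A1 kSZ (i * q + k).
have szE i k : i < q -> k < q -> sz i k = mu N U k * ai i (k %/ N) by exact: hSZ.
have hR0 (k : 'I_q) : k \in R0 -> k %/ N < n.
  rewrite inE ffunE hW //; case: (ltnP (k %/ N) n) => // h.
  by rewrite cint_out // muln0.
have Hfit k : k \in R0 -> fits (@osz q sz) (@obv q (A1 kB)) k.
  move=> kR i; rewrite /osz /obv szE // hB //.
  have [->|a0] := eqVneq (ai i (k %/ N)) 0; first by rewrite muln0.
  apply: leq_trans (leq_trunc_div _ (ai i (k %/ N))); rewrite leq_mul2r; apply/orP; right.
  by apply: leq_trans (mu_le_ubound U k) _; apply: (us_le hU) => //; apply: rowq.
have Hends k : k \in R0 -> #|ends (@osz q sz) k| <= 2.
  move=> kR; apply: leq_trans (sparse (k %/ N)); apply: subset_leq_card; apply/subsetP => i.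
  by rewrite !inE /osz szE // muln_eq0 negb_or => /andP[].
have Hrel (i k : 'I_q) : k \in R0 -> i \notin Irel -> @osz q sz i k = 0.
  by move=> kR; rewrite inE /osz szE // => /negbTE im; rewrite aint_out ?muln0 // im.
have Hn : #|R0| <= N ^ 2.
  apply: leq_trans (card_ord_lt q _); apply: subset_leq_card; apply/subsetP => k /hR0 kn.
  by rewrite inE expnS expn1 -ltn_divLR // (leq_trans kn nN).
have N20 : 0 < N ^ 2 by rewrite expn_gt0 N0.
have HT : 200 * (N ^ 2) ^ 4 * (#|Irel| + N ^ 2 + 1) ^ 3 <= q.
  apply: rounds_suffice; apply: leq_trans (card_ord_lt q m) _.
  exact: leq_trans (ltnW in_m_le_L) in_L_le_N.
have hbZ i : bi i <= Z * Z by apply: bint_le => [|a]; rewrite ltnW // ?delta_lt ?gin_lt.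
have hcZ j : ci j <= Z * Z by apply: cint_le => [|a]; rewrite ltnW // ?delta_lt ?gin_lt.
have Z0 : 0 < Z by rewrite expn_gt0.
have muZ k : k < q -> mu N U k < Z.
  by move=> kq; apply: leq_ltn_trans (mu_le_ubound U k) _; apply: ubound_lt => //; apply: rowq.
have HPm e : e \in R0 -> denprod (@osz q sz) (@obv q (A1 kB)) e <= (Z * Z) ^ 2.
  move=> eR; apply: prod_le_pow; first by rewrite muln_gt0 Z0.
    move=> i _; rewrite /den /obv hB // geq_max muln_gt0 Z0 /=.
    exact: leq_trans (leq_subr _ _) (hbZ i).
  by have := Hends e eR; rewrite /ends cardsE.
have Pm0 : 0 < (Z * Z) ^ 2 by rewrite expn_gt0 muln_gt0 Z0.
have HW0 k : k < q -> A1 kW k <= Z * Z * Z.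
  by move=> kq; rewrite hW // -mulnA leq_mul // ltnW // muZ.
have [wseq [w_top w_bot w_step]] := @rounds_ok L q cap (N ^ 2) (A1 kSZ) (A1 kB) R0 Irel Hfit Hends
  Hrel Hn N20 HT cap_mwu (Z * Z * Z) ((Z * Z) ^ 2) HPm Pm0 cap_run s A1 (conj erefl erefl)
  (conj erefl erefl) (subxx _) HW0.
set A2 := evalP L (For 5 pround) s A1 in w_step.
have fr2 k : k \notin wkeys (For 5 pround) -> A2 k = A1 k by exact: evalP_frame.
have sel0 k : k < q -> A2 kSEL k = 0 by move=> _; rewrite fr2 // hz.
have [S hS hSEL] := @inserts_ok L q cap (N ^ 2) (A1 kSZ) (A1 kB) R0 Irel Hn N20 HT cap_mwu
  (Z * Z * Z) ((Z * Z) ^ 2) Pm0 cap_run s A2 wseq (conj erefl erefl)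
  (conj (fr2 kSZ isT) (fr2 kB isT)) sel0 w_bot w_step.
set A3 := evalP L (For 5 pinsert) s A2 in hSEL.
have hMU3 k : k < q -> A3 kMU k = mu N U k.
  by move=> kq; rewrite /A3 (@evalP_frame L (For 5 pinsert) s A2 kMU) // fr2 // hMU.
pose X j := \sum_(0 <= l < N) A3 kSEL (j * N + l) * mu N U (j * N + l).
have mu_cell j l : l < N -> mu N U (j * N + l) = minn (2 ^ l) (U j - (2 ^ l - 1)).
  by move=> lN; rewrite /mu row_cell // modnMDl modn_small.
have cellq j l : j < n -> l < N -> j * N + l < q.
  by move=> jn lN; apply: leq_trans (flat_lt jn lN) nNq.
have XU j : j < n -> X j <= U j.
  move=> jn; apply: leq_trans (geq_minl (U j) (2 ^ N - 1)); rewrite -sum_parts.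
  rewrite /X big_nat [leqRHS]big_nat; apply: leq_sum => l /andP[_ lN].
  rewrite mu_cell // -[leqRHS]mul1n leq_mul2r; apply/orP; right.
  by rewrite (hSEL (Ordinal (cellq _ _ jn lN))); case: (_ \in _).
have outX j : j < n ->
    \sum_(0 <= k < q) (if k %/ N == j then A3 kSEL k * A3 kMU k else 0) = X j.
  move=> jn; transitivity (\sum_(0 <= k < q) (A3 kSEL k * mu N U k) * (k %/ N == j)).
    rewrite big_nat [RHS]big_nat; apply: eq_bigr => k /andP[_ kq]; rewrite hMU3 //.
    by case: (_ == j); rewrite ?muln1 ?muln0.
  rewrite (@sum_cells (fun k => A3 kSEL k * mu N U k) (fun j' => j' == j)); last first.
    by move=> j' h; rewrite gtn_eqF // (leq_trans jn h).
  rewrite (bigD1_seq j) ?iota_uniq ?mem_index_iota //= eqxx mul1n [Y in _ + Y]big1 ?addn0 //.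
  by move=> j' /negbTE->.
set x := evalP L main_prog s (mem0 input) 0.
have xX j : j < n -> x j = X j.
  move=> jn; rewrite /x /main_prog.
  rewrite (_ : evalP L _ s (mem0 input) = evalP L (PSeq pOUT pfin) s A3) //.
  rewrite output_ok // ?outX // => j' jn'; rewrite outX //; apply: leq_trans (XU _ jn') _.
  apply: ltnW; apply: leq_trans (ubound_lt hU (ltn_trans jn' nq)) _.
  by rewrite leq_exp2l // in_N_le_q.
have sumS (G : nat -> nat) : (forall j, n <= j -> G j = 0) ->
    \sum_(k in S) mu N U k * G (k %/ N) = \sum_(0 <= j < n) G j * x j.
  move=> G0; transitivity (\sum_(0 <= k < q) (A3 kSEL k * mu N U k) * G (k %/ N)).
    rewrite big_mkcond [RHS]big_mkord; apply: eq_bigr => k _; rewrite hSEL.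
    by case: (k \in S); rewrite ?mul1n.
  rewrite (@sum_cells (fun k => A3 kSEL k * mu N U k)) //.
  by rewrite big_nat [RHS]big_nat; apply: eq_bigr => j /andP[_ jn]; rewrite xX.
split=> [j jn|i im|y yU yb]; first by rewrite xX // XU.
  have iq : i < q := ltn_trans im mq.
  have := solved_feasible (Ordinal iq) hS; rewrite /obv /= hB //; apply: leq_trans.
  rewrite -(sumS (ai i)); last by move=> j h; rewrite aint_out // [j < n]ltnNge h andbF.
  by apply: leq_sum => k _; rewrite /osz /= hSZ.
(* Each coordinate of the competitor is a subset sum of the parts of its variable, which turns it
   into a 0-1 solution over the items. *)
have /fin_all_exists[f hf] (j : 'I_n) : exists g : nat -> bool,
    \sum_(0 <= l < N) g l * minn (2 ^ l) (U j - (2 ^ l - 1)) = y j.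
  apply: subset_parts; rewrite leq_min yU //=.
  apply: leq_trans (yU j _) _ => //.
  by have := ubound_lt hU (ltn_trans (ltn_ord j) nq); lia.
pose zb k := oapp (fun j => f j (k %% N)) false (insub (k %/ N) : option 'I_n).
have sumy (G : nat -> nat) : (forall j, n <= j -> G j = 0) ->
    \sum_(0 <= k < q) (zb k * mu N U k) * G (k %/ N) = \sum_(0 <= j < n) G j * y j.
  move=> G0; rewrite (@sum_cells (fun k => zb k * mu N U k)) //.
  rewrite big_nat [RHS]big_nat; apply: eq_bigr => j /andP[_ jn]; congr (_ * _).
  rewrite -(hf (Ordinal jn)) big_nat [RHS]big_nat; apply: eq_bigr => l /andP[_ lN].
  by rewrite mu_cell // /zb row_cell // modnMDl modn_small // insubT.
(* Restricting to the initially active items costs no value, the others having weight 0. *)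
pose z (k : 'I_q) : rat := (zb k && (k \in R0))%:R%R.
have zF : frac_feasible (@osz q sz) (@obv q (A1 kB)) R0 z.
  split=> [k|k|k /negbTE kR|i]; rewrite /z ?kR ?andbF ?ler0n //; first by case: (_ && _).
  rewrite /load /obv hB //.
  rewrite (eq_bigr (fun k : 'I_q => (sz i k * (zb k && (k \in R0)))%:R : rat)%R); last first.
    by move=> k _; rewrite natrM.
  rewrite -natr_sum ler_nat.
  apply: leq_trans (_ : \sum_(0 <= k < q) (zb k * mu N U k) * ai i (k %/ N) <= _).
    rewrite [leqRHS]big_mkord; apply: leq_sum => k _; rewrite szE //.
    by case: (zb k); case: (_ \in _); rewrite ?muln0 ?muln1 ?mul1n.
  rewrite sumy; last by move=> j h; rewrite aint_out // [j < n]ltnNge h andbF.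
  have [im|mi] := ltnP i m; first exact: yb.
  by rewrite big1 // => j _; rewrite aint_out ?mul0n // ltnNge mi.
have n0 : (0 < (N ^ 2)%:R :> rat)%R by rewrite ltr0n.
have eta1 : (0 <= (5 * (N ^ 2)%:R : rat)^-1 <= 1)%R.
  rewrite invr_ge0 mulr_ge0 ?(ltW n0) //= invf_le1 ?mulr_gt0 //.
  have : (1 <= (N ^ 2)%:R :> rat)%R by rewrite ler1n.
  by lra.
have acR : active (wseq q) = R0 by rewrite w_top.
have := @solved_ratio _ _ _ _ _ _ _ eta1 hS _ (N ^ 2) z; rewrite acR => /(_ Hfit Hn zF).
have -> : (\sum_k (wseq q k)%:R * z k = (\sum_(0 <= j < n) ci j * y j)%:R)%R.
  rewrite -(sumy ci cint_out) big_mkord natr_sum; apply: eq_bigr => k _.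
  rewrite /z w_top inE ffunE hW // -natrM; congr (_%:R)%R.
  case: (eqVneq (mu N U k * ci (k %/ N)) 0) => [E|_]; first by rewrite E mul0n -mulnA E muln0.
  by rewrite andbT mulnC mulnA.
have -> : weight (wseq q) S = \sum_(0 <= j < n) ci j * x j.
  rewrite -(sumS ci cint_out) /weight; apply: eq_bigr => k _.
  by rewrite w_top ffunE hW.
set Y := \sum_(0 <= j < n) ci j * y j; set V := \sum_(0 <= j < n) ci j * x j.
(* At most [N ^ 2] rounds lose a fraction [1 / (5 * N ^ 2)] each, so a factor 4/5 remains. *)
have := bernoulli (N ^ 2) eta1.
have -> : (1 - (N ^ 2)%:R * (5 * (N ^ 2)%:R)^-1 = 4 / 5 :> rat)%R.
  by rewrite invfM mulrCA divff ?mulr1 ?gt_eqF //; lra.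
move=> hb hr; have : (4 / 5 * Y%:R <= 3 * V%:R :> rat)%R.
  by apply: le_trans hr; apply: ler_wpM2r hb; rewrite ler0n.
by move=> h; rewrite -(ler_nat rat) !natrM; lra.
Qed.
End MainRun.

(** * Encoded programs *)

Lemma nth_flatten_const (T : Type) (x0 : T) c (s : seq (seq T)) i t :
  all (fun r => size r == c) s -> t < c ->
  nth x0 (flatten s) (i * c + t) = nth x0 (nth [::] s i) t.
Proof.
move=> hs tc; elim: s i hs => [|r s IH] i /=; first by rewrite !nth_nil.
case/andP=> /eqP rc /IH{}IH; rewrite nth_cat rc; case: i => [|i]; first by rewrite mul0n tc.
by rewrite mulSn -addnA ltnNge leq_addr /= addKn IH.
Qed.

Lemma size_flatten_const (T : Type) c (s : seq (seq T)) :
  all (fun r => size r == c) s -> size (flatten s) = size s * c.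
Proof. by elim: s => //= r s IH /andP[/eqP rc /IH]; rewrite size_cat rc mulSn => ->. Qed.

Lemma size_encode_bound u : size (encode_bound u) = 2. Proof. by case: u. Qed.

Lemma scaled_rat (r : rat) D : (0 <= r)%R -> `|denq r|%N %| D ->
  ((`|numq r| * (D %/ `|denq r|))%N%:R = D%:R * r :> rat)%R.
Proof.
move=> r0 dD; have d0 : (0 < `|denq r|)%N by rewrite absz_gt0 denq_eq0.
have dE : ((`|denq r|%N)%:R = (denq r)%:~R :> rat)%R.
  by rewrite [LHS]pmulrn; congr (_%:~R)%R; rewrite gez0_abs // denq_ge0.
have nE : ((`|numq r|%N)%:R = (numq r)%:~R :> rat)%R.
  by rewrite [LHS]pmulrn; congr (_%:~R)%R; rewrite gez0_abs // numq_ge0.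
by rewrite -[in RHS](divnK dD) !natrM dE nE numqE; ring.
Qed.

Section Encode.
Variables (m n : nat) (P : pip m n).
Let e := encode P.
Let FA := flatten [seq encode_rat (pip_A P i j) | i <- enum 'I_m, j <- enum 'I_n].
Let Fb := flatten [seq encode_rat (pip_b P i 0%R) | i <- enum 'I_m].
Let Fc := flatten [seq encode_rat (pip_c P 0%R j) | j <- enum 'I_n].
Let Fd := flatten [seq encode_bound (pip_d P j) | j <- enum 'I_n].

Let sA : all (fun r => size r == 2) [seq encode_rat (pip_A P i j) | i <- enum 'I_m, j <- enum 'I_n].
Proof. by apply/allP => r /allpairsP[[i j] [_ _ ->]]. Qed.
Let sb : all (fun r => size r == 2) [seq encode_rat (pip_b P i 0%R) | i <- enum 'I_m].
Proof. by apply/allP => r /mapP[i _ ->]. Qed.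
Let sc : all (fun r => size r == 2) [seq encode_rat (pip_c P 0%R j) | j <- enum 'I_n].
Proof. by apply/allP => r /mapP[i _ ->]. Qed.
Let sd : all (fun r => size r == 2) [seq encode_bound (pip_d P j) | j <- enum 'I_n].
Proof. by apply/allP => r /mapP[i _ ->]; rewrite size_encode_bound. Qed.

Let szA : size FA = m * n * 2.
Proof. by rewrite /FA (size_flatten_const sA) size_allpairs !size_enum_ord. Qed.
Let szb : size Fb = m * 2.
Proof. by rewrite /Fb (size_flatten_const sb) size_map size_enum_ord. Qed.
Let szc : size Fc = n * 2.
Proof. by rewrite /Fc (size_flatten_const sc) size_map size_enum_ord. Qed.
Let szd : size Fd = n * 2.
Proof. by rewrite /Fd (size_flatten_const sd) size_map size_enum_ord. Qed.

Lemma size_encode : in_L e = 2 * (in_m e * in_n e + in_m e + in_n e + in_n e + 1).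
Proof.
rewrite /in_L /e /encode /= -/FA -/Fb -/Fc -/Fd !size_cat szA szb szc szd /in_m /in_n /=; lia.
Qed.

Lemma encode_A (i : 'I_m) (j : 'I_n) t : t < 2 ->
  nth 0 e (2 + (2 * (i * n + j) + t)) = nth 0 (encode_rat (pip_A P i j)) t.
Proof.
move=> t2; rewrite /e /encode [LHS]/= -/FA nth_cat szA.
have := flat_lt (ltn_ord i) (ltn_ord j) => h.
rewrite ifT; last by move: h; clear -t2; lia.
rewrite [2 * _]mulnC (nth_flatten_const _ _ sA) //; congr nth.
rewrite nth_flatten_const //; last by apply/allP => r /mapP[k _ ->]; rewrite size_map size_enum_ord.
rewrite (nth_map i) ?size_enum_ord // (nth_map j) ?size_enum_ord //.
by rewrite !nth_ord_enum.
Qed.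

Lemma encode_b (i : 'I_m) t : t < 2 ->
  nth 0 e (o_b m n + (2 * i + t)) = nth 0 (encode_rat (pip_b P i 0%R)) t.
Proof.
move=> t2; rewrite /e /encode /o_b [LHS]/= -/FA -/Fb nth_cat szA ltnNge.
rewrite (_ : m * n * 2 <= _) /=; last by lia.
rewrite (_ : _ - _ = i * 2 + t); last by lia.
have := ltn_ord i; rewrite nth_cat szb => h; rewrite ifT; last by lia.
by rewrite (nth_flatten_const _ _ sb) // (nth_map i) ?size_enum_ord // nth_ord_enum.
Qed.

Lemma encode_c (j : 'I_n) t : t < 2 ->
  nth 0 e (o_c m n + (2 * j + t)) = nth 0 (encode_rat (pip_c P 0%R j)) t.
Proof.
move=> t2; rewrite /e /encode /o_c /o_b [LHS]/= -/FA -/Fb -/Fc nth_cat szA ltnNge.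
rewrite (_ : m * n * 2 <= _) /=; last by lia.
rewrite nth_cat szb ltnNge (_ : m * 2 <= _) /=; last by lia.
rewrite (_ : _ - _ = j * 2 + t); last by lia.
have := ltn_ord j; rewrite nth_cat szc => h; rewrite ifT; last by lia.
by rewrite (nth_flatten_const _ _ sc) // (nth_map j) ?size_enum_ord // nth_ord_enum.
Qed.

Lemma encode_d (j : 'I_n) t : t < 2 ->
  nth 0 e (o_d m n + (2 * j + t)) = nth 0 (encode_bound (pip_d P j)) t.
Proof.
move=> t2; rewrite /e /encode /o_d /o_c /o_b [LHS]/= -/FA -/Fb -/Fc -/Fd nth_cat szA ltnNge.
rewrite (_ : m * n * 2 <= _) /=; last by lia.
rewrite nth_cat szb ltnNge (_ : m * 2 <= _) /=; last by lia.
rewrite nth_cat szc ltnNge (_ : n * 2 <= _) /=; last by lia.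
rewrite (_ : _ - _ = j * 2 + t); last by lia.
by rewrite (nth_flatten_const _ _ sd) // (nth_map j) ?size_enum_ord // nth_ord_enum.
Qed.

Local Notation L := (in_L e).
Local Notation q := (in_q e).
Local Notation ai := (aint L q m n (nth 0 e)).
Local Notation bi := (bint L q m n (nth 0 e)).
Local Notation ci := (cint L q m n (nth 0 e)).
Local Notation D := (delta L q (nth 0 e)).

Let Lq : L <= q.
Proof. exact: leq_trans (in_L_le_N e) (in_N_le_q e). Qed.

Lemma denq_dvd_delta (r : rat) a : nth 0 e a = `|denq r|%N -> `|denq r|%N %| D.
Proof.
move=> E; have d0 : nth 0 e a != 0 by rewrite E absz_eq0 denq_eq0.
rewrite -E; apply: dvd_delta => //; apply: leq_trans Lq.
by rewrite ltnNge; apply: contra d0 => h; rewrite nth_default.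
Qed.

Lemma aintE (i : 'I_m) (j : 'I_n) : ((ai i j)%:R = D%:R * pip_A P i j)%R.
Proof.
rewrite /aint ifT ?ltn_ord // !ginE (_ : 3 + _ = 2 + (2 * (i * n + j) + 1)); last by lia.
rewrite -{1}[2 * _]addn0 !(encode_A i j) //.
by apply: scaled_rat; [exact: pip_A_ge0|apply: denq_dvd_delta (encode_A i j (isT : 1 < 2))].
Qed.

Lemma bintE (i : 'I_m) : ((bi i)%:R = D%:R * pip_b P i 0)%R.
Proof.
rewrite /bint ltn_ord /ratint !ginE -{1}[2 * i]addn0 !(encode_b i) //.
by apply: scaled_rat; [exact: pip_b_ge0|apply: denq_dvd_delta (encode_b i (isT : 1 < 2))].
Qed.

Lemma cintE (j : 'I_n) : ((ci j)%:R = D%:R * pip_c P 0 j)%R.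
Proof.
rewrite /cint ltn_ord /ratint !ginE -{1}[2 * j]addn0 !(encode_c j) //.
by apply: scaled_rat; [exact: pip_c_ge0|apply: denq_dvd_delta (encode_c j (isT : 1 < 2))].
Qed.

Let D0 : (0 < D%:R :> rat)%R. Proof. by rewrite ltr0n delta_gt0. Qed.

Definition vec (y : nat -> nat) : 'cV[int]_n := (\col_j (y j)%:Z)%R.

Lemma scaled_load y i :
  (D%:R * (pip_A P *m map_mx intr (vec y)) i 0 = (\sum_(0 <= j < n) ai i j * y j)%:R)%R.
Proof.
rewrite mxE mulr_sumr big_mkord natr_sum; apply: eq_bigr => j _.
by rewrite !mxE natrM aintE mulrA.
Qed.

Lemma scaled_objective y :
  (D%:R * objective P (vec y) = (\sum_(0 <= j < n) ci j * y j)%:R)%R.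
Proof.
rewrite /objective mxE mulr_sumr big_mkord natr_sum; apply: eq_bigr => j _.
by rewrite !mxE natrM cintE mulrA.
Qed.

Lemma feasible_vec y : feasible P (vec y) <->
  (forall i, i < m -> \sum_(0 <= j < n) ai i j * y j <= bi i) /\
  (forall (j : 'I_n) u, pip_d P j = Some u -> y j <= u).
Proof.
have E (i : 'I_m) : ((pip_A P *m map_mx intr (vec y)) i 0 <= pip_b P i 0)%R =
    (\sum_(0 <= j < n) ai i j * y j <= bi i).
  by rewrite -(ler_pM2l D0) scaled_load -bintE ler_nat.
split=> [[h1 _ h3]|[h1 h3]].
  split=> [i im|j u /h3]; last by rewrite mxE lez_nat.
  by have := h1 (Ordinal im); rewrite E.
by split=> [i|j|j u /h3]; rewrite ?E ?h1 ?mxE.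
Qed.

Lemma feasible_is_vec (x : 'cV[int]_n) : feasible P x -> exists y, x = vec y.
Proof.
case=> _ x0 _; exists (fun j => oapp (fun j : 'I_n => `|x j 0%R|%N) 0 (insub j)).
apply/matrixP => j k; rewrite ord1 !mxE valK /=; apply/eqP.
by rewrite gez0_abs.
Qed.

Hypothesis sparse : two_column_sparse P.

Lemma aint_sparse j : #|[set i : 'I_q | ai i j != 0]| <= 2.
Proof.
have [jn|nj] := ltnP j n; last first.
  rewrite (_ : [set _ | _] = set0) ?cards0 //; apply/setP => i.
  by rewrite !inE /aint [j < n]ltnNge nj andbF.
have mq : m <= q.
  apply: leq_trans Lq; rewrite size_encode (_ : in_m e = m) //; set t := m * _; lia.
apply: leq_trans (sparse (Ordinal jn)).
apply: leq_trans (leq_imset_card (widen_ord mq) _); apply: subset_leq_card.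
apply/subsetP => i; rewrite inE => a0.
have im : i < m by move: a0; rewrite /aint; case: (i < m).
apply/imsetP; exists (Ordinal im); last exact: val_inj.
rewrite inE; apply: contra a0 => /eqP A0.
by rewrite -(eqr_nat rat) (aintE (Ordinal im) (Ordinal jn)) A0 mulr0.
Qed.

Lemma encode_approx : let x := vec (evalP L main_prog (env0 e) (mem0 e) 0) in
  feasible P x /\ forall y, optimal P y -> (4 * objective P y <= 15 * objective P x)%R.
Proof.
have [||U hU] := @main_prog_ok e size_encode aint_sparse.
- move=> i j im jn; rewrite (_ : 3 + _ = 2 + (2 * (Ordinal im * n + Ordinal jn) + 1)).
    by rewrite encode_A // absz_gt0 denq_eq0.
  by rewrite /=; change (in_n e) with n; lia.
- by move=> i im; rewrite (encode_b (Ordinal im)) // absz_gt0 denq_eq0.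
set x := evalP _ _ _ _ _ => -[xU xb xopt].
have nq : n < q.
  apply: leq_trans Lq; rewrite size_encode (_ : in_n e = n) //; set t := _ * n; lia.
have fx : feasible P (vec x).
  apply/feasible_vec; split=> // j u dj; apply: leq_trans (xU j (ltn_ord j)) _.
  apply: leq_trans (us_le0 hU (ltn_trans (ltn_ord j) nq)) _.
  rewrite /ubound0 (_ : j < in_n e) // !ginE -{1}[2 * j]addn0 !(encode_d j) // dj /=.
  by rewrite leqnn.
split=> // yv [fy yopt]; have [y yE] := feasible_is_vec fy; subst yv.
have [yb yd] := (feasible_vec y).1 fy.
(* For a null column without bound and without cost, [U j] is 0 while [y j] is arbitrary; clearing
   costless variables preserves feasibility and value. *)
pose y' j := if ci j == 0 then 0 else y j.
have cy' : \sum_(0 <= j < n) ci j * y' j = \sum_(0 <= j < n) ci j * y j.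
  by apply: eq_bigr => j _; rewrite /y'; case: eqP => [->|].
suff y'U j : j < n -> y' j <= U j.
  have := xopt y' y'U; rewrite cy' => h.
  have {}h : 4 * \sum_(0 <= j < n) ci j * y j <= 15 * \sum_(0 <= j < n) ci j * x j.
    apply: h => i im; apply: leq_trans (yb i im); apply: leq_sum => j _.
    by rewrite leq_mul2l /y'; case: (ci j == 0); rewrite ?leqnn orbT.
  rewrite -(ler_pM2l D0) !(mulrCA D%:R%R) !scaled_objective.
  by rewrite -!natrM ler_nat.
rewrite /y' => jn; case: (eqVneq (ci j) 0) => // cj0.
have jq : j < q := ltn_trans jn nq.
have ya i : i < q -> ai i j != 0 -> y j * ai i j <= bi i.
  move=> iq a0; have im : i < m by move: a0; rewrite /aint; case: (i < m).
  apply: leq_trans (yb i im); rewrite (bigD1_seq j) ?iota_uniq ?mem_index_iota //=.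
  by rewrite mulnC leq_addr.
(* Whichever constraint determines [U j], the feasible [y] satisfies it. *)
case: (us_att hU jq) => [->|[i iq [a0 ->]]]; last by rewrite leq_divRL ?lt0n ?ya.
rewrite /ubound0 (_ : j < in_n e) // !ginE -{1}[2 * j]addn0 !(encode_d (Ordinal jn)) //.
case dj : (pip_d P (Ordinal jn)) => [u|] /=; first exact: yd dj.
case: ifP => [|/negbFE].
  rewrite sum_nat_seq_neq0 => /hasP[i]; rewrite mem_index_iota /= => iq a0.
  rewrite (bigD1_seq i) ?iota_uniq ?mem_index_iota //=.
  apply: leq_trans (leq_addr _ _); apply: leq_trans (ya i iq a0).
  by rewrite leq_pmulr // lt0n.
(* a null column without a multiplicity bound and with a positive cost makes
   the program unbounded, so it contradicts the optimality of [y] *)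
rewrite sum_nat_seq_eq0 => /allP a0; exfalso.
pose z k := y k + (k == j).
have zsum F : \sum_(0 <= k < n) F k * z k = F j + \sum_(0 <= k < n) F k * y k.
  rewrite (bigD1_seq j) ?iota_uniq ?mem_index_iota //=.
  rewrite [in RHS](bigD1_seq j) ?iota_uniq ?mem_index_iota //= addnA /z eqxx; congr (_ + _).
    by rewrite addn1 mulnS.
  by apply: eq_bigr => k /negbTE->; rewrite addn0.
have fz : feasible P (vec z).
  apply/feasible_vec; split=> [i im|k u dk].
    have iq : i < q.
      apply: leq_trans im (leq_trans _ Lq); rewrite size_encode (_ : in_m e = m) //.
      by set t := m * _; lia.
    rewrite zsum; have := a0 i; rewrite mem_index_iota /= => /(_ iq)/eqP->.
    exact: yb.
  rewrite /z; case: (eqVneq (k : nat) j) => [E|_]; last by rewrite addn0 (yd _ _ dk).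
  by move: dk; rewrite (_ : k = Ordinal jn) ?dj //; apply: val_inj.
have := yopt _ fz; rewrite -(ler_pM2l D0) !scaled_objective zsum ler_nat.
by move: cj0; rewrite -lt0n; lia.
Qed.
End Encode.

(** One vector for all tapes: the empty tape gives the deterministic claim, and the expectation of
    the randomized one is that of a constant. The inequality is kept in [rat], so that [R] enters
    only at the end. *)
Lemma approx_15_4 : exists (c : cmd) (p : {poly nat}), forall m n (P : pip m n),
  two_column_sparse P -> exists2 x : 'cV[int]_n,
    forall t, computes c (encode P) t (p.[bitsize (encode P)])%R x &
    feasible P x /\ forall y, optimal P y -> (4 * objective P y <= 15 * objective P x)%R.
Proof.
have [p hp] := machine_ok wf_main; exists (machine main_prog), p => m n P sp.
exists (vec n (evalP (in_L (encode P)) main_prog (env0 (encode P)) (mem0 (encode P)) 0)).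
  move=> t; have [k [s' [h1 h2 h3]]] := hp (encode P) t (size_encode P).
  exists k, s'; split=> //; apply/matrixP => j l; rewrite !mxE h3 //.
  rewrite size_encode (_ : in_n _ = n) //; have := ltn_ord j; set t' := _ * n; lia.
exact: encode_approx.
Qed.

Local Open Scope ring_scope.

Lemma ratr_ratio (R : rcfType) (alpha : R) (a b : rat) : 15 / 4 <= alpha ->
  0 <= b -> 4 * a <= 15 * b -> alpha^-1 * ratr a <= ratr b.
Proof.
move=> ha b0 hab; have al0 : 0 < alpha by apply: lt_le_trans ha; lra.
rewrite mulrC ler_pdivrMr //; apply: le_trans (_ : ratr b * (15 / 4) <= _); last first.
  by apply: ler_wpM2l => //; rewrite ler0q.
have : ratr (4 * a) <= ratr (15 * b) :> R by rewrite ler_rat.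
by rewrite !rmorphM /= !ratr_nat; lra.
Qed.

Lemma objective_ge0 m n (P : pip m n) x : feasible P x -> 0 <= objective P x.
Proof.
case=> _ x0 _; rewrite /objective mxE; apply: sumr_ge0 => j _.
by rewrite mulr_ge0 ?pip_c_ge0 // mxE ler0z.
Qed.

Theorem theorem5 (R : rcfType) :
  det_poly_approx (4 : R) (fun m n (P : pip m n) => two_column_sparse P) /\
  rand_poly_approx (6 - Num.sqrt 5 : R)
    (fun m n (P : pip m n) =>
       [/\ two_column_sparse P, simple_pip P & unit_multiplicity P]).
Proof.
have [c [p H]] := approx_15_4; split.
  exists c, p => m n P sp; have [x cx [fx ox]] := H m n P sp.
  exists x; split=> // y /ox; apply: ratr_ratio; last exact: objective_ge0.
  by lra.
exists c, p => m n P [sp _ _] T; have [x cx [fx ox]] := H m n P sp.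
exists (fun=> x); split=> [t||y /ox h]; [exact: cx|by []|].
have -> : (2 ^+ T)^-1 * (\sum_(t : T.-tuple bool) ratr (objective P x)) =
    ratr (objective P x) :> R.
  rewrite sumr_const card_tuple card_bool -[X in _ * X = _]mulr_natl natrX mulKf //.
  by rewrite expf_neq0 // pnatr_eq0.
apply: ratr_ratio h; last exact: objective_ge0.
have s0 : 0 <= Num.sqrt 5 :> R by apply: sqrtr_ge0.
have s2 : Num.sqrt 5 ^+ 2 = 5 :> R by rewrite sqr_sqrtr // ler0n.
(* Since [5 <= 81 / 16]; this is [15 / 4 <= 6 - Num.sqrt 5]. *)
have : Num.sqrt 5 <= 9 / 4 :> R.
  rewrite -(@ler_pXn2r _ 2) ?nnegrE //; last by lra.
  by rewrite s2; lra.
by lra.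
Qed.
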